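(* There exist absolute constants $C,k>0$ such that for every prime power $q$ and every subset $A\subseteq\mathbb{F}_q$ satisfying \[ |A| > C\, q^{\frac{2}{3}-\frac{1}{13542}}\,(\log q)^k, \] one has $|(A-A)(A-A)| > q/2$.
   Context: $\mathbb{F}_q$ is the finite field with $q$ elements. For $A\subseteq\mathbb{F}_q$, $(A-A)(A-A)=\{(a-b)(c-d): a,b,c,d\in A\}$. *)

(* Defs.v *)
From HB Require Import structures.
From mathcomp Require Import all_boot all_order all_algebra.
From mathcomp Require Import all_classical all_reals all_analysis.

Set Implicit Arguments.
Unset Strict Implicit.
Unset Printing Implicit Defensive.

Import Order.TTheory GRing.Theory Num.Theory.

Local Open Scope ring_scope.

Definition diffset (F : finFieldType) (A B : {set F}) : {set F} :=
  [set a - b | a in A, b in B].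

Definition prodset (F : finFieldType) (A B : {set F}) : {set F} :=
  [set x * y | x in A, y in B].

(* Main.v *)
(* Suppose that [|(A-A)(A-A)| <= q/2].  The number of solutions of
   [(a-b)(c-d) = (a'-b')(c'-d')] is the second moment over [x] of the energies
   [E(A, xA)], whose total excess over their expected value is at most
   [q |A|^2].  Hence [E(A, xA)] is nearly [|A|^3] for a set [X] of about
   [q^(1/3)] dilations [x].  The Balog-Szemeredi-Gowers theorem, with an argument
   of Bourgain that makes the sets independent of [x], gives a large subset [A'] of
   [A] with [|A' - x A'|] comparable to [|A'|] for all [x] in a dilate of a large
   subset [Y] of [X].  By Plunnecke's inequality the same holds for the values of
   short polynomial expressions in [Y], but only about [q^(1/3)] field elements
   have this property; a pivoting argument then forces
   [G = (Y-Y)/(Y-Y)] to be a subfield, and [|G|^3 = q] by cardinality.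

   The energies [E(A, xA)], [x] in a dilate of [G], count pairs of points of [A]
   by direction over [G]; so many directions carry rich lines, and two of them
   produce a plane over [G] in which [A] has density [q^(-eps)].  On two lines
   of this plane with given directions, a Kloosterman-type estimate in [G] shows
   that products of differences take all the values that the directions allow.
   Therefore [(A-A)(A-A)] contains a dilate of the set of products of two elements
   of a plane [G + Gt]; these are the multiples of the split quadratics in [t],
   and there are more than [|G|^3 / 2] of them. *)
Require Import Defs.
From mathcomp Require Import all_boot all_order all_algebra.
From mathcomp Require Import ring lra zify.

Set Implicit Arguments.
Unset Strict Implicit.
Unset Printing Implicit Defensive.

Import Order.TTheory GRing.Theory Num.Theory.

Local Open Scope ring_scope.

(** * Averages and popularity *)

(** The exponent 2/3 and the factor 1/2 meet in one example: if q = p^3 and G is the subfield of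
    order p, a plane G + Gt has q^(2/3) elements, and its products fill only slightly more than half
    of the field. So a subfield of this size is no contradiction in itself. It has to be recovered
    exactly, not merely up to the losses, because the final count has almost nothing to spare.

    The size of the saving is decided at the pivot. Let u be the basic loss and p = q^(1/3).
    Balog-Szemeredi-Gowers is applied with losses in u^4, the common set then has distortion about
    the 56th power of that, and the pivot raises this to the 18th power; 4 * 56 * 18 = 4032. With
    the losses in the sizes of the sets, the argument needs u^4078 < p, for which 4100 leaves a
    margin. As u = q^(1/N), this amounts to N >= 3 * 4100. *)

Lemma sum1_card_set (R : realFieldType) (I : finType) (P : {set I}) :
  \sum_(i in P) (1 : R) = #|P|%:R.
Proof. by rewrite sumr_const. Qed.

Lemma sum_sqr_dev (R : realFieldType) (I : finType) (P : {set I}) (f : I -> R)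
    (c : R) :
  \sum_(i in P) (f i - c) ^+ 2 =
  \sum_(i in P) f i ^+ 2 - 2 * c * (\sum_(i in P) f i) + c ^+ 2 * #|P|%:R.
Proof.
rewrite -sum1_card_set !mulr_sumr -sumrB -big_split /=.
by apply: eq_bigr => i _; ring.
Qed.

Lemma sqr_sum_le (R : realFieldType) (I : finType) (P : {set I}) (f : I -> R) :
  (\sum_(i in P) f i) ^+ 2 <= #|P|%:R * \sum_(i in P) f i ^+ 2.
Proof.
have [->|nz] := eqVneq P set0.
  by rewrite !big_set0 cards0 mul0r expr2 mul0r.
have P_gt0 : 0 < #|P|%:R :> R by rewrite ltr0n card_gt0.
set S := \sum_(i in P) f i; set n : R := #|P|%:R in P_gt0 *.
have := sum_sqr_dev P f (S / n); rewrite -/S -/n => dev.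
have dev_ge0 : 0 <= \sum_(i in P) (f i - S / n) ^+ 2.
  by apply: sumr_ge0 => i _; apply: sqr_ge0.
have e : 2 * (S / n) * S - (S / n) ^+ 2 * n = S ^+ 2 / n.
  by field; rewrite gt_eqF.
have le1 : S ^+ 2 / n <= \sum_(i in P) f i ^+ 2 by lra.
by rewrite mulrC -ler_pdivrMr.
Qed.

(** Used backwards: a large sum of terms bounded by [M] forces many terms above the threshold
    [t]. *)
Lemma sum_le_popular (R : realFieldType) (I : finType) (P : {set I})
    (f : I -> R) (t M : R) :
  0 <= t -> (forall i, i \in P -> f i <= M) ->
  \sum_(i in P) f i <= t * #|P|%:R + M * #|[set i in P | t <= f i]|%:R.
Proof.
move=> t0 fM; rewrite (bigID (fun i => t <= f i)) /= addrC; apply: lerD.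
  rewrite -sum1_card_set mulr_sumr big_mkcondr /=.
  by apply: ler_sum => i _; rewrite mulr1; have [//|/ltW] := lerP t (f i).
rewrite -sum1_card_set mulr_sumr.
rewrite [leRHS](eq_bigl (fun i => (i \in P) && (t <= f i))); last first.
  by move=> i; rewrite inE.
by apply: ler_sum => i /andP[iP _]; rewrite mulr1 fM.
Qed.

Lemma exists_ge_avg (R : realFieldType) (I : finType) (P : {set I})
    (f : I -> R) (S : R) :
  P != set0 -> S <= \sum_(i in P) f i ->
  exists2 i, i \in P & S <= f i * #|P|%:R.
Proof.
move=> /set0Pn[i0 i0P] leS.
case: (boolP [exists i in P, S <= f i * #|P|%:R]) => [/exists_inP//|].
rewrite negb_exists_in => /forall_inP no.
have n0 : 0 < #|P|%:R :> R by rewrite ltr0n; apply/card_gt0P; exists i0.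
have : \sum_(i in P) f i < \sum_(i in P) (S / #|P|%:R).
  apply: ltr_sum; last by move=> i iP; rewrite ltr_pdivlMr // ltNge no.
  by apply/hasP; exists i0; rewrite ?mem_index_enum.
rewrite sumr_const -(mulr_natr (S / _)) mulfVK ?gt_eqF // => lt.
by have := lt_le_trans lt leS; rewrite ltxx.
Qed.

Lemma sum_card_fibre (R : realFieldType) (I T : finType) (X : {set I})
    (P : I -> {set T}) (Q : {set T}) :
  \sum_(i in X) #|P i :&: Q|%:R =
  \sum_(w in Q) #|[set i in X | w \in P i]|%:R :> R.
Proof.
have e i : #|P i :&: Q|%:R = \sum_(w in Q) (w \in P i)%:R :> R.
  rewrite -sum1_card_set big_mkcond [RHS]big_mkcond; apply: eq_bigr => w _.
  by rewrite inE; case: (w \in P i); case: (w \in Q).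
rewrite (eq_bigr _ (fun i _ => e i)) exchange_big /=; apply: eq_bigr => w _.
rewrite -sum1_card_set [LHS]big_mkcond [RHS]big_mkcond; apply: eq_bigr => i _.
by rewrite inE; case: (w \in P i); case: (i \in X).
Qed.

(** On average a point of [Om] lies in at least [al * #|X|] of the sets. By Cauchy-Schwarz the
    second moment of these degrees, which is the sum of all [#|P i :&: P j|], is at least
    [al ^+ 2 * #|X| ^+ 2 * #|Om|]. An index [i0] with at least the average share meets many [P j] in
    a popular amount. *)
Lemma popular_intersection (R : realFieldType) (I T : finType) (X : {set I})
    (Om : {set T}) (P : I -> {set T}) (al : R) :
  X != set0 -> Om != set0 -> 0 <= al ->
  (forall i, i \in X -> P i \subset Om /\ al * #|Om|%:R <= #|P i|%:R) ->
  exists2 i0, i0 \in X &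
    al ^+ 2 / 2 * #|X|%:R <=
    #|[set i in X | al ^+ 2 / 2 * #|Om|%:R <= #|P i0 :&: P i|%:R]|%:R.
Proof.
move=> Xn0 On0 al0 hP.
have N0 : 0 < #|X|%:R :> R by rewrite ltr0n card_gt0.
have M0 : 0 < #|Om|%:R :> R by rewrite ltr0n card_gt0.
set N : R := #|X|%:R in N0 *; set M : R := #|Om|%:R in M0 hP *.
pose deg w : R := #|[set i in X | w \in P i]|%:R.
have degS : al * N * M <= \sum_(w in Om) deg w.
  rewrite -sum_card_fibre -/N mulrAC -[N]sum1_card_set mulr_sumr.
  apply: ler_sum => i iX; rewrite mulr1.
  by have [/setIidPl -> ->] := hP i iX.
have deg2 : al ^+ 2 * N ^+ 2 * M <= \sum_(w in Om) deg w ^+ 2.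
  have := sqr_sum_le Om deg; rewrite -/M => cs.
  have : (al * N * M) ^+ 2 <= M * \sum_(w in Om) deg w ^+ 2.
    by apply: le_trans cs; rewrite ler_sqr ?nnegrE ?sumr_ge0 // !mulr_ge0 // ltW.
  rewrite -ler_pdivrMl // => le; apply: le_trans le.
  by rewrite le_eqVlt; apply/orP; left; apply/eqP; field; rewrite gt_eqF.
have dbl : \sum_(w in Om) deg w ^+ 2 =
    \sum_(i in X) \sum_(j in X) #|P i :&: P j|%:R.
  have e i : i \in X -> \sum_(j in X) #|P i :&: P j|%:R =
      \sum_(w in Om) (w \in P i)%:R * deg w.
    move=> iX; under eq_bigr => j _ do rewrite setIC.
    rewrite sum_card_fibre (eq_bigr (fun w => (w \in P i)%:R * deg w)).
      rewrite [RHS](bigID [in P i]) /= [X in _ + X]big1 ?addr0.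
        apply: eq_bigl => w; rewrite andbC; case wP: (w \in P i) => //=.
        by have [/subsetP/(_ w wP)] := hP i iX.
      by move=> w /andP[_ /negbTE->]; rewrite mul0r.
    by move=> w ->; rewrite mul1r.
  rewrite (eq_bigr _ e) exchange_big /=; apply: eq_bigr => w _.
  rewrite -mulr_suml expr2; congr (_ * _).
  rewrite /deg -sum1_card_set [RHS](bigID (fun i => w \in P i)) /=.
  rewrite [X in _ + X]big1 ?addr0; last by move=> i /andP[_ /negbTE->].
  by apply: eq_big => [i|i]; rewrite inE // => /andP[_ ->].
rewrite dbl in deg2.
have [i0 i0X le0] := exists_ge_avg Xn0 deg2.
exists i0 => //; set Y := [set _ in X | _].
have le1 : \sum_(j in X) #|P i0 :&: P j|%:R
    <= al ^+ 2 / 2 * M * N + M * #|Y|%:R :> R.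
  apply: sum_le_popular => [|j jX].
    by rewrite mulr_ge0 ?divr_ge0 ?sqr_ge0 // ltW.
  rewrite ler_nat subset_leq_card // (subset_trans (subsetIl _ _)) //.
  by have [] := hP i0 i0X.
have le2 : al ^+ 2 * N ^+ 2 * M <= (al ^+ 2 / 2 * M * N + M * #|Y|%:R) * N.
  by apply: le_trans le0 _; rewrite ler_wpM2r // ltW.
have MN0 : 0 < M * N by rewrite mulr_gt0.
rewrite -(ler_pM2r MN0).
rewrite -subr_ge0 in le2; rewrite -subr_ge0.
suff -> : #|Y|%:R * (M * N) - al ^+ 2 / 2 * N * (M * N) =
  (al ^+ 2 / 2 * M * N + M * #|Y|%:R) * N - al ^+ 2 * N ^+ 2 * M by [].
by field.
Qed.

(** * Paths of length three *)

Lemma card_ge_markov (R : realFieldType) (I : finType) (P : {set I})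
    (f : I -> R) (t : R) :
  (forall i, i \in P -> 0 <= f i) ->
  t * #|[set i in P | t <= f i]|%:R <= \sum_(i in P) f i.
Proof.
move=> f0; rewrite -sum1_card_set mulr_sumr [leRHS](bigID (fun i => t <= f i)) /=.
rewrite -[leLHS]addr0; apply: lerD; last by apply: sumr_ge0 => i /andP[/f0].
rewrite [leLHS](eq_bigl (fun i => (i \in P) && (t <= f i))); last first.
  by move=> i; rewrite inE.
by apply: ler_sum => i /andP[_]; rewrite mulr1.
Qed.

Lemma card_setX_filter (R : realFieldType) (T U : finType) (A : {set T})
    (B : {set U}) (P : T -> U -> bool) :
  #|[set p in setX A B | P p.1 p.2]|%:R =
  \sum_(a in A) \sum_(b in B) (P a b)%:R :> R.
Proof.
rewrite pair_big_dep /= -sum1_card_set big_mkcond [RHS]big_mkcond.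
apply: eq_bigr => -[a b] _; rewrite !inE /=.
by case: (a \in A); case: (b \in B); case: (P a b).
Qed.

(* Paths of length three in a dense bipartite graph: most pairs in a suitable
   neighbourhood have many common neighbours, and a vertex of [B] adjacent to
   a positive proportion of that neighbourhood is reached through them. *)
Lemma many_paths_of_length_three (R : realFieldType) (T U : finType)
    (A : {set T}) (B : {set U}) (E : T -> U -> bool) (k : R) :
  A != set0 -> B != set0 -> 0 < k ->
  #|A|%:R * #|B|%:R <= k * \sum_(a in A) \sum_(b in B) (E a b)%:R ->
  exists (A' : {set T}) (B' : {set U}), [/\ A' \subset A, B' \subset B,
    #|A|%:R <= 6 * k * #|A'|%:R, #|B|%:R <= 4 * k * #|B'|%:R &
    forall a b, a \in A' -> b \in B' ->
    #|A|%:R * #|B|%:R <= 3072 * k ^+ 5 *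
      #|[set p in setX A B | [&& E a p.2, E p.1 p.2 & E p.1 b]]|%:R].
Proof.
move=> An0 Bn0 k0 edges.
have kn0 : k != 0 by rewrite gt_eqF.
have n0 : 0 < #|A|%:R :> R by rewrite ltr0n card_gt0.
have m0 : 0 < #|B|%:R :> R by rewrite ltr0n card_gt0.
set n : R := #|A|%:R in n0 edges *; set m : R := #|B|%:R in m0 edges *.
pose e a b : R := (E a b)%:R.
have e0 a b : 0 <= e a b by rewrite ler0n.
have e1 a b : e a b <= 1 by rewrite /e; case: (E a b).
pose deg a := \sum_(b in B) e a b.
have degm a : deg a <= m.
  by rewrite /m -sum1_card_set; apply: ler_sum => b _; apply: e1.
(* Vertices of low degree carry at most half of the edges. Without them every vertex has at least
   m/(2k) neighbours, which later makes [B'] large. *)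
pose A0 := [set a in A | m / (2 * k) <= deg a].
have A0A : A0 \subset A by apply/subsetP => a; rewrite inE => /andP[].
have A0n : #|A0|%:R <= n by rewrite ler_nat subset_leq_card.
have sum0 : n * m <= 2 * k * \sum_(a in A0) deg a.
  have : \sum_(a in A) deg a <= m / (2 * k) * n + \sum_(a in A0) deg a.
    rewrite (bigID (fun a => m / (2 * k) <= deg a)) /= addrC; apply: lerD.
      rewrite /n -sum1_card_set mulr_sumr big_mkcondr /=.
      apply: ler_sum => i _; rewrite mulr1; have [_|/ltW //] := lerP (m / (2 * k)) (deg i).
      by rewrite /= divr_ge0 ?mulr_ge0 ?(ltW m0) ?(ltW k0).
    by rewrite le_eqVlt; apply/orP; left; apply/eqP/eq_bigl => a; rewrite inE.
  move=> le; have := le_trans edges (ler_wpM2l (ltW k0) le).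
  have -> : k * (m / (2 * k) * n + \sum_(a in A0) deg a) =
     n * m / 2 + k * \sum_(a in A0) deg a by field.
  lra.
pose r b := \sum_(a in A0) e a b.
have sumr : \sum_(b in B) r b = \sum_(a in A0) deg a by rewrite exchange_big.
have sumr2 : n ^+ 2 * m <= 4 * k ^+ 2 * \sum_(b in B) r b ^+ 2.
  have cs := sqr_sum_le B r; rewrite sumr -/m in cs.
  have : (n * m) ^+ 2 <= (2 * k * \sum_(a in A0) deg a) ^+ 2.
    rewrite ler_sqr ?nnegrE //; first by rewrite mulr_ge0 // ltW.
    by rewrite !mulr_ge0 ?(ltW k0) // sumr_ge0 // => a _; apply: sumr_ge0.
  move=> le; have k20 : 0 <= 4 * k ^+ 2 by rewrite mulr_ge0 ?sqr_ge0.
  have := ler_wpM2l k20 cs => le2; rewrite -(ler_pM2r m0); lra.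
pose codeg a a' := \sum_(b in B) e a b * e a' b.
have codeg0 a a' : 0 <= codeg a a' by apply: sumr_ge0 => b _; rewrite mulr_ge0.
(* With this value 16 k times the total of [badn] is at most half the lower bound for the total of
   [r b ^+ 2], so that some [b0] keeps a large difference. *)
pose ep := (128 * k ^+ 3)^-1.
have k30 : 0 < 128 * k ^+ 3 by rewrite mulr_gt0 ?exprn_gt0.
have ep0 : 0 < ep by rewrite invr_gt0.
pose bad a a' : R := (codeg a a' < ep * m)%R%:R.
have bad0 a a' : 0 <= bad a a' by rewrite ler0n.
pose badn b := \sum_(a in A0) \sum_(a' in A0) e a b * e a' b * bad a a'.
have sumbad : \sum_(b in B) badn b <= ep * m * n ^+ 2.
  have -> : \sum_(b in B) badn b =
      \sum_(a in A0) \sum_(a' in A0) codeg a a' * bad a a'.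
    rewrite exchange_big /=; apply: eq_bigr => a _.
    rewrite exchange_big /=; apply: eq_bigr => a' _.
    by rewrite mulr_suml.
  apply: (@le_trans _ _ (\sum_(a in A0) \sum_(a' in A0) ep * m)).
    apply: ler_sum => a _; apply: ler_sum => a' _; rewrite /bad.
    have [/ltW|_] := ltrP (codeg a a') (ep * m); rewrite ?mulr1 ?mulr0 //.
    by rewrite mulr_ge0 // ltW.
  rewrite !sumr_const -[X in X <= _]mulr_natr -[_ *+ _]mulr_natr -mulrA.
  rewrite ler_wpM2l ?mulr_ge0 ?(ltW ep0) ?(ltW m0) // expr2.
  by apply: ler_pM.
have [b0 b0B hb0] : exists2 b, b \in B &
    n ^+ 2 / (8 * k ^+ 2) <= r b ^+ 2 - 16 * k * badn b.
  have le : n ^+ 2 / (8 * k ^+ 2) * m <= \sum_(b in B) (r b ^+ 2 - 16 * k * badn b).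
    rewrite sumrB -mulr_sumr.
    have h1 : n ^+ 2 * m / (4 * k ^+ 2) <= \sum_(b in B) r b ^+ 2.
      by rewrite ler_pdivrMr ?mulr_gt0 ?exprn_gt0 // [leRHS]mulrC.
    have h2 : 16 * k * \sum_(b in B) badn b <= 16 * k * (ep * m * n ^+ 2).
      by rewrite ler_wpM2l // mulr_ge0 // ltW.
    have h3 : n ^+ 2 / (8 * k ^+ 2) * m =
        n ^+ 2 * m / (4 * k ^+ 2) - 16 * k * (ep * m * n ^+ 2).
      by rewrite /ep; field.
    by rewrite h3; lra.
  have [b bB hb] := exists_ge_avg Bn0 le; exists b => //.
  by move: hb; rewrite ler_pM2r.
pose A1 := [set a in A0 | E a b0].
have A1A0 : A1 \subset A0 by apply/subsetP => a; rewrite inE => /andP[].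
have sumA1 f : \sum_(a in A0) e a b0 * f a = \sum_(a in A1) f a.
  rewrite [LHS]big_mkcond [RHS]big_mkcond; apply: eq_bigr => a _.
  by rewrite !inE /e; case: (E a b0); rewrite ?mul1r ?mul0r ?andbT ?andbF //=; case: ifP.
have rA1 : r b0 = #|A1|%:R.
  by rewrite -sum1_card_set -sumA1; apply: eq_bigr => a _; rewrite mulr1.
have badA1 : badn b0 = \sum_(a in A1) \sum_(a' in A1) bad a a'.
  rewrite -sumA1; apply: eq_bigr => a _; rewrite -sumA1 mulr_sumr.
  by apply: eq_bigr => a' _; rewrite mulrA.
set n1 : R := #|A1|%:R in rA1.
rewrite rA1 badA1 in hb0.
have n1_ge : n <= 3 * k * n1.
  have badge0 : 0 <= 16 * k * \sum_(a in A1) \sum_(a' in A1) bad a a'.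
    rewrite !mulr_ge0 ?(ltW k0) // sumr_ge0 // => a _; exact: sumr_ge0.
  have : n ^+ 2 / (8 * k ^+ 2) <= n1 ^+ 2 by lra.
  rewrite ler_pdivrMr ?mulr_gt0 ?exprn_gt0 // => le.
  rewrite -ler_sqr ?nnegrE ?(ltW n0) ?mulr_ge0 ?(ltW k0) //.
  have : 0 <= n1 ^+ 2 * k ^+ 2 by rewrite mulr_ge0 ?sqr_ge0.
  by lra.
have n1_gt0 : 0 < n1.
  by have := lt_le_trans n0 n1_ge; rewrite pmulr_rgt0 // mulr_gt0.
(* The weight 16 k in [hb0] lets Markov put at most half of [A1] into [A2]. Any other vertex has at
   most n1/(8k) bad partners, half of the n1/(4k) neighbours that a vertex of [B'] has in [A1]. *)
pose A2 := [set a in A1 | n1 / (8 * k) <= \sum_(a' in A1) bad a a'].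
have A2n : 2 * #|A2|%:R <= n1.
  have le : n1 / (8 * k) * #|A2|%:R <=
      \sum_(a in A1) \sum_(a' in A1) bad a a'.
    by apply: card_ge_markov => a _; apply: sumr_ge0.
  pose Sb := \sum_(a in A1) \sum_(a' in A1) bad a a'.
  rewrite -/Sb in hb0 le.
  have q0 : 0 <= n ^+ 2 / (8 * k ^+ 2) by rewrite divr_ge0 ?sqr_ge0 // mulr_ge0 ?sqr_ge0.
  have : 16 * k * (n1 / (8 * k) * #|A2|%:R) <= n1 ^+ 2.
    by apply: (le_trans (ler_wpM2l _ le)); [rewrite mulr_ge0 // ltW | lra].
  have -> : 16 * k * (n1 / (8 * k) * #|A2|%:R) = n1 * (2 * #|A2|%:R) by field.
  by rewrite expr2 ler_pM2l.
exists (A1 :\: A2), [set b in B | n1 / (4 * k) <= \sum_(a in A1) e a b].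
split.
- by apply: subset_trans (subsetDl _ _) _; apply: subset_trans A0A.
- by apply/subsetP => b; rewrite inE => /andP[].
- have A2A1 : A2 \subset A1 by apply/subsetP => a; rewrite inE => /andP[].
  have : #|A1 :\: A2|%:R = n1 - #|A2|%:R :> R.
    by rewrite cardsD (setIidPr A2A1) natrB // subset_leq_card.
  move=> ->; have : k * (2 * #|A2|%:R) <= k * n1 by rewrite ler_wpM2l // ltW.
  by lra.
- set B' := [set b in B | _].
  have le1 : \sum_(b in B) \sum_(a in A1) e a b <= n1 / (4 * k) * m + n1 * #|B'|%:R.
    apply: sum_le_popular => [|b _]; first by rewrite divr_ge0 ?mulr_ge0 ?(ltW k0) ?(ltW n1_gt0).
    by rewrite /n1 -sum1_card_set; apply: ler_sum.
  have le2 : n1 * (m / (2 * k)) <= \sum_(b in B) \sum_(a in A1) e a b.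
    rewrite exchange_big /= /n1 -sum1_card_set mulr_suml.
    apply: ler_sum => a aA1; rewrite mul1r.
    by have := subsetP A1A0 _ aA1; rewrite inE => /andP[].
  have : n1 * (m / (4 * k)) <= n1 * #|B'|%:R.
    have -> : n1 * (m / (4 * k)) = n1 * (m / (2 * k)) - n1 / (4 * k) * m by field.
    by lra.
  by rewrite ler_pM2l // ler_pdivrMr ?mulr_gt0 // mulrC.
move=> a b /setDP[aA1 aA2]; rewrite inE => /andP[bB hb].
rewrite (card_setX_filter R A B (fun a' b' => [&& E a b', E a' b' & E a' b])).
have fewbad : \sum_(a' in A1) bad a a' <= n1 / (8 * k).
  by apply: ltW; rewrite ltNge; move: aA2; rewrite inE aA1.
have -> : \sum_(a' in A) \sum_(b' in B) [&& E a b', E a' b' & E a' b]%:R =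
    \sum_(a' in A) e a' b * codeg a a'.
  apply: eq_bigr => a' _; rewrite mulr_sumr; apply: eq_bigr => b' _.
  rewrite /e; case: (E a b'); case: (E a' b'); case: (E a' b) => /=;
  by rewrite ?mulr1 ?mulr0.
have big : ep * m * (n1 / (8 * k)) <= \sum_(a' in A) e a' b * codeg a a'.
  apply: (@le_trans _ _ (\sum_(a' in A1) e a' b * codeg a a')); last first.
    rewrite [leRHS](big_setID A1) /= (setIidPr (subset_trans A1A0 A0A)).
    by rewrite lerDl sumr_ge0 // => a' _; rewrite mulr_ge0.
  apply: (@le_trans _ _ (\sum_(a' in A1) ep * m * (e a' b - bad a a'))).
    rewrite -mulr_sumr ler_wpM2l ?mulr_ge0 ?(ltW ep0) ?(ltW m0) // sumrB.
    have -> : n1 / (8 * k) = n1 / (4 * k) - n1 / (8 * k) by field.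
    by lra.
  apply: ler_sum => a' _; rewrite /bad /e.
  have emm : 0 <= ep * m by rewrite mulr_ge0 // ltW.
  have [_|le] := ltrP (codeg a a') (ep * m); case: (E a' b);
    rewrite ?subrr ?subr0 ?sub0r ?mulr1 ?mulr0 ?mul1r ?mul0r ?mulrN1 ?oppr_le0 //.
apply: (@le_trans _ _ (3072 * k ^+ 5 * (ep * m * (n1 / (8 * k))))); last first.
  by rewrite ler_wpM2l // mulr_ge0 // exprn_ge0 // ltW.
have -> : 3072 * k ^+ 5 * (ep * m * (n1 / (8 * k))) = (3 * k * n1) * m.
  by rewrite /ep; field.
by rewrite ler_pM2r.
Qed.

(** * Sumset inequalities *)

Definition sumset (F : finFieldType) (A B : {set F}) : {set F} :=
  [set a + b | a in A, b in B].

Definition dilate (F : finFieldType) (x : F) (A : {set F}) : {set F} :=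
  [set x * a | a in A].

Fixpoint nfold (F : finFieldType) (n : nat) (B : {set F}) : {set F} :=
  if n is m.+1 then sumset B (nfold m B) else [set 0].

Lemma diffsetP (F : finFieldType) (A B : {set F}) (z : F) :
  reflect (exists a b, [/\ a \in A, b \in B & z = a - b]) (z \in diffset A B).
Proof.
apply: (iffP imset2P) => [[a b aA bB ->]|[a [b [aA bB ->]]]].
  by exists a, b.
by exists a b.
Qed.

Lemma sumsetP (F : finFieldType) (A B : {set F}) (z : F) :
  reflect (exists a b, [/\ a \in A, b \in B & z = a + b]) (z \in sumset A B).
Proof.
apply: (iffP imset2P) => [[a b aA bB ->]|[a [b [aA bB ->]]]].
  by exists a, b.
by exists a b.
Qed.

Lemma mem_diffset (F : finFieldType) (A B : {set F}) a b :
  a \in A -> b \in B -> a - b \in diffset A B.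
Proof. by move=> aA bB; apply/diffsetP; exists a, b. Qed.

Lemma mem_sumset (F : finFieldType) (A B : {set F}) a b :
  a \in A -> b \in B -> a + b \in sumset A B.
Proof. by move=> aA bB; apply/sumsetP; exists a, b. Qed.

Lemma diffsetS (F : finFieldType) (A A' B B' : {set F}) :
  A \subset A' -> B \subset B' -> diffset A B \subset diffset A' B'.
Proof. by move=> sA sB; apply: imset2S. Qed.

Lemma card_dilate (F : finFieldType) (x : F) (A : {set F}) :
  x != 0 -> #|dilate x A| = #|A|.
Proof. by move=> x0; rewrite card_imset //; apply: mulfI. Qed.

Lemma dilate1 (F : finFieldType) (A : {set F}) : dilate 1 A = A.
Proof.
by rewrite /dilate -[RHS]imset_id; apply: eq_imset => a; rewrite mul1r.
Qed.

Lemma dilateM (F : finFieldType) (x y : F) (A : {set F}) :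
  dilate (x * y) A = dilate x (dilate y A).
Proof.
by rewrite /dilate -imset_comp; apply: eq_imset => a /=; rewrite mulrA.
Qed.

Lemma diffset_dilate (F : finFieldType) (x : F) (A B : {set F}) :
  diffset (dilate x A) (dilate x B) = dilate x (diffset A B).
Proof.
apply/setP => z; apply/diffsetP/imsetP.
  move=> [_ [_ [/imsetP[a aA ->] /imsetP[b bB ->] ->]]].
  by exists (a - b); rewrite ?mem_diffset ?mulrBr.
move=> [_ /diffsetP[a [b [aA bB ->]]] ->].
by exists (x * a), (x * b); rewrite mulrBr !imset_f.
Qed.

Lemma diffset_swap (F : finFieldType) (A B : {set F}) :
  diffset B A = [set - z | z in diffset A B].
Proof.
apply/setP => z; apply/diffsetP/imsetP => [[b [a [bB aA ->]]]|].
  by exists (a - b); rewrite ?mem_diffset ?opprB.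
by move=> [_ /diffsetP[a [b [aA bB ->]]] ->]; exists b, a; rewrite opprB.
Qed.

Lemma card_diffsetC (F : finFieldType) (A B : {set F}) :
  #|diffset A B| = #|diffset B A|.
Proof. by rewrite (diffset_swap A B) card_imset //; apply: oppr_inj. Qed.

Lemma sumsetA (F : finFieldType) (A B C : {set F}) :
  sumset A (sumset B C) = sumset (sumset A B) C.
Proof.
apply/setP => z; apply/sumsetP/sumsetP.
  move=> [a [_ [aA /sumsetP[b [c [bB cC ->]]] ->]]].
  by exists (a + b), c; rewrite mem_sumset ?addrA.
move=> [_ [c [/sumsetP[a [b [aA bB ->]]] cC ->]]].
by exists a, (b + c); rewrite mem_sumset ?addrA.
Qed.

(** Fix one representation d = y - z for each difference d. Then (x, d) |-> (y - x, x - z) is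
    injective: the sum of the two coordinates returns d, hence y, and then x. *)
Lemma ruzsa_triangle (F : finFieldType) (X Y Z : {set F}) :
  (#|X| * #|diffset Y Z| <= #|diffset Y X| * #|diffset X Z|)%N.
Proof.
pose r d := odflt (0, 0) [pick p in setX Y Z | p.1 - p.2 == d].
have rP d : d \in diffset Y Z ->
    [/\ (r d).1 \in Y, (r d).2 \in Z & (r d).1 - (r d).2 = d].
  case/diffsetP => y [z [yY zZ ->]]; rewrite /r.
  case: pickP => [[y' z'] /= /andP[]|/(_ (y, z))].
    by rewrite inE /= => /andP[-> ->] /eqP ->.
  by rewrite !inE /= yY zZ eqxx.
pose f (p : F * F) := ((r p.2).1 - p.1, p.1 - (r p.2).2).
rewrite -!cardsX -(@card_in_imset _ _ f).
  apply: subset_leq_card; apply/subsetP => _ /imsetP[[x d] /setXP[/= xX dD] ->].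
  by have [yY zZ _] := rP _ dD; rewrite /f inE /= !mem_diffset.
move=> [x d] [x' d'] /setXP[/= xX dD] /setXP[/= x'X d'D] [] e1 e2.
have [_ _ rd] := rP _ dD; have [_ _ rd'] := rP _ d'D.
have ed : d = d'.
  rewrite -rd -rd'; have : (r d).1 - x + (x - (r d).2) =
    (r d').1 - x' + (x' - (r d').2) by rewrite e1 e2.
  by rewrite !addrA !subrK.
by move: e1; rewrite ed => /addrI/oppr_inj ->.
Qed.

(** Induction on [C], adding one element c. Let [W] be the part of [X] whose translate by c is
    already covered. Then X + C gains |X| - |W| elements, while X + B + C gains at most |X + B| - |W
    + B|, since W + B + c is covered as well. The minimality hypothesis, applied to [W], compares
    the two gains. *)
Lemma petridis (F : finFieldType) (X B : {set F}) :
  (forall Z : {set F}, Z \subset X ->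
     (#|sumset X B| * #|Z| <= #|sumset Z B| * #|X|)%N) ->
  forall C : {set F},
  (#|sumset (sumset X B) C| * #|X| <= #|sumset X B| * #|sumset X C|)%N.
Proof.
move=> Xmin C; have [n] := ubnP #|C|; elim: n C => // n IH C ltC.
have [->|[c cC]] := set_0Vmem C.
  have -> : sumset (sumset X B) set0 = set0.
    by apply/setP => z; rewrite inE; apply/sumsetP => -[? [? []]]; rewrite inE.
  by rewrite cards0.
pose C' := C :\ c.
have {IH}IH := IH C'; rewrite (cardsD1 c) cC ltnS in ltC.
have {}IH := IH ltC.
pose W := [set x in X | x + c \in sumset X C'].
have WX : W \subset X by apply/subsetP => x; rewrite inE => /andP[].
have lowX : (#|sumset X C'| + (#|X| - #|W|) <= #|sumset X C|)%N.
  have -> : (#|X| - #|W| = #|[set (x + c)%R | x in X :\: W]|)%N.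
    rewrite card_imset; last exact: addIr.
    by rewrite cardsD (setIidPr WX).
  rewrite -cardsUI; set I := _ :&: _; have -> : I = set0.
    apply/setP => z; rewrite !inE; apply/negP => /andP[zX /imsetP[x]].
    rewrite !inE => /andP[/negP xW xX] e; apply: xW.
    by rewrite xX -e.
  rewrite cards0 addn0 subset_leq_card // subUset; apply/andP; split.
    by apply: imset2S => //; apply: subD1set.
  by apply/subsetP => _ /imsetP[x /setDP[xX _] ->]; apply: mem_sumset.
have upXB : (#|sumset (sumset X B) C| <=
    #|sumset (sumset X B) C'| + (#|sumset X B| - #|sumset W B|))%N.
  have WB : sumset W B \subset sumset X B by apply: imset2S.
  have -> : (#|sumset X B| - #|sumset W B| =
      #|[set (z + c)%R | z in sumset X B :\: sumset W B]|)%N.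
    rewrite card_imset; last exact: addIr.
    by rewrite cardsD (setIidPr WB).
  apply: leq_trans (leq_card_setU _ _); apply: subset_leq_card.
  apply/subsetP => _ /sumsetP[z [c' [zXB c'C ->]]]; rewrite in_setU.
  have [ec|nc] := eqVneq c' c; last first.
    by apply/orP; left; apply: mem_sumset => //; rewrite !inE nc.
  rewrite ec; have [zW|zW] := boolP (z \in sumset W B); last first.
    by apply/orP; right; apply: imset_f; rewrite inE zW.
  apply/orP; left; case/sumsetP: zW => w [b [wW bB ->]].
  move: wW; rewrite inE => /andP[_ /sumsetP[x [c1 [xX c1C e]]]].
  have -> : w + b + c = x + b + c1 by rewrite addrAC e addrAC.
  by rewrite !mem_sumset.
have WB := Xmin W WX.
have leW : (#|W| <= #|X|)%N by rewrite subset_leq_card.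
have leWB : (#|sumset W B| <= #|sumset X B|)%N.
  by rewrite subset_leq_card //; apply: imset2S.
move: IH lowX upXB WB leW leWB.
move: #|sumset (sumset X B) C'| #|sumset (sumset X B) C| #|sumset X C'|
  #|sumset X C| #|sumset X B| #|sumset W B| #|X| #|W| => p1 p c1 c2 b wb x w.
move=> IH lowX upXB WB leW leWB.
apply: (@leq_trans ((p1 + (b - wb)) * x)); first by rewrite leq_mul2r upXB orbT.
apply: (@leq_trans (b * (c1 + (x - w)))); last by rewrite leq_mul2l lowX orbT.
rewrite mulnDl mulnDr mulnBl mulnBr.
by apply: leq_add => //; apply: leq_sub2l.
Qed.

(** For a nonempty subset X of [A] with the least ratio |X + B| / |X|, [petridis] can be iterated
    and gives |X + kB| <= K^k |X|. The minimum is at most K because [A] itself competes. *)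
Lemma plunnecke (R : realFieldType) (F : finFieldType) (A B : {set F}) (K : R)
    (m n : nat) :
  A != set0 -> #|sumset A B|%:R <= K * #|A|%:R ->
  #|diffset (nfold m B) (nfold n B)|%:R <= K ^+ (m + n) * #|A|%:R.
Proof.
move=> An0 leK.
have A0 : 0 < #|A|%:R :> R by rewrite ltr0n card_gt0.
have K0 : 0 <= K by rewrite -(pmulr_lge0 _ A0) (le_trans _ leK).
pose ratio (X : {set F}) : rat := #|sumset X B|%:R / #|X|%:R.
have PA : (A \subset A) && (A != set0) by rewrite subxx.
have [X /andP[XA Xn0] Xmin] := @Order.TotalTheory.arg_minP _ _ _ A
  (fun X : {set F} => (X \subset A) && (X != set0)) ratio PA.
have X0 : (0 < #|X|)%N by rewrite card_gt0.
have cross (Z : {set F}) : Z \subset A ->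
    (#|sumset X B| * #|Z| <= #|sumset Z B| * #|X|)%N.
  move=> ZA; have [->|Zn0] := eqVneq Z set0; first by rewrite cards0 muln0.
  have Z0 : (0 < #|Z|)%N by rewrite card_gt0.
  have := Xmin Z; rewrite ZA Zn0 => /(_ isT); rewrite /ratio.
  rewrite ler_pdivrMr ?ltr0n // mulrAC ler_pdivlMr ?ltr0n //.
  by rewrite -!natrM ler_nat.
have pet := petridis (fun Z ZX => cross Z (subset_trans ZX XA)).
have XR : 0 < #|X|%:R :> R by rewrite ltr0n.
have XB : #|sumset X B|%:R <= K * #|X|%:R.
  have := cross A (subxx A); rewrite -(ler_nat R) !natrM => le.
  rewrite -(ler_pM2r A0); apply: (le_trans le).
  by rewrite mulrAC ler_wpM2r // ltW.
have step k : #|sumset X (nfold k B)|%:R <= K ^+ k * #|X|%:R.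
  elim: k => [|k IH] /=.
    rewrite expr0 mul1r ler_nat; apply: subset_leq_card.
    apply/subsetP => _ /sumsetP[x [z [xX /set1P -> ->]]].
    by rewrite addr0.
  rewrite sumsetA; have := pet (nfold k B); rewrite -(ler_nat R) !natrM => le.
  rewrite -(ler_pM2r XR); apply: (le_trans le).
  apply: (@le_trans _ _ (K * #|X|%:R * (K ^+ k * #|X|%:R))).
    by apply: ler_pM.
  by rewrite exprS le_eqVlt; apply/orP; left; apply/eqP; ring.
(* The middle set -X turns the differences of the triangle inequality into the sums X + mB and X +
   nB. *)
have tri := ruzsa_triangle [set - x | x in X] (nfold m B) (nfold n B).
have cardN : #|[set - x | x in X]| = #|X| by rewrite card_imset //; apply: oppr_inj.
have e1 C : #|diffset C [set - x | x in X]| = #|sumset X C|.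
  congr #|pred_of_set _|; apply/setP => z; apply/diffsetP/sumsetP.
    by move=> [c [_ [cC /imsetP[x xX ->] ->]]]; exists x, c; rewrite opprK addrC.
  by move=> [x [c [xX cC ->]]]; exists c, (- x); rewrite opprK addrC imset_f.
rewrite cardN e1 (card_diffsetC [set - _ | _ in X]) e1 in tri.
rewrite -(ler_nat R) !natrM in tri.
have XleA : #|X|%:R <= #|A|%:R :> R by rewrite ler_nat subset_leq_card.
apply: (@le_trans _ _ (K ^+ (m + n) * #|X|%:R)); last first.
  by rewrite ler_wpM2l // exprn_ge0.
rewrite -(ler_pM2l XR); apply: (le_trans _ (_ : K ^+ m * #|X|%:R * (K ^+ n * #|X|%:R) <= _)).
  by apply: (le_trans tri); rewrite ler_pM.
by rewrite exprD le_eqVlt; apply/orP; left; apply/eqP; ring.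
Qed.

(** Measures how far [t] is from acting on [A] like a scalar on a vector space. It is
    submultiplicative, and Plunnecke's inequality controls it on sums, so it stays bounded on short
    polynomial expressions. *)
Definition distortion (R : realFieldType) (F : finFieldType) (A : {set F})
    (t : F) : R :=
  #|diffset A (dilate t A)|%:R / #|A|%:R.

Lemma distortionM (R : realFieldType) (F : finFieldType) (A : {set F})
    (s t : F) :
  A != set0 -> s != 0 ->
  distortion R A (s * t) <= distortion R A s * distortion R A t.
Proof.
move=> An0 s0; have A0 : 0 < #|A|%:R :> R by rewrite ltr0n card_gt0.
have := ruzsa_triangle (dilate s A) A (dilate (s * t) A).
rewrite dilateM diffset_dilate !card_dilate // -(ler_nat R) !natrM => le.
rewrite /distortion ler_pdivrMr //.
have -> : #|diffset A (dilate s A)|%:R / #|A|%:R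
    * (#|diffset A (dilate t A)|%:R / #|A|%:R) * #|A|%:R =
   (#|diffset A (dilate s A)|%:R * #|diffset A (dilate t A)|%:R) / #|A|%:R :> R.
  by field; rewrite gt_eqF.
by rewrite ler_pdivlMr // mulrC dilateM.
Qed.

(** Dilating by [f] turns A - (e/f)A into fA - eA, and Ruzsa's triangle inequality applies with
    middle set [A]. *)
Lemma distortionV (R : realFieldType) (F : finFieldType) (A : {set F})
    (e f : F) :
  A != set0 -> f != 0 ->
  distortion R A (e / f) <= distortion R A e * distortion R A f.
Proof.
move=> An0 f0; have A0 : 0 < #|A|%:R :> R by rewrite ltr0n card_gt0.
have := ruzsa_triangle A (dilate f A) (dilate e A).
have -> : #|diffset (dilate f A) (dilate e A)| = #|diffset A (dilate (e / f) A)|.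
  have -> : dilate e A = dilate f (dilate (e / f) A).
    by rewrite -dilateM mulrC divfK.
  by rewrite diffset_dilate card_dilate.
rewrite (card_diffsetC (dilate f A)) -(ler_nat R) !natrM => le.
rewrite /distortion ler_pdivrMr //.
have -> : #|diffset A (dilate e A)|%:R / #|A|%:R
    * (#|diffset A (dilate f A)|%:R / #|A|%:R) * #|A|%:R =
   (#|diffset A (dilate f A)|%:R * #|diffset A (dilate e A)|%:R) / #|A|%:R :> R.
  by field; rewrite gt_eqF.
by rewrite ler_pdivlMr // mulrC.
Qed.

Lemma mem_nfold (F : finFieldType) (B : {set F}) (s : seq F) :
  all [in B] s -> \sum_(x <- s) x \in nfold (size s) B.
Proof.
elim: s => [|x s IH] /=; first by rewrite big_nil inE.
by move=> /andP[xB sB]; rewrite big_cons; apply: mem_sumset => //; apply: IH.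
Qed.

Lemma leq_card_bigcup (I T : finType) (P : {set I}) (B : I -> {set T}) :
  (#|\bigcup_(i in P) B i| <= \sum_(i in P) #|B i|)%N.
Proof.
elim/big_rec2: _ => [|i m S _ le]; first by rewrite cards0.
by rewrite (leq_trans (leq_card_setU _ _)) // leq_add2l.
Qed.

(** Let B be the union of the sets -tA over the listed t and t = 1. Each a - (sum ps - sum ns) a' is
    a difference of a sum of [size ps] elements of B and a sum of [(size ns).+1] elements; the extra
    summand is -(1 a). The number of listed t bounds |A + B| / |A| up to the factor [L], and
    [plunnecke] concludes. *)
Lemma distortion_sum (R : realFieldType) (F : finFieldType) (A : {set F})
    (ps ns : seq F) (L : R) :
  A != set0 -> 0 <= L ->
  (forall t, t \in 1 :: ps ++ ns -> distortion R A t <= L) ->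
  distortion R A (\sum_(t <- ps) t - \sum_(t <- ns) t)
    <= ((size ps + (size ns).+1)%:R * L) ^+ (size ps + (size ns).+1).
Proof.
move=> An0 L0 hL; have A0 : 0 < #|A|%:R :> R by rewrite ltr0n card_gt0.
set N := (size ps + _)%N.
pose T := [set t in 1 :: ps ++ ns].
have TN : (#|T| <= N)%N.
  rewrite cardsE; apply: leq_trans (card_size _) _.
  by rewrite /= size_cat /N addnS.
pose B := \bigcup_(t in T) dilate (- t) A.
have mB t a : t \in 1 :: ps ++ ns -> a \in A -> - (t * a) \in B.
  move=> tT aA; apply/bigcupP; exists t; first by rewrite inE.
  by rewrite -mulNr imset_f.
have AB : #|sumset A B|%:R <= N%:R * L * #|A|%:R.
  apply: (@le_trans _ _ (\sum_(t in T) #|diffset A (dilate t A)|%:R)).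
    rewrite -natr_sum ler_nat; apply: leq_trans (leq_card_bigcup _ _).
    apply: subset_leq_card; apply/subsetP => z.
    move=> /sumsetP[a [b [aA /bigcupP[t tT /imsetP[a' a'A ->]] ->]]].
    apply/bigcupP; exists t => //; rewrite mulNr mem_diffset //.
    exact: imset_f.
  apply: (@le_trans _ _ (\sum_(t in T) L * #|A|%:R)).
    apply: ler_sum => t tT; rewrite -ler_pdivrMr //; apply: hL.
    by rewrite inE in tT.
  rewrite sumr_const -[leLHS]mulr_natl mulrA ler_wpM2r ?(ltW A0) //.
  by rewrite ler_wpM2r // ler_nat.
have := plunnecke (size ps) (size ns).+1 An0 AB.
rewrite /distortion ler_pdivrMr //; apply: le_trans; rewrite ler_nat.
apply: subset_leq_card; apply/subsetP => z.
move=> /diffsetP[a [_ [aA /imsetP[a' a'A ->] ->]]].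
have sumN (s : seq F) : {subset s <= 1 :: ps ++ ns} ->
    - ((\sum_(t <- s) t) * a') \in nfold (size s) B.
  move=> sub; have := @mem_nfold _ B [seq - (t * a') | t <- s].
  rewrite size_map big_map sumrN -mulr_suml; apply.
  by rewrite all_map; apply/allP => t /sub ts /=; apply: mB.
have := sumN ps; have := sumN ns => h1 h2.
have -> : a - (\sum_(t <- ps) t - \sum_(t <- ns) t) * a' =
  - ((\sum_(t <- ps) t) * a') - (- (1 * a) + - ((\sum_(t <- ns) t) * a')) by ring.
apply: mem_diffset; first by apply: h2 => t tp; rewrite inE mem_cat tp orbT.
apply: mem_sumset; first by apply: mB; rewrite // inE eqxx.
by apply: h1 => t tp; rewrite inE mem_cat tp !orbT.
Qed.

(** * Multiplicative energies of difference sets *)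

Definition diffrep (R : realFieldType) (F : finFieldType) (A : {set F})
    (d : F) : R :=
  \sum_(a in A) \sum_(b in A) (a - b == d)%:R.

Definition dilrep (R : realFieldType) (F : finFieldType) (A : {set F})
    (x s : F) : R :=
  \sum_(a in A) \sum_(b in A) (a - x * b == s)%:R.

(* [quotrep A x] counts the solutions of [a - b = x (c - d)], [c <> d], in [A]
   and [prodrep A t], for [t <> 0], those of [(a - b) (c - d) = t]. *)
Definition quotrep (R : realFieldType) (F : finFieldType) (A : {set F})
    (x : F) : R :=
  \sum_(d | d != 0) diffrep R A (x * d) * diffrep R A d.

Definition prodrep (R : realFieldType) (F : finFieldType) (A : {set F})
    (t : F) : R :=
  \sum_(d | d != 0) diffrep R A d * diffrep R A (t / d).

Lemma sum_eq_ind (R : realFieldType) (T : finType) (x : T) (f : T -> R) :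
  \sum_d (x == d)%:R * f d = f x.
Proof.
rewrite (bigD1 x) //= eqxx mul1r big1 ?addr0 // => d /negbTE.
by rewrite eq_sym => ->; rewrite mul0r.
Qed.

Lemma sum_eq_ind1 (R : realFieldType) (T : finType) (x : T) :
  \sum_d (x == d)%:R = 1 :> R.
Proof. by rewrite -[RHS](sum_eq_ind x (fun=> 1)); apply: eq_bigr => d; rewrite mulr1. Qed.

Lemma diffrep_ge0 (R : realFieldType) (F : finFieldType) (A : {set F}) d :
  0 <= diffrep R A d.
Proof. by do 2!apply: sumr_ge0 => ? _; rewrite ler0n. Qed.

Lemma diffrep0 (R : realFieldType) (F : finFieldType) (A : {set F}) :
  diffrep R A 0 = #|A|%:R.
Proof.
rewrite -sum1_card_set; apply: eq_bigr => a aA.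
rewrite (bigD1 a) //= subrr eqxx big1 ?addr0 // => b /andP[_ /negbTE ba].
by rewrite subr_eq0 eq_sym ba.
Qed.

Lemma sum_diffrep (R : realFieldType) (F : finFieldType) (A : {set F}) :
  \sum_d diffrep R A d = #|A|%:R ^+ 2.
Proof.
rewrite exchange_big /= -sum1_card_set expr2 big_distrlr /=.
apply: eq_bigr => a _; rewrite exchange_big /=; apply: eq_bigr => b _.
by rewrite sum_eq_ind1 mulr1.
Qed.

Lemma sum_diffrep_nz (R : realFieldType) (F : finFieldType) (A : {set F}) :
  \sum_(d | d != 0) diffrep R A d = #|A|%:R ^+ 2 - #|A|%:R.
Proof.
by rewrite -(sum_diffrep R A) [X in _ = X - _](bigD1 0) //= diffrep0 addrAC subrr add0r.
Qed.

Lemma diffrep_le (R : realFieldType) (F : finFieldType) (A : {set F}) d :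
  diffrep R A d <= #|A|%:R.
Proof.
rewrite -sum1_card_set; apply: ler_sum => a _.
have [d' | ] := boolP (a - d \in A).
  rewrite (bigD1 (a - d)) //= big1 ?addr0; first by case: eqP.
  move=> b /andP[_ nb]; case: eqP => // e; move: nb.
  by rewrite -e subKr eqxx.
move=> nad; rewrite big1 // => b bA; case: eqP => // e; move: nad.
by rewrite -e subKr bA.
Qed.

Lemma sum_nz_scale (R : realFieldType) (F : finFieldType) (c : F) (f : F -> R) :
  c != 0 -> \sum_(z | z != 0) f (c * z) = \sum_(z | z != 0) f z.
Proof.
move=> c0; rewrite [RHS](reindex_inj (mulfI c0)) /=.
by apply: eq_bigl => z; rewrite mulf_eq0 negb_or c0.
Qed.

Lemma sum_quotrep (R : realFieldType) (F : finFieldType) (A : {set F}) :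
  \sum_(x | x != 0) quotrep R A x = (#|A|%:R ^+ 2 - #|A|%:R) ^+ 2.
Proof.
rewrite exchange_big /= -sum_diffrep_nz expr2 mulr_sumr.
apply: eq_bigr => d d0; rewrite -mulr_suml; congr (_ * _).
by rewrite -(sum_nz_scale (diffrep R A) d0); apply: eq_bigr => x _; rewrite mulrC.
Qed.

Lemma sum_prodrep (R : realFieldType) (F : finFieldType) (A : {set F}) :
  \sum_(t | t != 0) prodrep R A t = (#|A|%:R ^+ 2 - #|A|%:R) ^+ 2.
Proof.
rewrite exchange_big /= -sum_diffrep_nz expr2 mulr_suml.
apply: eq_bigr => d d0; rewrite -mulr_sumr; congr (_ * _).
rewrite -(sum_nz_scale (fun t => diffrep R A (t / d)) d0).
by apply: eq_bigr => x _; rewrite mulrC mulKf.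
Qed.

(** An equality of products d f = e f' between nonzero differences is an equality of quotients e / d
    = f / f'; here x is the common quotient. This turns multiplicative information into the additive
    energies of [A] and xA. *)
Lemma sum_sqr_prodrep (R : realFieldType) (F : finFieldType) (A : {set F}) :
  \sum_(t | t != 0) prodrep R A t ^+ 2 = \sum_(x | x != 0) quotrep R A x ^+ 2.
Proof.
set D := diffrep R A.
have e1 t : prodrep R A t ^+ 2 =
    \sum_(d | d != 0) \sum_(e | e != 0) D d * D (t / d) * (D e * D (t / e)).
  by rewrite expr2 big_distrlr.
rewrite (eq_bigr _ (fun t _ => e1 t)) exchange_big /=.
transitivity (\sum_(d | d != 0) \sum_(x | x != 0) \sum_(f | f != 0)
    D d * D (x * d) * (D f * D (f / x))).
  apply: eq_bigr => d d0; rewrite exchange_big /=.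
  rewrite -(sum_nz_scale _ d0); apply: eq_bigr => x x0.
  rewrite -(sum_nz_scale _ d0); apply: eq_bigr => f f0.
  rewrite [d * f / d]mulrC mulKf // [d * x]mulrC.
  have -> : d * f / (x * d) = f / x by field; rewrite x0 d0.
  by ring.
rewrite exchange_big /=; apply: eq_bigr => x x0.
have -> : quotrep R A x ^+ 2 = quotrep R A x * \sum_(f | f != 0) D f * D (f / x).
  rewrite expr2; congr (_ * _); rewrite -[RHS](sum_nz_scale _ x0).
  by apply: eq_bigr => f f0; rewrite [x * f / x]mulrC mulKf.
rewrite /quotrep big_distrlr /=; apply: eq_bigr => d _.
by apply: eq_bigr => f _; rewrite [D d * _]mulrC.
Qed.

Lemma sum_dilrep (R : realFieldType) (F : finFieldType) (A : {set F}) (x : F) :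
  \sum_s dilrep R A x s = #|A|%:R ^+ 2.
Proof.
rewrite exchange_big /= -sum1_card_set expr2 big_distrlr /=.
apply: eq_bigr => a _; rewrite exchange_big /=; apply: eq_bigr => b _.
by rewrite sum_eq_ind1 mulr1.
Qed.

(** The equation a - x b = a' - x b' is rearranged as a - a' = x (b - b'). *)
Lemma sum_sqr_dilrep_diffrep (R : realFieldType) (F : finFieldType)
    (A : {set F}) (x : F) :
  \sum_s dilrep R A x s ^+ 2 = \sum_d diffrep R A (x * d) * diffrep R A d.
Proof.
transitivity (\sum_(a in A) \sum_(b in A) \sum_(a' in A) \sum_(b' in A)
    (a - x * b == a' - x * b')%:R : R).
  under eq_bigr => s _ do rewrite expr2 {1}/dilrep mulr_suml.
  rewrite exchange_big /=; apply: eq_bigr => a _.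
  under eq_bigr => s _ do rewrite mulr_suml.
  rewrite exchange_big /=; apply: eq_bigr => b _.
  rewrite sum_eq_ind; apply: eq_bigr => a' _; apply: eq_bigr => b' _.
  by rewrite eq_sym.
under [RHS]eq_bigr => d _ do rewrite mulrC {1}/diffrep mulr_suml.
rewrite [RHS]exchange_big /= [LHS]exchange_big /=; apply: eq_bigr => b _.
under [RHS]eq_bigr => d _ do rewrite mulr_suml.
rewrite [RHS]exchange_big /=.
transitivity (\sum_(b' in A) \sum_(a in A) \sum_(a' in A)
    (a - x * b == a' - x * b')%:R : R).
  rewrite [RHS]exchange_big /=; apply: eq_bigr => a _.
  by rewrite [RHS]exchange_big.
apply: eq_bigr => b' _; rewrite sum_eq_ind.
apply: eq_bigr => a _; apply: eq_bigr => a' _.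
by congr (nat_of_bool _)%:R; rewrite -subr_eq0 -[RHS]subr_eq0; congr (_ == 0); ring.
Qed.

Lemma sum_sqr_dilrep (R : realFieldType) (F : finFieldType) (A : {set F}) (x : F) :
  \sum_s dilrep R A x s ^+ 2 = #|A|%:R ^+ 2 + quotrep R A x.
Proof.
by rewrite sum_sqr_dilrep_diffrep (bigD1 0) //= mulr0 diffrep0.
Qed.

Lemma quotrep_ge0 (R : realFieldType) (F : finFieldType) (A : {set F}) (x : F) :
  0 <= quotrep R A x.
Proof. by apply: sumr_ge0 => d _; rewrite mulr_ge0 ?diffrep_ge0. Qed.

Lemma energy_le (R : realFieldType) (F : finFieldType) (A : {set F}) (x : F) :
  #|A|%:R ^+ 2 + quotrep R A x <= #|A|%:R ^+ 3.
Proof.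
rewrite -sum_sqr_dilrep sum_sqr_dilrep_diffrep exprS -(sum_diffrep R A) mulr_sumr.
by apply: ler_sum => d _; rewrite ler_wpM2r ?diffrep_ge0 ?diffrep_le.
Qed.

Definition is_subfield (F : finFieldType) (G : {set F}) : Prop :=
  [/\ 1 \in G, {in G &, forall x y, x - y \in G} &
      {in G &, forall x y, x / y \in G}].

Lemma subfieldT (F : finFieldType) : is_subfield [set: F].
Proof. by split=> [|x y _ _|x y _ _]; rewrite inE. Qed.

Lemma subfield0 (F : finFieldType) (G : {set F}) : is_subfield G -> 0 \in G.
Proof. by case=> G1 GB _; rewrite -(subrr 1) GB. Qed.

Lemma subfieldN (F : finFieldType) (G : {set F}) :
  is_subfield G -> {in G, forall x, - x \in G}.
Proof. by move=> GF x xG; case: (GF) => _ GB _; rewrite -sub0r GB ?subfield0. Qed.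

Lemma subfieldD (F : finFieldType) (G : {set F}) :
  is_subfield G -> {in G &, forall x y, x + y \in G}.
Proof.
move=> GF x y xG yG; case: (GF) => _ GB _.
by rewrite -[y]opprK GB // subfieldN.
Qed.

Lemma subfieldV (F : finFieldType) (G : {set F}) :
  is_subfield G -> {in G, forall x, x^-1 \in G}.
Proof. by case=> G1 _ GD x xG; rewrite -div1r GD. Qed.

Lemma subfieldM (F : finFieldType) (G : {set F}) :
  is_subfield G -> {in G &, forall x y, x * y \in G}.
Proof.
move=> GF x y xG yG; case: (GF) => _ _ GD.
by rewrite -[y]invrK GD // subfieldV.
Qed.

Lemma subfield_card_gt1 (F : finFieldType) (G : {set F}) :
  is_subfield G -> (1 < #|G|)%N.
Proof.
move=> GF; rewrite (cardsD1 0) (subfield0 GF) ltnS card_gt0.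
by apply/set0Pn; exists 1; case: GF => G1 _ _; rewrite !inE oner_eq0.
Qed.

Lemma card_subfield_nz (R : realFieldType) (F : finFieldType) (G : {set F}) :
  is_subfield G -> #|G :\ 0|%:R = #|G|%:R - 1 :> R.
Proof.
move=> GF; rewrite [X in _ = X%:R - _](cardsD1 0) (subfield0 GF).
by rewrite /= natrD addrAC subrr add0r.
Qed.

Lemma sum_subfield_nz (R : realFieldType) (F : finFieldType) (G : {set F})
    (f : F -> R) :
  (forall x, x != 0 -> x \notin G -> f x = 0) ->
  \sum_(x in G :\ 0) f x = \sum_(x | x != 0) f x.
Proof.
move=> f0; rewrite [RHS](bigID [in G]) /= [X in _ + X]big1 ?addr0.
  by apply: eq_bigl => x; rewrite !inE.
by move=> x /andP[]; apply: f0.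
Qed.

Lemma diffrep_out (R : realFieldType) (F : finFieldType) (G A : {set F}) d :
  is_subfield G -> A \subset G -> d \notin G -> diffrep R A d = 0.
Proof.
move=> [_ GB _] AG dG; rewrite /diffrep big1 // => a aA; rewrite big1 // => b bA.
by case: eqP => // e; move: dG; rewrite -e GB // (subsetP AG).
Qed.

Lemma quotrep_out (R : realFieldType) (F : finFieldType) (G A : {set F}) x :
  is_subfield G -> A \subset G -> x \notin G -> quotrep R A x = 0.
Proof.
move=> GF AG xG; rewrite /quotrep big1 // => d d0.
have [dG|dG] := boolP (d \in G); last by rewrite (diffrep_out _ GF AG dG) mulr0.
rewrite (diffrep_out _ GF AG (d := x * d)) ?mul0r //.
apply: contra xG => xdG; rewrite -(mulfK d0 x).
by case: GF => _ _; apply.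
Qed.

Lemma prodrep_out (R : realFieldType) (F : finFieldType) (G A : {set F}) t :
  is_subfield G -> A \subset G -> t \notin G -> prodrep R A t = 0.
Proof.
move=> GF AG tG; rewrite /prodrep big1 // => d d0.
have [dG|dG] := boolP (d \in G); last by rewrite (diffrep_out _ GF AG dG) mul0r.
rewrite (diffrep_out _ GF AG (d := t / d)) ?mulr0 //.
apply: contra tG => xdG; rewrite -(divfK d0 t).
exact: subfieldM.
Qed.

Lemma energy_ge (R : realFieldType) (F : finFieldType) (G A : {set F}) x :
  is_subfield G -> A \subset G -> x \in G ->
  #|A|%:R ^+ 4 / #|G|%:R <= #|A|%:R ^+ 2 + quotrep R A x.
Proof.
move=> GF AG xG.
have p0 : 0 < #|G|%:R :> R by rewrite ltr0n (ltn_trans _ (subfield_card_gt1 GF)).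
have out s : s \notin G -> dilrep R A x s = 0.
  move=> sG; rewrite /dilrep big1 // => a aA; rewrite big1 // => b bA.
  case: eqP => // e; move: sG; rewrite -e; case: (GF) => _ -> //.
    by apply: (subsetP AG).
  by apply: subfieldM => //; apply: (subsetP AG).
have sG (f : R -> R) : f 0 = 0 ->
    \sum_s f (dilrep R A x s) = \sum_(s in G) f (dilrep R A x s).
  move=> f0; rewrite (bigID [in G]) /= [X in _ + X]big1 ?addr0 //.
  by move=> s /out ->.
have := sqr_sum_le G (dilrep R A x).
rewrite -(sG id) // -(sG (fun y => y ^+ 2)) ?expr0n // sum_dilrep sum_sqr_dilrep.
by rewrite -exprM ler_pdivrMr // mulrC.
Qed.

(** The first two terms make up the additive energy of [A] and xA: [quotrep] omits the solutions
    with c = d, of which there are |A|^2. The subtracted term is the lower bound that Cauchy-Schwarz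
    gives when all the differences a - x b lie in [G]. *)
Definition excess (R : realFieldType) (F : finFieldType) (G A : {set F})
    (x : F) : R :=
  #|A|%:R ^+ 2 + quotrep R A x - #|A|%:R ^+ 4 / #|G|%:R.

Lemma excess_ge0 (R : realFieldType) (F : finFieldType) (G A : {set F}) x :
  is_subfield G -> A \subset G -> x \in G -> 0 <= excess R G A x.
Proof. by move=> GF AG xG; rewrite subr_ge0 energy_ge. Qed.

Lemma excess_le (R : realFieldType) (F : finFieldType) (G A : {set F}) x :
  excess R G A x <= #|A|%:R ^+ 3.
Proof.
apply: le_trans (energy_le R A x).
by rewrite lerBlDr lerDl divr_ge0 ?exprn_ge0.
Qed.

Lemma quotrep0 (R : realFieldType) (F : finFieldType) (A : {set F}) :
  quotrep R A 0 = #|A|%:R ^+ 3 - #|A|%:R ^+ 2.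
Proof.
rewrite /quotrep; under eq_bigr => d _ do rewrite mul0r diffrep0.
by rewrite -mulr_sumr sum_diffrep_nz; ring.
Qed.

(** The sum can be evaluated: it is p n^2 - n^3 with p = |G| and n = |A|, because the values of
    [quotrep] over the nonzero x add up to the square of the number of pairs of distinct
    elements. *)
Lemma sum_excess_le (R : realFieldType) (F : finFieldType) (G A : {set F}) :
  is_subfield G -> A \subset G ->
  \sum_(x in G) excess R G A x <= #|G|%:R * #|A|%:R ^+ 2.
Proof.
move=> GF AG; have p0 : 0 < #|G|%:R :> R.
  by rewrite ltr0n (ltn_trans _ (subfield_card_gt1 GF)).
rewrite (big_setD1 0) ?subfield0 //= {1}/excess quotrep0 sumrB big_split /=.
rewrite (sum_subfield_nz (f := quotrep R A)); last first.
  by move=> x _; apply: quotrep_out.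
rewrite sum_quotrep !sumr_const -[X in _ + (X + _ - _)]mulr_natr -[X in _ - X]mulr_natr.
rewrite card_subfield_nz //.
set n : R := #|A|%:R; set p : R := #|G|%:R in p0 *.
have n0 : 0 <= n by [].
rewrite [leLHS](_ : _ = p * n ^+ 2 - n ^+ 3); last by field; rewrite gt_eqF.
by rewrite lerBlDr lerDl exprn_ge0.
Qed.

Lemma sum_excess_nz_le (R : realFieldType) (F : finFieldType) (G A : {set F}) :
  is_subfield G -> A \subset G ->
  \sum_(x in G :\ 0) excess R G A x <= #|G|%:R * #|A|%:R ^+ 2.
Proof.
move=> GF AG; apply: le_trans (sum_excess_le R GF AG).
by rewrite [leRHS](big_setD1 0) ?subfield0 //= lerDr excess_ge0 ?subfield0.
Qed.

(** Over the nonzero elements [prodrep] and [quotrep] have the same sum and the same sum of squares,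
    hence the same variance. The excess is [quotrep] recentred at another constant, and the square
    deviation is least around the mean. *)
Lemma variance_prodrep_le (R : realFieldType) (F : finFieldType) (G A : {set F}) :
  is_subfield G -> A \subset G ->
  \sum_(t in G :\ 0)
     (prodrep R A t - (#|A|%:R ^+ 2 - #|A|%:R) ^+ 2 / (#|G|%:R - 1)) ^+ 2 <=
  \sum_(x in G :\ 0) excess R G A x ^+ 2.
Proof.
move=> GF AG.
have m0 : 0 < #|G|%:R - 1 :> R.
  by rewrite subr_gt0 ltr1n (subfield_card_gt1 GF).
set c : R := #|A|%:R ^+ 4 / #|G|%:R - #|A|%:R ^+ 2.
have -> : \sum_(x in G :\ 0) excess R G A x ^+ 2 =
    \sum_(x in G :\ 0) (quotrep R A x - c) ^+ 2.
  by apply: eq_bigr => x _; rewrite /excess /c; congr (_ ^+ 2); ring.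
rewrite !sum_sqr_dev card_subfield_nz //.
rewrite (sum_subfield_nz (f := quotrep R A)); last first.
  by move=> x _; apply: quotrep_out.
rewrite (sum_subfield_nz (f := prodrep R A)); last first.
  by move=> x _; apply: prodrep_out.
rewrite (sum_subfield_nz (f := fun x => quotrep R A x ^+ 2)); last first.
  by move=> x _ xG; rewrite (quotrep_out _ GF AG) // expr0n.
rewrite (sum_subfield_nz (f := fun x => prodrep R A x ^+ 2)); last first.
  by move=> x _ xG; rewrite (prodrep_out _ GF AG) // expr0n.
rewrite sum_prodrep sum_quotrep sum_sqr_prodrep.
set W : R := (_ - _) ^+ 2; set m : R := _ - 1 in m0 *.
rewrite -!addrA lerD2l.
have : 0 <= (W / m - c) ^+ 2 * m by rewrite mulr_ge0 ?sqr_ge0 // ltW.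
have -> : (W / m - c) ^+ 2 * m = W ^+ 2 / m - 2 * c * W + c ^+ 2 * m.
  by field; rewrite gt_eqF.
have -> : - (2 * (W / m) * W) + (W / m) ^+ 2 * m = - (W ^+ 2 / m).
  by field; rewrite gt_eqF.
by lra.
Qed.

Lemma sum_sqr_excess_le (R : realFieldType) (F : finFieldType) (G A : {set F}) :
  is_subfield G -> A \subset G ->
  \sum_(x in G :\ 0) excess R G A x ^+ 2 <= #|G|%:R * #|A|%:R ^+ 5.
Proof.
move=> GF AG.
apply: (@le_trans _ _ (\sum_(x in G :\ 0) #|A|%:R ^+ 3 * excess R G A x)).
  apply: ler_sum => x; rewrite inE => /andP[_ xG].
  by rewrite expr2 ler_wpM2r ?excess_le ?excess_ge0.
rewrite -mulr_sumr; apply: (le_trans (ler_wpM2l _ (sum_excess_nz_le R GF AG))).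
  by rewrite exprn_ge0.
by rewrite le_eqVlt; apply/orP; left; apply/eqP; ring.
Qed.

(** * Products of differences in a subfield *)

Lemma sum_shift_mem (R : realFieldType) (F : finFieldType) (I : {set F}) (z : F) :
  \sum_u (u + z \in I)%:R = #|I|%:R :> R.
Proof.
rewrite (reindex_inj (addIr (- z))) /= -sum1_card_set [RHS]big_mkcond.
by apply: eq_bigr => u _; rewrite subrK; case: (u \in I).
Qed.

Lemma sum_shift_mem2 (R : realFieldType) (F : finFieldType) (I : {set F}) (z z' : F) :
  \sum_u (u + z \in I)%:R * (u + z' \in I)%:R = diffrep R I (z - z').
Proof.
rewrite (reindex_inj (addIr (- z))) /= /diffrep [RHS]big_mkcond.
apply: eq_bigr => u _; rewrite subrK; case: (u \in I); last by rewrite mul0r.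
rewrite mul1r; have [uI|uI] := boolP (_ \in I).
  rewrite (bigD1 _ uI) /= big1 ?addr0; first by case: eqP => //; case; ring.
  move=> b /andP[_ nb]; case: eqP => // e; case/eqP: nb.
  by rewrite -[LHS](subKr u) e; ring.
rewrite big1 // => b bI; case: eqP => // e; case/negP: uI.
by rewrite (_ : _ + _ = b) // -[RHS](subKr u) e; ring.
Qed.

(** The map s |-> y / (s - s^2) is at most two-to-one: only s and 1 - s share a value. *)
Lemma sum_subr_sqr_fibre (R : realFieldType) (F : finFieldType) (G : {set F})
    (y : F) (f : F -> R) :
  is_subfield G -> y \in G -> y != 0 -> (forall t, 0 <= f t) ->
  \sum_(s in G :\ 0 :\ 1) f (y / (s - s ^+ 2)) <= 2 * \sum_(t in G :\ 0) f t.
Proof.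
move=> GF yG y0 f0.
have tG s : s \in G :\ 0 :\ 1 -> y / (s - s ^+ 2) \in G :\ 0.
  rewrite !inE => /and3P[s1 s0 sG].
  rewrite mulf_neq0 ?invr_eq0 //=; last first.
    by rewrite expr2 -{1}[s]mulr1 -mulrBr mulf_neq0 // subr_eq0 eq_sym.
  have ssG : s - s ^+ 2 \in G by case: (GF) => _ GB _; rewrite GB // expr2 subfieldM.
  by case: (GF) => _ _ GD; rewrite GD.
have -> : \sum_(s in G :\ 0 :\ 1) f (y / (s - s ^+ 2)) =
    \sum_(t in G :\ 0) \sum_(s in G :\ 0 :\ 1) (y / (s - s ^+ 2) == t)%:R * f t.
  rewrite exchange_big /=; apply: eq_bigr => s /tG tsG.
  rewrite (bigD1 _ tsG) /= eqxx mul1r big1 ?addr0 // => t /andP[_ nt].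
  by rewrite eq_sym (negbTE nt) mul0r.
rewrite mulr_sumr; apply: ler_sum => t _; rewrite -mulr_suml ler_wpM2r //.
have [s0 /andP[s0G /eqP e0]|no] :=
    pickP (fun s => (s \in G :\ 0 :\ 1) && (y / (s - s ^+ 2) == t)); last first.
  by rewrite big1 // => s sG; have := no s; rewrite sG /= => ->.
apply: (@le_trans _ _ #|[set s0; 1 - s0]|%:R); last first.
  by rewrite ler_nat cards2; case: (_ == _).
rewrite -sum1_card_set big_mkcond [leRHS]big_mkcond.
apply: ler_sum => s _; case sG: (s \in G :\ 0 :\ 1); last by case: ifP.
case: eqP => [e|]; last by case: ifP.
have : s - s ^+ 2 = s0 - s0 ^+ 2.
  by apply: invr_inj; apply: (mulfI y0); rewrite e e0.
move=> /eqP; rewrite -subr_eq0.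
have -> : s - s ^+ 2 - (s0 - s0 ^+ 2) = (s - s0) * (s - (1 - s0)) * -1 by ring.
rewrite mulrN1 oppr_eq0 mulf_eq0 !subr_eq0 => ee.
by rewrite !inE ee.
Qed.

(* A Kloosterman-type estimate by second moments.  Let [f (u, v)] count the
   [a, c] in [I] with [(a - u) (c - v) = y].  In the second moment of [f], the
   pairs [a <> a'] contribute [prodrep I (y / (s - s^2))], [u = a - (a - a') s],
   and [prodrep I] has small variance; so [f] cannot vanish on [I * I]. *)
Lemma prod_diff_subfield (R : realFieldType) (F : finFieldType) (G I : {set F})
    (y : F) :
  is_subfield G -> I \subset G -> y \in G ->
  256 * #|G|%:R ^+ 6 < #|I|%:R ^+ 7 :> R ->
  exists a b c d, [/\ a \in I, b \in I, c \in I, d \in I & (a - b) * (c - d) = y].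
Proof.
move=> GF IG yG big.
have p1 := subfield_card_gt1 GF.
set p : R := #|G|%:R in big; set n : R := #|I|%:R in big.
have p1R : 1 < p by rewrite ltr1n.
have np : n <= p by rewrite ler_nat subset_leq_card.
have n_ge0 : 0 <= n by rewrite ler0n.
have n0 : 0 < n.
  rewrite lt_neqAle n_ge0 andbT; apply/eqP => e; move: big; rewrite -e expr0n /=.
  by rewrite ltNge mulr_ge0 ?exprn_ge0 // (le_trans _ (ltW p1R)).
have p0 : 0 < p by lra.
have [y0|y0] := eqVneq y 0.
  have : (0 < #|I|)%N by rewrite -(ltr0n R).
  by case/card_gt0P => a aI; exists a, a, a, a; rewrite aI y0 subrr mul0r.
pose f (P : F * F) : R :=
  \sum_(a in I | a != P.1) (P.2 + y / (a - P.1) \in I)%:R.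
have [/existsP[[[a u] [c v]]] /andP[/andP[aI uI] /andP[/andP[cI vI] /eqP e]]|no] :=
  boolP [exists q : (F * F) * (F * F), (q.1.1 \in I) && (q.1.2 \in I) &&
    ((q.2.1 \in I) && (q.2.2 \in I) && ((q.1.1 - q.1.2) * (q.2.1 - q.2.2) == y))].
  by exists a, u, c, v.
(* Without a solution [f] vanishes on I * I. This improves the Cauchy-Schwarz bound for its second
   moment from p^2 points to p^2 - n^2. *)
have f_I2 P : P \in setX I I -> f P = 0.
  case: P => u v /setXP[/= uI vI]; rewrite /f big1 //= => a /andP[aI au].
  have [cI|//] := boolP (v + _ \in I); case/negP: no; apply/existsP.
  exists ((a, u), (v + y / (a - u), v)); rewrite /= aI uI cI vI /= addrAC subrr add0r.
  by rewrite mulrC divfK // subr_eq0.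
have f_out P : P.1 \in G -> P.2 \notin G -> f P = 0.
  case: P => u v /= uG vG; rewrite /f big1 //= => a /andP[aI au].
  have [cI|//] := boolP (v + _ \in I); case/negP: vG.
  have auG : y / (a - u) \in G.
    by case: (GF) => _ GB GD; rewrite GD ?GB // (subsetP IG).
  rewrite -(addrK (y / (a - u)) v); case: (GF) => _ GB _.
  by rewrite GB // (subsetP IG).
have sumG (h : R -> R) : h 0 = 0 ->
    \sum_(P in setX G G :\: setX I I) h (f P) = \sum_(u in G) \sum_v h (f (u, v)).
  move=> h0; rewrite pair_big_dep /= [LHS]big_mkcond [RHS]big_mkcond.
  apply: eq_bigr => -[u v] _; rewrite in_setD [in RHS]andbT.
  have [/f_I2->|_ /=] := boolP ((u, v) \in setX I I); first by rewrite h0; case: ifP.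
  rewrite in_setX /=; case uG: (u \in G) => //=.
  by have [//|vG] := boolP (v \in G); rewrite f_out.
have sum_neq a c : a \in G -> \sum_(u in G | a != u) c = c * (p - 1).
  move=> aG; have e : \sum_(u in G) c = c * p by rewrite sumr_const mulr_natr.
  rewrite mulrBr mulr1 -e [X in _ = X - _](bigD1 a) //= addrAC subrr add0r.
  by apply: eq_bigl => u; rewrite eq_sym.
have S1 : \sum_(u in G) \sum_v f (u, v) = n ^+ 2 * (p - 1).
  transitivity (\sum_(u in G) \sum_(a in I | a != u) n).
    apply: eq_bigr => u _; rewrite /f /= exchange_big /=.
    by apply: eq_bigr => a _; rewrite sum_shift_mem.
  rewrite (exchange_big_dep [in I]) /=; last by move=> u a _ /andP[].
  transitivity (\sum_(a in I) n * (p - 1)).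
    apply: eq_bigr => a aI; rewrite -(sum_neq a) ?(subsetP IG) //.
    by apply: eq_bigl => u; rewrite aI.
  by rewrite sumr_const -[LHS]mulr_natr -/n; ring.
pose W := (n ^+ 2 - n) ^+ 2; pose m := p - 1.
have m0 : 0 < m by rewrite subr_gt0.
pose H := G :\ 0 :\ 1.
have S2 : \sum_(u in G) \sum_v f (u, v) ^+ 2 =
    n ^+ 2 * m + \sum_(s in H) prodrep R I (y / (s - s ^+ 2)).
  transitivity (\sum_(a in I) \sum_(b in I) \sum_(u in G | (a != u) && (b != u))
      diffrep R I (y / (a - u) - y / (b - u))).
    transitivity (\sum_(u in G) \sum_(a in I | a != u) \sum_(b in I | b != u)
        diffrep R I (y / (a - u) - y / (b - u))).
      apply: eq_bigr => u _; rewrite /f /=.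
      under eq_bigr => v _ do rewrite expr2 big_distrlr /=.
      rewrite exchange_big /=; apply: eq_bigr => a _.
      rewrite exchange_big /=; apply: eq_bigr => b _.
      by rewrite sum_shift_mem2.
    rewrite (exchange_big_dep [in I]) /=; last by move=> u a _ /andP[].
    apply: eq_bigr => a aI.
    rewrite (exchange_big_dep [in I]) /=; last by move=> u b _ /andP[].
    apply: eq_bigr => b bI; apply: eq_bigl => u.
    by rewrite aI bI /= andbA.
  transitivity (\sum_(a in I) (n * m + \sum_(b in I | b != a)
      \sum_(s in H) diffrep R I (y / ((a - b) * (s - s ^+ 2))))).
    apply: eq_bigr => a aI; rewrite (bigD1 a) //=; congr (_ + _).
      under eq_bigr => u _ do rewrite subrr diffrep0.
      under eq_bigl => u do rewrite andbb.
      by rewrite sum_neq // (subsetP IG).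
    apply: eq_bigr => b /andP[bI ba].
    have ab0 : a - b != 0 by rewrite subr_eq0 eq_sym.
    have aG := subsetP IG a aI; have bG := subsetP IG b bI.
    have abG : a - b \in G by case: (GF) => _ GB _; apply: GB.
    (* An affine change of variable that sends s = 0 and s = 1 to the excluded values u = a and u =
       b. The dependence on a and b is then only through the factor a - b. *)
    pose g s := a - (a - b) * s.
    have g_inj : injective g by move=> s s' /addrI/oppr_inj/(mulfI ab0).
    rewrite (reindex_inj g_inj) /=.
    have gG s : (g s \in G) = (s \in G).
      apply/idP/idP => sG; last first.
        by case: (GF) => _ GB _; apply: GB => //; apply: subfieldM.
      have -> : s = (a - g s) / (a - b) by rewrite /g; field.
      by case: (GF) => _ GB GD; apply: GD => //; apply: GB.
    have gE s : (g s \in G) && ((a != g s) && (b != g s)) = (s \in H).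
      have aE : (a != g s) = (s != 0).
        by rewrite -subr_eq0 /g opprB addrC subrK mulf_eq0 (negbTE ab0).
      have bE : (b != g s) = (s != 1).
        rewrite -subr_eq0 (_ : b - g s = (a - b) * (s - 1)); last by rewrite /g; ring.
        by rewrite mulf_eq0 (negbTE ab0) subr_eq0.
      rewrite gG aE bE !inE.
      by case: (s \in G); case: (s == 0); case: (s == 1).
    rewrite (eq_bigl _ _ gE); apply: eq_bigr => s; rewrite !inE => /and3P[s1 s0 _].
    congr diffrep; rewrite /g.
    have s10 : s - 1 != 0 by rewrite subr_eq0.
    have -> : a - (a - (a - b) * s) = (a - b) * s by ring.
    have -> : b - (a - (a - b) * s) = (a - b) * (s - 1) by ring.
    have -> : s - s ^+ 2 = - (s * (s - 1)) by ring.
    by field; rewrite oppr_eq0 mulf_neq0 //= ab0 s0 s10.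
  rewrite big_split /= sumr_const -[X in X + _]mulr_natr -/n; congr (_ + _); first by ring.
  under eq_bigr => a _ do rewrite exchange_big /=.
  rewrite exchange_big /=; apply: eq_bigr => s sH.
  rewrite /prodrep.
  under [RHS]eq_bigr => d _.
    rewrite {1}/diffrep mulr_suml; under eq_bigr => a _ do rewrite mulr_suml; over.
  rewrite [RHS]exchange_big /=; apply: eq_bigr => a aI.
  rewrite [RHS]exchange_big /= big_mkcondr /=; apply: eq_bigr => b bI.
  have [->|ba] /= := eqVneq b a.
    by rewrite big1 // => d d0; rewrite subrr eq_sym (negbTE d0) mul0r.
  have ab0 : a - b != 0 by rewrite subr_eq0 eq_sym.
  rewrite (bigD1 (a - b)) //= eqxx mul1r big1 ?addr0.
    by rewrite [(a - b) * _]mulrC invfM mulrA.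
  by move=> d /andP[_ /negbTE nd]; rewrite eq_sym nd mul0r.
(* The only error term: the deviation of [prodrep] from its mean W/m along s |-> y / (s - s^2),
   bounded by Cauchy-Schwarz and the variance. *)
pose e := \sum_(s in H) (prodrep R I (y / (s - s ^+ 2)) - W / m).
have Hm : #|H|%:R <= m.
  rewrite /m -(card_subfield_nz R GF) ler_nat subset_leq_card //.
  exact: subD1set.
have e2 : e ^+ 2 <= 2 * p ^+ 2 * n ^+ 5.
  apply: (le_trans (sqr_sum_le _ _)).
  have le1 := sum_subr_sqr_fibre GF yG y0 (fun t => sqr_ge0 (prodrep R I t - W / m)).
  have le2 := le_trans (variance_prodrep_le R GF IG) (sum_sqr_excess_le R GF IG).
  apply: (@le_trans _ _ (p * (2 * (p * n ^+ 5)))); last first.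
    by rewrite le_eqVlt; apply/orP; left; apply/eqP; ring.
  apply: ler_pM => //.
  - by apply: sumr_ge0 => s _; apply: sqr_ge0.
  - by apply: (le_trans Hm); rewrite /m; lra.
  - by apply: (le_trans le1); rewrite ler_pM2l.
have eS : \sum_(s in H) prodrep R I (y / (s - s ^+ 2)) = e + #|H|%:R * (W / m).
  by rewrite /e sumrB sumr_const -[X in _ - X + _]mulr_natl subrK.
have n1 : 1 <= n by rewrite ler1n -(ltr0n R).
have W0 : 0 <= W by apply: sqr_ge0.
have Wn : W <= n ^+ 4.
  have -> : n ^+ 4 = (n ^+ 2) ^+ 2 by rewrite -exprM.
  have : 0 <= n * (n - 1) by rewrite mulr_ge0 // subr_ge0.
  by move=> nn; rewrite ler_sqr ?nnegrE ?sqr_ge0 //; lra.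
have cs := sqr_sum_le (setX G G :\: setX I I) f.
rewrite (sumG id) // (sumG (fun x => x ^+ 2)) ?expr0n // S1 S2 eS in cs.
have cardC : #|setX G G :\: setX I I|%:R = p ^+ 2 - n ^+ 2.
  rewrite cardsD (setIidPr _) ?setXS // !cardsX natrB ?leq_mul ?subset_leq_card //.
  by rewrite !natrM.
rewrite cardC in cs.
have HW : #|H|%:R * (W / m) <= n ^+ 4.
  apply: le_trans Wn; rewrite mulrA ler_pdivrMr // mulrC.
  by rewrite ler_wpM2l.
have pn2 : 0 <= p ^+ 2 - n ^+ 2.
  by rewrite subr_ge0 ler_sqr ?nnegrE // ltW.
(* The leading terms p^2 n^4 on the two sides cancel. What remains is n^6, the saving from the n^2
   points where [f] vanishes, against lower-order terms and the error. *)
have main : n ^+ 6 <= 3 * p ^+ 3 * n ^+ 2 + p ^+ 2 * `|e|.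
  have : (n ^+ 2 * m) ^+ 2 <= (p ^+ 2 - n ^+ 2) * (n ^+ 2 * m + (`|e| + n ^+ 4)).
    apply: (le_trans cs); rewrite ler_wpM2l // lerD2l lerD //.
    exact: ler_norm.
  have : 0 <= n ^+ 2 * `|e| by rewrite mulr_ge0 ?sqr_ge0.
  have : 0 <= p * n ^+ 2 * (p ^+ 2 - n ^+ 2) by rewrite !mulr_ge0 ?sqr_ge0 // ltW.
  have : 0 <= n ^+ 2 * p ^+ 2 by rewrite mulr_ge0 ?sqr_ge0.
  have : 0 <= n ^+ 4 by rewrite exprn_ge0.
  have : 0 <= p * n ^+ 4 by rewrite mulr_ge0 ?exprn_ge0 // ltW.
  rewrite /m; lra.
have n4 : 16 * p ^+ 3 <= n ^+ 4.
  rewrite -ler_sqr ?nnegrE ?mulr_ge0 ?exprn_ge0 ?(ltW p0) //.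
  have : n ^+ 7 * 1 <= n ^+ 7 * n by rewrite ler_wpM2l ?exprn_ge0.
  rewrite -[(n ^+ 4) ^+ 2]exprM -exprSr exprMn -exprM mulr1.
  by lra.
have le13 : 13 * n ^+ 6 <= 16 * (p ^+ 2 * `|e|).
  have : 0 <= n ^+ 2 * (n ^+ 4 - 16 * p ^+ 3) by rewrite mulr_ge0 ?sqr_ge0 ?subr_ge0.
  by lra.
have : (13 * n ^+ 6) ^+ 2 <= (16 * (p ^+ 2 * `|e|)) ^+ 2.
  by rewrite ler_sqr ?nnegrE // !mulr_ge0 ?exprn_ge0 // ltW.
rewrite !exprMn real_normK ?num_real // => lefin.
have le2 : p ^+ 4 * e ^+ 2 <= p ^+ 4 * (2 * p ^+ 2 * n ^+ 5).
  by rewrite ler_wpM2l // exprn_ge0 // ltW.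
have n5 : 0 < n ^+ 5 by rewrite exprn_gt0.
have p6 : 0 <= p ^+ 6 by rewrite exprn_ge0 // ltW.
have : n ^+ 5 * (169 * n ^+ 7) <= n ^+ 5 * (512 * p ^+ 6) by lra.
rewrite ler_pM2l // => con; lra.
Qed.

(** * Planes over a subfield *)

(** By finiteness, multiplication by a nonzero y maps [G] onto itself, so 1 is a multiple of y
    inside [G]. *)
Lemma subring_subfield (F : finFieldType) (G : {set F}) :
  1 \in G -> {in G &, forall x y, x - y \in G} ->
  {in G &, forall x y, x * y \in G} -> is_subfield G.
Proof.
move=> G1 GB GM; split=> // x y xG yG; apply: (GM) => //.
have [->|y0] := eqVneq y 0; first by rewrite invr0 -(subrr 1) GB.
have eG : dilate y G = G.
  apply/eqP; rewrite eqEcard card_dilate // leqnn andbT.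
  by apply/subsetP => _ /imsetP[g gG ->]; apply: GM.
move: (G1); rewrite -{1}eG => /imsetP[g gG e].
by rewrite -[y^-1]mulr1 e mulKf.
Qed.

Definition is_subspace (F : finFieldType) (G V : {set F}) : Prop :=
  [/\ 0 \in V, {in V &, forall x y, x - y \in V} &
      forall g x, g \in G -> x \in V -> g * x \in V].

Definition adjoin (F : finFieldType) (G V : {set F}) (v : F) : {set F} :=
  sumset V (dilate v G).

Lemma subspace_subfield (F : finFieldType) (G : {set F}) :
  is_subfield G -> is_subspace G G.
Proof.
move=> GF; split; [exact: subfield0 | by case: GF | exact: subfieldM].
Qed.

Lemma adjoinP (F : finFieldType) (G V : {set F}) (v z : F) :
  reflect (exists x g, [/\ x \in V, g \in G & z = x + v * g])
          (z \in adjoin G V v).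
Proof.
apply: (iffP (sumsetP _ _ _)).
  by move=> [x [_ [xV /imsetP[g gG ->] ->]]]; exists x, g.
by move=> [x [g [xV gG ->]]]; exists x, (v * g); rewrite imset_f.
Qed.

Lemma adjoin_subspace (F : finFieldType) (G V : {set F}) (v : F) :
  is_subfield G -> is_subspace G V -> is_subspace G (adjoin G V v).
Proof.
move=> GF [V0 VB VM]; split.
- by apply/adjoinP; exists 0, 0; rewrite V0 subfield0 // mulr0 addr0.
- move=> _ _ /adjoinP[x [g [xV gG ->]]] /adjoinP[x' [g' [x'V g'G ->]]].
  apply/adjoinP; exists (x - x'), (g - g'); case: GF => _ GB _.
  by rewrite VB // GB //; split=> //; ring.
move=> c _ cG /adjoinP[x [g [xV gG ->]]].
by apply/adjoinP; exists (c * x), (c * g); rewrite VM ?subfieldM //; split=> //; ring.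
Qed.

Lemma card_adjoin (F : finFieldType) (G V : {set F}) (v : F) :
  is_subfield G -> is_subspace G V -> v \notin V ->
  #|adjoin G V v| = (#|V| * #|G|)%N.
Proof.
move=> GF [V0 VB VM] vV.
pose h (p : F * F) := p.1 + v * p.2.
have -> : adjoin G V v = [set h p | p in setX V G].
  apply/setP => z; apply/adjoinP/imsetP.
    by move=> [x [g [xV gG ->]]]; exists (x, g); rewrite // inE xV gG.
  by move=> [[x g] /setXP[/= xV gG] ->]; exists x, g.
rewrite card_in_imset ?cardsX // => -[x g] [x' g'] /setXP[/= xV gG] /setXP[/= x'V g'G].
rewrite /h /= => e.
have [eg|ng] := eqVneq g g'; first by move: e; rewrite eg => /addIr ->.
case/negP: vV; have gg0 : g - g' != 0 by rewrite subr_eq0.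
have -> : v = (g - g')^-1 * (x' - x).
  have -> : x' - x = v * (g - g') by rewrite -(addrK (v * g') x') -e; ring.
  by rewrite mulrC mulfK.
by apply: VM; [apply: subfieldV => //; case: GF => _ -> | apply: VB].
Qed.

Lemma notin_proper (T : finType) (V : {set T}) :
  (#|V| < #|T|)%N -> exists x, x \notin V.
Proof.
move=> lt; have /set0Pn[x] : ~: V != set0.
  by rewrite -card_gt0 cardsCs setCK subn_gt0.
by rewrite inE; exists x.
Qed.

(** The two bounds leave only dimension 3 over [G]: adjoining elements outside the current subspace
    multiplies its size by |G|, and a fourth independent vector would give |G|^4 elements. *)
Lemma card_cube_subfield (F : finFieldType) (G : {set F}) :
  is_subfield G -> (#|G| ^ 2 < #|F|)%N -> (#|F| < #|G| ^ 4)%N ->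
  #|F| = (#|G| ^ 3)%N.
Proof.
move=> GF lt2 lt4; have p1 := subfield_card_gt1 GF.
have [|v vG] := @notin_proper _ G.
  by apply: leq_ltn_trans lt2; rewrite -{1}[#|G|]expn1 leq_pexp2l // ltnW.
have VG := subspace_subfield GF; pose V := adjoin G G v.
have VV : is_subspace G V by apply: adjoin_subspace.
have cV : #|V| = (#|G| ^ 2)%N by rewrite card_adjoin.
have [|w wV] := @notin_proper _ V; first by rewrite cV.
have cW : #|adjoin G V w| = (#|G| ^ 3)%N by rewrite card_adjoin // cV -expnSr.
have WW : is_subspace G (adjoin G V w) by apply: adjoin_subspace.
have [lt3|] := ltnP (#|G| ^ 3) #|F|.
  have [|z zW] := @notin_proper _ (adjoin G V w); first by rewrite cW.
  have := max_card (mem (adjoin G (adjoin G V w) z)).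
  by rewrite card_adjoin // cW -expnSr leqNgt lt4.
move=> le3; apply/eqP; rewrite eqn_leq le3 -cW.
exact: max_card.
Qed.

(** Otherwise H = G + Gt is a field of order |G|^2 smaller than [F], and a plane over H would have
    |G|^4 elements, more than [F]. *)
Lemma subfield_square_indep (F : finFieldType) (G : {set F}) (t a b : F) :
  is_subfield G -> (#|G| ^ 2 < #|F|)%N -> (#|F| < #|G| ^ 4)%N ->
  t \notin G -> a \in G -> b \in G -> t ^+ 2 <> a + b * t.
Proof.
move=> GF lt2 lt4 tG aG bG e.
pose H := adjoin G G t.
have [H0 HB HM] := adjoin_subspace t GF (subspace_subfield GF).
have HF : is_subfield H.
  apply: subring_subfield => //.
    by apply/adjoinP; exists 1, 0; rewrite subfield0 // mulr0 addr0; case: GF.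
  move=> _ _ /adjoinP[x [y [xG yG ->]]] /adjoinP[x' [y' [x'G y'G ->]]].
  apply/adjoinP; exists (x * x' + y * y' * a), (x * y' + y * x' + y * y' * b).
  split; rewrite ?subfieldD ?subfieldM //.
  have -> : (x + t * y) * (x' + t * y') =
     x * x' + t * (x * y' + y * x') + t ^+ 2 * (y * y') by ring.
  by rewrite e; ring.
have cH : #|H| = (#|G| ^ 2)%N by rewrite card_adjoin //; apply: subspace_subfield.
have [|w wH] := @notin_proper _ H; first by rewrite cH.
have := max_card (mem (adjoin H H w)).
rewrite card_adjoin //; last exact: subspace_subfield.
by rewrite cH -expnD leqNgt lt4.
Qed.

Lemma subfield_quadratic_indep (F : finFieldType) (G : {set F}) (t a b c : F) :
  is_subfield G -> (#|G| ^ 2 < #|F|)%N -> (#|F| < #|G| ^ 4)%N ->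
  t \notin G -> a \in G -> b \in G -> c \in G ->
  a + b * t + c * t ^+ 2 = 0 -> [/\ a = 0, b = 0 & c = 0].
Proof.
move=> GF lt2 lt4 tG aG bG cG e; have GD : {in G &, forall x y, x / y \in G} by case: GF.
have c0 : c = 0.
  apply/eqP; apply/negPn/negP => c0.
  have := @subfield_square_indep _ G t (- a / c) (- b / c) GF lt2 lt4 tG.
  rewrite !GD ?subfieldN // => /(_ isT isT); apply.
  apply: (mulfI c0); have -> : c * t ^+ 2 = - (a + b * t).
    by apply/eqP; rewrite -addr_eq0 addrC e.
  by field.
move: e; rewrite c0 mul0r addr0 => e.
have b0 : b = 0.
  apply/eqP; apply/negPn/negP => b0; case/negP: tG.
  have -> : t = - a / b.
    apply: (mulfI b0); have -> : b * t = - a by apply/eqP; rewrite -addr_eq0 addrC e.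
    by rewrite mulrC divfK.
  by rewrite GD ?subfieldN.
by split=> //; move: e; rewrite b0 mul0r addr0.
Qed.

(** The ordered half and its mirror image cover G * G and share the diagonal. The order of
    [enum_rank] serves only to pick one of the two orderings of each pair. *)
Lemma card_unordered_pairs (T : finType) (G : {set T}) :
  (#|G| * #|G| + #|G| <=
   2 * #|[set p in setX G G | (enum_rank p.1 <= enum_rank p.2)%N]|)%N.
Proof.
set L := [set _ in _ | _]; pose sw (p : T * T) := (p.2, p.1).
have swK : involutive sw by case.
have cL : #|[set sw p | p in L]| = #|L| by rewrite card_imset //; apply: inv_inj.
rewrite mul2n -addnn -{2}cL -cardsUI; apply: leq_add.
  rewrite -cardsX; apply: subset_leq_card; apply/subsetP => -[x y] xyG.
  rewrite in_setU; have [le|lt] := leqP (enum_rank x) (enum_rank y).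
    by rewrite inE xyG /= le.
  apply/orP; right; apply/imsetP; exists (y, x) => //.
  by move: xyG; rewrite !inE /= andbC => ->; rewrite ltnW.
have <- : #|[set (x, x) | x in G]| = #|G| by rewrite card_imset // => x y [].
apply: subset_leq_card; apply/subsetP => _ /imsetP[x xG ->].
have xL : (x, x) \in L by rewrite !inE /= xG leqnn.
by rewrite inE xL; apply/imsetP; exists (x, x).
Qed.

(* The products of two vectors of a plane over [G] are the multiples of the
   split quadratics [(t + a) (t + b)]: a little more than half of the field. *)
Lemma card_split_quadratics (F : finFieldType) (G S : {set F}) (t : F) :
  is_subfield G -> (#|G| ^ 2 < #|F|)%N -> (#|F| < #|G| ^ 4)%N -> t \notin G ->
  (forall g a b, g \in G -> a \in G -> b \in G -> g * ((t + a) * (t + b)) \in S) ->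
  (forall g a, g \in G -> a \in G -> g * (t + a) \in S) ->
  (#|G| ^ 3 < 2 * #|S|)%N.
Proof.
move=> GF lt2 lt4 tG S2 S1.
have indep := @subfield_quadratic_indep _ G t _ _ _ GF lt2 lt4 tG.
have GB : {in G &, forall x y, x - y \in G} by case: GF.
pose L := [set p in setX G G | (enum_rank p.1 <= enum_rank p.2)%N].
pose f2 (x : F * (F * F)) := x.1 * ((t + x.2.1) * (t + x.2.2)).
pose f1 (x : F * F) := x.1 * (t + x.2).
pose T2 := [set f2 x | x in setX (G :\ 0) L].
(* With p = |G| the multiples of quadratics number (p^3 - p)/2, just short of half. The p (p - 1)
   multiples of linear polynomials make up the deficit. *)
pose T1 := [set f1 x | x in setX (G :\ 0) G].
have c2 : #|T2| = (#|G :\ 0%R| * #|L|)%N.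
  rewrite card_in_imset ?cardsX //.
  move=> [g [a b]] [g' [a' b']]; rewrite !inE /f2 /=.
  move=> /andP[/andP[g0 gG] /andP[/andP[aG bG] leab]].
  move=> /andP[/andP[g'0 g'G] /andP[/andP[a'G b'G] leab']] e.
  have [||||e0 e1 /eqP] := indep (g * (a * b) - g' * (a' * b'))
     (g * (a + b) - g' * (a' + b')) (g - g').
  - by rewrite GB ?subfieldM.
  - by rewrite GB ?subfieldM ?subfieldD.
  - by rewrite GB.
  - move: e => /eqP; rewrite -subr_eq0 => /eqP e.
    by rewrite -[RHS]e; ring.
  rewrite subr_eq0 => /eqP eg; subst g'.
  have {}e0 : a * b = a' * b' by apply: (mulfI g0); apply/eqP; rewrite -subr_eq0 e0.
  have {}e1 : a + b = a' + b' by apply: (mulfI g0); apply/eqP; rewrite -subr_eq0 e1.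
  have /eqP : (a - a') * (a - b') = 0.
    have -> : (a - a') * (a - b') = a ^+ 2 - a * (a' + b') + a' * b' by ring.
    by rewrite -e0 -e1; ring.
  rewrite mulf_eq0 !subr_eq0 => /orP[/eqP ea|/eqP ea].
    by subst a'; move/addrI: e1 => ->.
  subst b'; have eb : b = a' by apply: (addrI a); rewrite e1 addrC.
  subst a'; have : enum_rank a = enum_rank b.
    by apply: val_inj; apply/eqP; rewrite eqn_leq leab leab'.
  by move=> /enum_rank_inj ->.
have c1 : #|T1| = (#|G :\ 0%R| * #|G|)%N.
  rewrite card_in_imset ?cardsX //.
  move=> [g a] [g' a']; rewrite !inE /f1 /= => /andP[/andP[g0 gG] aG].
  move=> /andP[/andP[g'0 g'G] a'G] e.
  have [||||/eqP e0 /eqP e1 _] := indep (g * a - g' * a') (g - g') 0.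
  - by rewrite GB ?subfieldM.
  - by rewrite GB.
  - exact: subfield0.
  - move: e => /eqP; rewrite -subr_eq0 => /eqP e.
    by rewrite -[RHS]e; ring.
  move: e1; rewrite subr_eq0 => /eqP eg; subst g'.
  by move: e0; rewrite subr_eq0 => /eqP/(mulfI g0) ->.
have dis : T2 :&: T1 = set0.
  apply/setP => z; rewrite !inE; apply/negP => /andP[].
  move=> /imsetP[[g [a b]] gab ->] /imsetP[[g' a'] ga' e].
  move: gab ga' e; rewrite !inE /f1 /f2 /=.
  move=> /andP[/andP[g0 gG] /andP[/andP[aG bG] _]] /andP[/andP[g'0 g'G] a'G] e.
  have [||||_ _ eg] := indep (g * (a * b) - g' * a') (g * (a + b) - g') g.
  - by rewrite GB ?subfieldM.
  - by rewrite GB ?subfieldM ?subfieldD.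
  - by [].
  - move: e => /eqP; rewrite -subr_eq0 => /eqP e.
    by rewrite -[RHS]e; ring.
  by rewrite eg eqxx in g0.
have sub : T2 :|: T1 \subset S.
  rewrite subUset; apply/andP; split; apply/subsetP => _ /imsetP[x xT ->].
    case: x xT => g [a b]; rewrite !inE /f2 /=.
    by move=> /andP[/andP[_ gG] /andP[/andP[aG bG] _]]; apply: S2.
  by case: x xT => g a; rewrite !inE /f1 /= => /andP[/andP[_ gG] aG]; apply: S1.
have cS : (#|T2| + #|T1| <= #|S|)%N.
  by rewrite -cardsUI dis cards0 addn0 subset_leq_card.
have cL := card_unordered_pairs G; rewrite -/L in cL.
have cG : #|G :\ 0%R| = #|G|.-1 by rewrite (cardsD1 0 G) (subfield0 GF).
rewrite c2 c1 cG in cS.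
have p1 := subfield_card_gt1 GF.
move: cS cL p1; move: #|S| #|L| #|G| => s l [|p] //= cS cL p1.
have h : (p * (p.+1 * p.+1 + p.+1) <= p * (2 * l))%N by rewrite leq_mul2l cL orbT.
by rewrite !expnS expn0; nia.
Qed.

Lemma sum_translate_card (R : realFieldType) (F : finFieldType) (G B C : {set F}) :
  is_subfield G -> B \subset G -> C \subset G ->
  \sum_(s in G) #|[set b in B | b - s \in C]|%:R = #|B|%:R * #|C|%:R :> R.
Proof.
move=> GF BG CG.
transitivity (\sum_(s in G) \sum_(b in B) (b - s \in C)%:R : R).
  apply: eq_bigr => s _; rewrite -sum1_card_set [LHS]big_mkcond [RHS]big_mkcond.
  by apply: eq_bigr => b _; rewrite inE; case: (b \in B); case: (_ \in C).
rewrite exchange_big /= -[#|B|%:R]sum1_card_set mulr_suml.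
apply: eq_bigr => b bB; have bG := subsetP BG b bB.
rewrite mul1r -sum1_card_set.
have inj : injective (fun s => b - s) by move=> s s' /addrI/oppr_inj.
rewrite [RHS](reindex_inj inj) /= [LHS]big_mkcond [RHS]big_mkcond.
apply: eq_bigr => s _; have [sC|_] := boolP (b - s \in C); last by case: ifP.
suff -> : s \in G by [].
by rewrite -(subKr b s); case: GF => _ GB _; rewrite GB // (subsetP CG).
Qed.

(* In a plane over [G], every direction has a line containing [#|A0| / #|G|]
   points of [A0]; two such lines are compared by a translation. *)
Lemma prod_diff_plane (R : realFieldType) (F : finFieldType) (G A : {set F})
    (a v v' : F) :
  is_subfield G -> (#|G| ^ 2 < #|F|)%N -> (#|F| < #|G| ^ 4)%N ->
  v != 0 -> v' / v \notin G ->
  256 * #|G|%:R ^+ 27 <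
    #|A :&: [set a + p.1 * v + p.2 * v' | p in setX G G]|%:R ^+ 14 :> R ->
  (#|F| < 2 * #|prodset (diffset A A) (diffset A A)|)%N.
Proof.
move=> GF lt2 lt4 v0 vG; set P := [set _ | p in _]; set A0 := A :&: P => big.
have GD := subfieldD GF; have GM := subfieldM GF.
have GB : {in G &, forall x y, x - y \in G} by case: GF.
have p1 := subfield_card_gt1 GF.
have p0 : 0 < #|G|%:R :> R by rewrite ltr0n (ltn_trans _ p1).
set p : R := #|G|%:R in big p0; set N : R := #|A0|%:R in big.
have N0 : 0 < N.
  rewrite lt_neqAle ler0n andbT; apply/eqP => e; move: big; rewrite -e expr0n /=.
  by rewrite ltNge mulr_ge0 ?exprn_ge0 // ltW.
have PleG : #|P|%:R <= p ^+ 2.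
  rewrite -natrX ler_nat -mulnn -cardsX; exact: leq_imset_card.
have PS w : (exists x y, [/\ x \in G, y \in G & w = x * v + y * v']) ->
    {in P, forall z, z + w \in P}.
  move=> [x [y [xG yG ->]]] _ /imsetP[[x' y'] /setXP[/= x'G y'G] ->].
  apply/imsetP; exists (x + x', y + y'); first by rewrite inE /= !GD.
  by rewrite /=; ring.
(* The base point b is found by averaging over the plane, which is invariant under translation by
   multiples of w and has at most p^2 points. *)
have line w : (exists x y, [/\ x \in G, y \in G & w = x * v + y * v']) ->
    exists b, N <= p * #|[set g in G | b + g * w \in A0]|%:R.
  move=> [x [y [xG yG ew]]].
  have Pn0 : P != set0.
    apply/set0Pn; exists a; apply/imsetP; exists (0, 0).
      by rewrite inE /= subfield0.
    by rewrite !mul0r !addr0.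
  have le : p * N <= \sum_(b in P) #|[set g in G | b + g * w \in A0]|%:R.
    have -> : \sum_(b in P) #|[set g in G | b + g * w \in A0]|%:R =
        \sum_(g in G) \sum_(b in P) (b + g * w \in A0)%:R :> R.
      rewrite exchange_big /=; apply: eq_bigr => b _.
      rewrite -sum1_card_set [LHS]big_mkcond [RHS]big_mkcond.
      by apply: eq_bigr => g _; rewrite inE; case: (g \in G); case: (_ \in A0).
    rewrite /p -sum1_card_set mulr_suml; apply: ler_sum => g gG.
    rewrite mul1r /N -sum1_card_set (reindex_inj (addIr (g * w))) /=.
    rewrite big_mkcond [leRHS]big_mkcond; apply: ler_sum => b _.
    have [bA|_] := boolP (_ \in A0); last by case: ifP.
    suff -> : b \in P by [].
    rewrite -(addrK (g * w) b) -mulNr; apply: PS.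
      exists (- g * x), (- g * y); rewrite ew !GM ?subfieldN //.
      by split=> //; ring.
    by move: bA; rewrite inE => /andP[].
  have [b _ hb] := exists_ge_avg Pn0 le; exists b.
  rewrite -(ler_pM2l p0); apply: (le_trans hb).
  by rewrite mulrA mulrC -expr2 ler_wpM2r.
have prod w w' y : (exists x y, [/\ x \in G, y \in G & w = x * v + y * v']) ->
    (exists x y, [/\ x \in G, y \in G & w' = x * v + y * v']) -> y \in G ->
    y * (w * w') \in prodset (diffset A A) (diffset A A).
  move=> /line[b hb] /line[b' hb'] yG.
  set B := [set g in G | b + g * w \in A0] in hb.
  set C := [set g in G | b' + g * w' \in A0] in hb'.
  have BG : B \subset G by apply/subsetP => g; rewrite inE => /andP[].
  have CG : C \subset G by apply/subsetP => g; rewrite inE => /andP[].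
  have Gn0 : G != set0 by rewrite -card_gt0 ltnW.
  have le : #|B|%:R * #|C|%:R <=
      \sum_(s in G) #|[set g in B | g - s \in C]|%:R :> R.
    by rewrite (sum_translate_card _ GF).
  (* [prod_diff_subfield] uses one set for both factors. An average translate makes the parameter
     sets of the two lines overlap in at least |B| |C| / p points, and a translation does not affect
     differences. *)
  have [s sG hs] := exists_ge_avg Gn0 le.
  set I := [set g in B | g - s \in C] in hs.
  have IG : I \subset G.
    by apply: subset_trans BG; apply/subsetP => g; rewrite inE => /andP[].
  have NI : N ^+ 2 <= p ^+ 3 * #|I|%:R.
    have h1 : N ^+ 2 <= (p * #|B|%:R) * (p * #|C|%:R).
      by rewrite expr2; apply: ler_pM => //; apply: ltW.
    apply: (le_trans h1).
    have -> : (p * #|B|%:R) * (p * #|C|%:R) = p ^+ 2 * (#|B|%:R * #|C|%:R) by ring.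
    have -> : p ^+ 3 * #|I|%:R = p ^+ 2 * (#|I|%:R * p) by ring.
    by rewrite ler_pM2l ?exprn_gt0.
  have bigI : 256 * p ^+ 6 < #|I|%:R ^+ 7.
    have p21 : 0 < p ^+ 21 by rewrite exprn_gt0.
    rewrite -(ltr_pM2l p21).
    have -> : p ^+ 21 * (256 * p ^+ 6) = 256 * p ^+ 27 by ring.
    apply: (lt_le_trans big).
    have -> : p ^+ 21 * #|I|%:R ^+ 7 = (p ^+ 3 * #|I|%:R) ^+ 7 by ring.
    rewrite -[14%N]/(2 * 7)%N exprM lerXn2r // ?nnegrE ?sqr_ge0 //.
    by rewrite mulr_ge0 ?exprn_ge0 // ltW.
  have [i1 [i2 [i3 [i4 [I1 I2 I3 I4 <-]]]]] := prod_diff_subfield GF IG yG bigI.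
  have IB g : g \in I -> b + g * w \in A by rewrite !inE => /andP[/andP[_ /andP[]]].
  have IC g : g \in I -> b' + (g - s) * w' \in A.
    by rewrite !inE => /andP[_ /andP[_ /andP[]]].
  apply/imset2P; exists (b + i1 * w - (b + i2 * w))
      (b' + (i3 - s) * w' - (b' + (i4 - s) * w')); last by ring.
    by rewrite mem_diffset ?IB.
  by rewrite mem_diffset ?IC.
have e3 := card_cube_subfield GF lt2 lt4; rewrite e3.
(* Dividing by v^2 turns products of vectors of the plane Gv + Gv' into products from G + Gt with t
   = v'/v. *)
have inv2 : v ^- 2 != 0 by rewrite invr_eq0 expf_neq0.
rewrite -[#|prodset _ _|](card_dilate _ inv2).
have G0 := subfield0 GF; have G1 : 1 \in G by case: GF.
have scale z : v ^+ 2 * z \in prodset (diffset A A) (diffset A A) ->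
    z \in dilate (v ^- 2) (prodset (diffset A A) (diffset A A)).
  move=> zS; apply/imsetP; exists (v ^+ 2 * z) => //.
  by rewrite mulKf // expf_neq0.
apply: (card_split_quadratics GF lt2 lt4 vG) => [g x y gG xG yG|g x gG xG].
  apply: scale.
  have -> : v ^+ 2 * (g * ((v' / v + x) * (v' / v + y))) =
     g * ((x * v + 1 * v') * (y * v + 1 * v')) by field.
  by apply: prod => //; [exists x, 1 | exists y, 1].
apply: scale.
have -> : v ^+ 2 * (g * (v' / v + x)) = g * ((x * v + 1 * v') * (1 * v + 0 * v')).
  by field.
by apply: prod => //; [exists x, 1 | exists 1, 0].
Qed.

(** * The pivot *)

Definition quotset (F : finFieldType) (X : {set F}) : {set F} :=
  [set x / y | x in diffset X X, y in diffset X X].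

Lemma quotsetP (F : finFieldType) (X : {set F}) (r : F) :
  reflect (exists a b c d,
    [/\ a \in X, b \in X, c \in X, d \in X & r = (a - b) / (c - d)])
    (r \in quotset X).
Proof.
apply: (iffP imset2P) => [[x y]|].
  move=> /diffsetP[a [b [aX bX ->]]] /diffsetP[c [d [cX dX ->]]] ->.
  by exists a, b, c, d.
move=> [a [b [c [d [aX bX cX dX ->]]]]].
by exists (a - b) (c - d); rewrite ?mem_diffset.
Qed.

(* [S1] is the set of periods of [quotset X] and [S2] the multiplier ring of
   [S1]; the hypotheses give [X \subset S2], whence
   [quotset X \subset S2 \subset S1 \subset quotset X]. *)
Lemma quotset_subfield (F : finFieldType) (X : {set F}) :
  X != set0 ->
  (forall x r, x \in X -> r \in quotset X -> x * r \in quotset X) ->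
  (forall r, r \in quotset X -> 1 + r \in quotset X) ->
  is_subfield (quotset X) /\ X \subset quotset X.
Proof.
move=> /set0Pn[x0 x0X] closedM closedD; set Q := quotset X.
have Q0 : 0 \in Q.
  by apply/quotsetP; exists x0, x0, x0, x0; rewrite subrr mul0r.
pose S1 := [set s | [forall r in Q, s + r \in Q]].
have S1P s : reflect (forall r, r \in Q -> s + r \in Q) (s \in S1).
  by rewrite inE; apply: (iffP forall_inP).
pose S2 := [set s | [forall z in S1, s * z \in S1]].
have S2P s : reflect (forall z, z \in S1 -> s * z \in S1) (s \in S2).
  by rewrite inE; apply: (iffP forall_inP).
have S1_0 : 0 \in S1 by apply/S1P => r; rewrite add0r.
have S1_1 : 1 \in S1 by apply/S1P.
have S1N s : s \in S1 -> forall r, r \in Q -> - s + r \in Q.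
  move=> /S1P sQ r rQ; have eQ : [set s + z | z in Q] = Q.
    apply/eqP; rewrite eqEcard card_imset ?leqnn ?andbT; last exact: addrI.
    by apply/subsetP => _ /imsetP[z zQ ->]; apply: sQ.
  by move: rQ; rewrite -{1}eQ => /imsetP[z zQ ->]; rewrite addKr.
have S1B s s' : s \in S1 -> s' \in S1 -> s - s' \in S1.
  move=> /S1P sS s'S; apply/S1P => r rQ; rewrite -addrA; apply: sS.
  exact: S1N.
have XS2 x : x \in X -> x \in S2.
  move=> xX; apply/S2P => z zS; have [->|x0'] := eqVneq x 0; first by rewrite mul0r.
  have eQ : dilate x Q = Q.
    apply/eqP; rewrite eqEcard card_dilate // leqnn andbT.
    by apply/subsetP => _ /imsetP[r rQ ->]; apply: closedM.
  apply/S1P => r; rewrite -{1}eQ => /imsetP[r' r'Q ->].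
  by rewrite -mulrDr closedM //; apply: (S1P _ zS).
have S2F : is_subfield S2.
  apply: subring_subfield.
  - by apply/S2P => z zS; rewrite mul1r.
  - by move=> s s' /S2P sS /S2P s'S; apply/S2P => z zS; rewrite mulrBl S1B ?sS ?s'S.
  - by move=> s s' /S2P sS /S2P s'S; apply/S2P => z zS; rewrite -mulrA sS ?s'S.
suff -> : Q = S2 by split=> //; apply/subsetP.
apply/eqP; rewrite eqEsubset; apply/andP; split; apply/subsetP => z.
  move=> /quotsetP[a [b [c [d [aX bX cX dX ->]]]]].
  by case: S2F => _ SB SD; rewrite SD ?SB ?XS2.
by move=> /S2P/(_ 1 S1_1)/S1P/(_ 0 Q0); rewrite addr0 mulr1.
Qed.

Lemma distortion_ge1 (R : realFieldType) (F : finFieldType) (A : {set F}) (t : F) :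
  A != set0 -> 1 <= distortion R A t.
Proof.
move=> An0; have A0 : 0 < #|A|%:R :> R by rewrite ltr0n card_gt0.
rewrite ler_pdivlMr // mul1r ler_nat; have /set0Pn[a aA] := An0.
rewrite -(card_imset A (addIr (- (t * a)))); apply: subset_leq_card.
by apply/subsetP => _ /imsetP[b bA ->]; rewrite mem_diffset // imset_f.
Qed.

Lemma distortion0 (R : realFieldType) (F : finFieldType) (A : {set F}) :
  A != set0 -> distortion R A 0 = 1.
Proof.
move=> An0; have A0 : 0 < #|A|%:R :> R by rewrite ltr0n card_gt0.
apply: le_anti; rewrite distortion_ge1 // andbT ler_pdivrMr // mul1r ler_nat.
apply: subset_leq_card; apply/subsetP => z.
by move=> /diffsetP[a [_ [aA /imsetP[b bA ->] ->]]]; rewrite mul0r subr0.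
Qed.

Lemma distortion_mul_le (R : realFieldType) (F : finFieldType) (A : {set F})
    (s t : F) (K L : R) :
  A != set0 -> distortion R A s <= K -> distortion R A t <= L ->
  distortion R A (s * t) <= K * L.
Proof.
move=> An0 sK tL; have s1 := distortion_ge1 R s An0; have t1 := distortion_ge1 R t An0.
apply: (@le_trans _ _ (distortion R A s * distortion R A t)); last first.
  by apply: ler_pM => //; lra.
have [->|s0] := eqVneq s 0; last exact: distortionM.
by rewrite mul0r distortion0 // mul1r.
Qed.

(** Cauchy-Schwarz on the support A - zA of [dilrep], which has at most L |A| elements. *)
Lemma energy_ge_distortion (R : realFieldType) (F : finFieldType) (A : {set F})
    (z : F) (L : R) :
  A != set0 -> distortion R A z <= L ->
  #|A|%:R ^+ 3 <= L * (#|A|%:R ^+ 2 + quotrep R A z).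
Proof.
move=> An0 zL; have A0 : 0 < #|A|%:R :> R by rewrite ltr0n card_gt0.
rewrite -sum_sqr_dilrep; set D := diffset A (dilate z A).
have out s : s \notin D -> dilrep R A z s = 0.
  move=> sD; rewrite /dilrep big1 // => a aA; rewrite big1 // => b bA.
  by case: eqP => // e; case/negP: sD; rewrite -e mem_diffset // imset_f.
have sD (f : R -> R) : f 0 = 0 ->
    \sum_s f (dilrep R A z s) = \sum_(s in D) f (dilrep R A z s).
  move=> f0; rewrite (bigID [in D]) /= [X in _ + X]big1 ?addr0 //.
  by move=> s /out ->.
have := sqr_sum_le D (dilrep R A z).
rewrite -(sD id) // -(sD (fun y => y ^+ 2)) ?expr0n // sum_dilrep -exprM => cs.
rewrite -(ler_pM2r A0) -exprSr; apply: (le_trans cs).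
rewrite mulrAC ler_wpM2r //; first by apply: sumr_ge0 => s _; apply: sqr_ge0.
by rewrite -ler_pdivrMr.
Qed.

(** With n = |A| and q = |F|, small distortion makes the energy at least n^3 / L. The hypothesis 2 L
    n <= q says that this is at least twice the expected n^4 / q, so each z in [Z] has excess at
    least n^3 / (2L), out of a total of at most q n^2. *)
Lemma card_distortion_le (R : realFieldType) (F : finFieldType) (A Z : {set F})
    (L : R) :
  A != set0 -> 1 <= L -> 2 * L * #|A|%:R <= #|F|%:R ->
  (forall z, z \in Z -> distortion R A z <= L) ->
  #|Z|%:R * #|A|%:R <= 2 * L * #|F|%:R.
Proof.
move=> An0 L1 LA hL; have n0 : 0 < #|A|%:R :> R by rewrite ltr0n card_gt0.
have q0 : 0 < #|F|%:R :> R by rewrite ltr0n; apply/card_gt0P; exists 0.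
have TF := subfieldT F.
have sum_le : \sum_(z in Z) excess R [set: F] A z <= #|F|%:R * #|A|%:R ^+ 2.
  rewrite -cardsT; apply: le_trans (sum_excess_le R TF (subsetT A)).
  rewrite [leRHS](big_setID Z) /= setTI lerDl sumr_ge0 // => z _.
  by rewrite excess_ge0 ?inE.
have le1 z : z \in Z -> #|A|%:R ^+ 3 <= 2 * L * excess R [set: F] A z.
  move=> zZ; have h1 := energy_ge_distortion An0 (hL z zZ).
  have h2 : 2 * L * (#|A|%:R ^+ 4 / #|F|%:R) <= #|A|%:R ^+ 3.
    rewrite mulrA ler_pdivrMr //.
    have : 0 <= #|A|%:R ^+ 3 :> R by rewrite exprn_ge0.
    by move=> n3; have := ler_wpM2l n3 LA; rewrite exprS; lra.
  by rewrite /excess cardsT; lra.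
have : \sum_(z in Z) #|A|%:R ^+ 3 <= \sum_(z in Z) 2 * L * excess R [set: F] A z.
  by apply: ler_sum.
rewrite -mulr_sumr sumr_const -[X in X <= _]mulr_natl => h.
have h2 : 2 * L * (\sum_(z in Z) excess R [set: F] A z)
    <= 2 * L * (#|F|%:R * #|A|%:R ^+ 2).
  by rewrite ler_wpM2l //; lra.
have n20 : 0 < #|A|%:R ^+ 2 :> R by rewrite exprn_gt0.
rewrite -(ler_pM2r n20); move: (le_trans h h2).
by rewrite exprS; lra.
Qed.

(* The pivot: if [xi] is not in [quotset X] then [(x, y) |-> x + xi y] is
   injective on [X * X] and yields too many elements of small distortion. *)
Lemma mem_quotset_pivot (R : realFieldType) (F : finFieldType) (A X : {set F})
    (L : R) (xi : F) :
  A != set0 -> 1 <= L -> 2 * L * #|A|%:R <= #|F|%:R ->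
  2 * L * #|F|%:R < #|X|%:R ^+ 2 * #|A|%:R ->
  (forall x y, x \in X -> y \in X -> distortion R A (x + xi * y) <= L) ->
  xi \in quotset X.
Proof.
move=> An0 L1 LA big hL; apply/negPn/negP => nxi.
pose f (p : F * F) := p.1 + xi * p.2.
have f_inj : {in setX X X &, injective f}.
  move=> [x y] [x' y'] /setXP[/= xX yX] /setXP[/= x'X y'X]; rewrite /f /= => e.
  have [ey|ny] := eqVneq y y'; first by move: e; rewrite ey => /addIr ->.
  case/negP: nxi; apply/quotsetP; exists x', x, y, y'; split=> //.
  have yy0 : y - y' != 0 by rewrite subr_eq0.
  by rewrite -(addrK (xi * y') x') -e; field.
have := @card_distortion_le R F A [set f p | p in setX X X] L An0 L1 LA.
rewrite card_in_imset // cardsX natrM -expr2 leNgt big => /(_ _)/negP; apply=> //.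
by move=> _ /imsetP[[x y] /setXP[/= xX yX] ->]; apply: hL.
Qed.

Lemma distortion_sub (R : realFieldType) (F : finFieldType) (A : {set F})
    (c d : F) (L : R) :
  A != set0 -> distortion R A 1 <= L -> distortion R A c <= L ->
  distortion R A d <= L -> distortion R A (c - d) <= (3 * L) ^+ 3.
Proof.
move=> An0 L1 Lc Ld; have L0 : 0 <= L.
  by rewrite (le_trans _ L1) // (le_trans _ (distortion_ge1 R 1 An0)).
have := @distortion_sum R F A [:: c] [:: d] L An0 L0.
rewrite !big_seq1; apply => t; rewrite !inE => /or3P[]/eqP-> //.
Qed.

(** The pivot is applied to xi = x r and to xi = 1 + r with r = (a - b) / (c - d). Over the
    denominator c - d, the numerator of x' + xi y is a signed sum of four monomials of degree at
    most 3, or of six of degree 2. Its distortion is at most (5 L^3)^5 or (7 L^2)^7, both below 7^7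
    L^15, and the denominator costs (3 L)^3. This is the origin of L^18. *)
Lemma quotset_subfield_of_distortion (R : realFieldType) (F : finFieldType)
    (A X : {set F}) (L : R) :
  A != set0 -> (1 < #|X|)%N -> distortion R A 1 <= L ->
  (forall x, x \in X -> distortion R A x <= L) ->
  2 * (7 ^+ 7 * 3 ^+ 3 * L ^+ 18) * #|A|%:R <= #|F|%:R ->
  2 * (7 ^+ 7 * 3 ^+ 3 * L ^+ 18) * #|F|%:R < #|X|%:R ^+ 2 * #|A|%:R ->
  (is_subfield (quotset X) /\ X \subset quotset X) /\
  #|quotset X|%:R * #|A|%:R <= 2 * (3 * L) ^+ 6 * #|F|%:R.
Proof.
move=> An0 X1 hL1 hL; set La := 7 ^+ 7 * _ * _ => LaA big.
have L1 : 1 <= L := le_trans (distortion_ge1 R 1 An0) hL1.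
have L0 : 0 <= L by lra.
have sub3 c d : c \in X -> d \in X -> distortion R A (c - d) <= (3 * L) ^+ 3.
  by move=> cX dX; apply: distortion_sub => //; apply: hL.
have LX m n : (m <= n)%N -> L ^+ m <= L ^+ n by apply: ler_weXn2l.
have LXge1 m : 1 <= L ^+ m by rewrite -(expr0 L) LX.
have La1 : 1 <= La by have := LXge1 18%N; rewrite /La; lra.
have Xn0 : X != set0 by rewrite -card_gt0 ltnW.
have [x1 [x2 [x1X x2X x12]]] : exists x1 x2, [/\ x1 \in X, x2 \in X & x1 != x2].
  have /card_gt1P[x1 [x2 [h1 h2 h3]]] := X1.
  by exists x1, x2.
have Q0 : 0 \in quotset X.
  by apply/quotsetP; exists x1, x1, x1, x1; rewrite subrr mul0r.
have Q1 : 1 \in quotset X.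
  by apply/quotsetP; exists x1, x2, x1, x2; split=> //; rewrite divff // subr_eq0.
split; last first.
  apply: card_distortion_le => //.
  - rewrite exprMn; have := LXge1 6%N; lra.
  - apply: le_trans LaA; rewrite ler_wpM2r // ler_wpM2l // exprMn /La.
    have := LX 6%N 18%N isT; have := LXge1 6%N; lra.
  move=> _ /quotsetP[a [b [c [d [aX bX cX dX ->]]]]].
  (* [quotset] admits zero denominators; the fraction is then 0, with distortion 1. *)
  have [e0|e0] := eqVneq (c - d) 0.
    by rewrite e0 invr0 mulr0 distortion0 // exprMn; have := LXge1 6%N; lra.
  apply: (le_trans (distortionV R (a - b) An0 e0)).
  have ge0 t : 0 <= distortion R A t by rewrite (le_trans ler01) // distortion_ge1.
  by rewrite -[6%N]/(3 + 3)%N exprD; apply: ler_pM => //; apply: sub3.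
have frac e c d : c \in X -> d \in X -> c - d != 0 ->
    distortion R A e <= 7 ^+ 7 * L ^+ 15 -> distortion R A (e / (c - d)) <= La.
  move=> cX dX cd0 he; apply: (le_trans (distortionV R e An0 cd0)).
  have ge0 t : 0 <= distortion R A t by rewrite (le_trans ler01) // distortion_ge1.
  apply: (le_trans (ler_pM (ge0 _) (ge0 _) he (sub3 _ _ cX dX))).
  by rewrite /La le_eqVlt; apply/orP; left; apply/eqP; ring.
have L2 s t : distortion R A s <= L -> distortion R A t <= L ->
    distortion R A (s * t) <= L ^+ 2.
  by rewrite expr2; apply: distortion_mul_le.
have L3 s t u : distortion R A s <= L -> distortion R A t <= L ->
    distortion R A u <= L -> distortion R A (s * t * u) <= L ^+ 3.
  move=> Ls Lt Lu; rewrite exprSr; apply: distortion_mul_le => //.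
  exact: L2.
have le23 : L ^+ 2 <= L ^+ 3 by apply: LX.
apply: quotset_subfield => //.
  move=> x r xX /quotsetP[a [b [c [d [aX bX cX dX ->]]]]].
  have [e0|e0] := eqVneq (c - d) 0; first by rewrite e0 invr0 !mulr0.
  apply: (mem_quotset_pivot An0 La1 LaA big) => x' y x'X yX.
  have -> : x' + x * ((a - b) / (c - d)) * y =
    ((x' * c + x * a * y) - (x' * d + x * b * y)) / (c - d) by field.
  apply: frac => //.
  have h : forall t, t \in 1 :: [:: x' * c; x * a * y] ++ [:: x' * d; x * b * y] ->
      distortion R A t <= L ^+ 3.
    move=> t; rewrite !inE => /or4P[/eqP->|/eqP->|/eqP->|/orP[/eqP->|/eqP->]].
    - by apply: (le_trans hL1); rewrite -[leLHS]expr1 LX.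
    - by apply: le_trans le23; apply: L2; apply: hL.
    - by apply: L3; apply: hL.
    - by apply: le_trans le23; apply: L2; apply: hL.
    - by apply: L3; apply: hL.
  have := distortion_sum An0 (exprn_ge0 3 L0) h.
  rewrite !big_cons !big_nil !addr0 /= => le; apply: (le_trans le).
  rewrite exprMn -exprM ler_wpM2r //; first exact: exprn_ge0.
  by rewrite -!natrX ler_nat.
move=> r /quotsetP[a [b [c [d [aX bX cX dX ->]]]]].
have [e0|e0] := eqVneq (c - d) 0; first by rewrite e0 invr0 !mulr0 addr0.
apply: (mem_quotset_pivot An0 La1 LaA big) => x' y x'X yX.
have -> : x' + (1 + (a - b) / (c - d)) * y =
  ((x' * c + (y * c + y * a)) - (x' * d + (y * d + y * b))) / (c - d) by field.
apply: frac => //.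
have h : forall t, t \in 1 :: [:: x' * c; y * c; y * a] ++ [:: x' * d; y * d; y * b] ->
    distortion R A t <= L ^+ 2.
  move=> t; rewrite !inE.
  move=> /or4P[/eqP->|/eqP->|/eqP->|/or4P[/eqP->|/eqP->|/eqP->|/eqP->]];
    try by apply: L2; apply: hL.
  by apply: (le_trans hL1); rewrite -[leLHS]expr1 LX.
have := distortion_sum An0 (exprn_ge0 2 L0) h.
rewrite !big_cons !big_nil !addr0 /= => le; apply: (le_trans le).
rewrite exprMn -exprM ler_wpM2l ?exprn_ge0 //; exact: LX.
Qed.

(** * A common set of small distortion *)

(** Join a to b when a - x b is a popular difference. A path of length three from a to b writes a -
    x b as an alternating sum of three popular differences. There are at most 2 K n of these, with n
    = |A|, and each a - x b arises from about n^2 paths, which leaves O(n) values. In 12 K the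
    factor 2 K is the inverse edge density and 6 is the loss in the path lemma; 12^8 covers the
    remaining constants. *)
Lemma balog_szemeredi_gowers (R : realFieldType) (F : finFieldType)
    (A : {set F}) (x : F) (K : R) :
  A != set0 -> x != 0 -> 0 < K ->
  #|A|%:R ^+ 3 <= K * (#|A|%:R ^+ 2 + quotrep R A x) ->
  exists A' B' : {set F}, [/\ A' \subset A, B' \subset A,
    #|A|%:R <= 12 * K * #|A'|%:R, #|A|%:R <= 12 * K * #|B'|%:R &
    #|diffset A' (dilate x B')|%:R <= (12 * K) ^+ 8 * #|A|%:R].
Proof.
move=> An0 x0 K0 energy.
have n0 : 0 < #|A|%:R :> R by rewrite ltr0n card_gt0.
set n : R := #|A|%:R in n0 energy *.
have rep0 s : 0 <= dilrep R A x s by do 2!apply: sumr_ge0 => ? _; rewrite ler0n.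
have repn s : dilrep R A x s <= n.
  rewrite /n -sum1_card_set /dilrep exchange_big /=; apply: ler_sum => b _.
  have [aA|naA] := boolP (s + x * b \in A).
    rewrite (bigD1 _ aA) /= big1 ?addr0; first by case: eqP.
    move=> a /andP[_ na]; case: eqP => // e; case/eqP: na.
    by rewrite -e subrK.
  rewrite big1 // => a aA; case: eqP => // e; case/negP: naA.
  by rewrite -e subrK.
pose S := [set s | n / (2 * K) <= dilrep R A x s].
have t0 : 0 <= n / (2 * K) by rewrite divr_ge0 ?mulr_ge0 // ltW.
have cS : #|S|%:R <= 2 * K * n.
  have := @card_ge_markov R _ [set: F] (dilrep R A x) (n / (2 * K)) (fun i _ => rep0 i).
  rewrite (eq_bigl predT) ?sum_dilrep; last by move=> s; rewrite inE.
  have -> : [set s in [set: F] | n / (2 * K) <= dilrep R A x s] = S.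
    by apply/setP => s; rewrite !inE.
  rewrite -/n mulrAC ler_pdivrMr ?mulr_gt0 // => h.
  by rewrite -(ler_pM2l n0); lra.
have edges : n * n <= 2 * K * \sum_(a in A) \sum_(b in A) (a - x * b \in S)%:R.
  have -> : \sum_(a in A) \sum_(b in A) (a - x * b \in S)%:R =
      \sum_(s in S) dilrep R A x s.
    rewrite /dilrep [RHS]exchange_big /=; apply: eq_bigr => a _.
    rewrite [RHS]exchange_big /=; apply: eq_bigr => b _.
    have [sS|sS] := boolP (_ \in S).
      rewrite (bigD1 _ sS) /= eqxx big1 ?addr0 // => s /andP[_ ns].
      by rewrite eq_sym (negbTE ns).
    by rewrite big1 // => s s'S; case: eqP => // e; move: sS; rewrite e s'S.
  have h1 : \sum_s dilrep R A x s ^+ 2 <=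
      n / (2 * K) * n ^+ 2 + n * \sum_(s in S) dilrep R A x s.
    rewrite -[X in _ * X + _](sum_dilrep R A x) mulr_sumr [leLHS](bigID [in S]) /= addrC.
    apply: lerD.
      rewrite [leLHS]big_mkcond; apply: ler_sum => s _.
      case: ifP => [|_]; last by rewrite mulr_ge0.
      by rewrite inE -ltNge => /ltW h; rewrite expr2 ler_wpM2r.
    by rewrite mulr_sumr; apply: ler_sum => s _; rewrite expr2 ler_wpM2r.
  rewrite sum_sqr_dilrep -/n in h1.
  have := le_trans energy (ler_wpM2l (ltW K0) h1).
  have -> : K * (n / (2 * K) * n ^+ 2 + n * \sum_(s in S) dilrep R A x s) =
     n ^+ 3 / 2 + n * (K * \sum_(s in S) dilrep R A x s).
    by field; rewrite gt_eqF.
  move=> h2; have : n * (n * n) <= n * (2 * K * \sum_(s in S) dilrep R A x s) by lra.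
  by rewrite ler_pM2l.
have k0 : 0 < 2 * K by rewrite mulr_gt0.
have [A' [B' [A'A B'A cA' cB' paths]]] := many_paths_of_length_three An0 An0 k0 edges.
exists A', B'; split=> //; rewrite -/n in cA' cB' paths.
- by apply: (le_trans cA'); rewrite le_eqVlt; apply/orP; left; apply/eqP; ring.
- apply: (le_trans cB'); have : 0 <= K * #|B'|%:R by rewrite mulr_ge0 // ltW.
  by lra.
pose T (d : F) := [set p in setX S (setX S S) | p.1 - p.2.1 + p.2.2 == d].
have cT d : d \in diffset A' (dilate x B') -> n * n <= 3072 * (2 * K) ^+ 5 * #|T d|%:R.
  move=> /diffsetP[a [_ [aA' /imsetP[b bB' ->] ->]]].
  apply: (le_trans (paths a b aA' bB')); rewrite ler_wpM2l //.
    by rewrite mulr_ge0 ?exprn_ge0 // ltW.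
  (* A path with inner vertices p.2 and p.1 is recovered from its triple of popular differences, so
     paths inject into [T d]. *)
  pose h (p : F * F) := (a - x * p.2, (p.1 - x * p.2, p.1 - x * b)).
  rewrite ler_nat -(card_imset _ (f := h)); last first.
    move=> [a1 b1] [a2 b2] [] e1 _ e3.
    by rewrite (mulfI x0 (oppr_inj (addrI _ e1))) (addIr _ e3).
  apply: subset_leq_card; apply/subsetP => z /imsetP[[a1 b1]].
  rewrite !inE /= => /andP[_ /and3P[s1 s2 s3]] ->.
  by rewrite /= s1 s2 s3 /=; apply/eqP; ring.
have sumT : \sum_(d in diffset A' (dilate x B')) #|T d|%:R <= #|S|%:R ^+ 3 :> R.
  have -> : #|S|%:R ^+ 3 = #|setX S (setX S S)|%:R :> R.
    by rewrite !cardsX !natrM; ring.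
  rewrite -[leRHS]sum1_card_set.
  have -> : \sum_(d in diffset A' (dilate x B')) #|T d|%:R =
     \sum_(p in setX S (setX S S)) \sum_(d in diffset A' (dilate x B'))
        (p.1 - p.2.1 + p.2.2 == d)%:R :> R.
    rewrite exchange_big /=; apply: eq_bigr => d _.
    rewrite -sum1_card_set [LHS]big_mkcond [RHS]big_mkcond.
    by apply: eq_bigr => p _; rewrite inE; case: (p \in _); case: (_ == d).
  apply: ler_sum => p _; rewrite -[leRHS](sum_eq_ind1 R (p.1 - p.2.1 + p.2.2)).
  rewrite [leLHS]big_mkcond; apply: ler_sum => d _.
  by case: ifP.
set D := diffset _ _ in cT sumT *.
have h1 : #|D|%:R * (n * n) <= 3072 * (2 * K) ^+ 5 * \sum_(d in D) #|T d|%:R.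
  rewrite -sum1_card_set mulr_suml mulr_sumr; apply: ler_sum => d dD.
  by rewrite mul1r; apply: cT.
have h2 : #|S|%:R ^+ 3 <= (2 * K * n) ^+ 3.
  by rewrite lerXn2r ?nnegrE // ?mulr_ge0 // ltW.
have h3 : 0 <= 3072 * (2 * K) ^+ 5 by rewrite mulr_ge0 ?exprn_ge0 // ltW.
have := le_trans h1 (ler_wpM2l h3 (le_trans sumT h2)).
have -> : 3072 * (2 * K) ^+ 5 * (2 * K * n) ^+ 3 = (3072 * 256 * K ^+ 8 * n) * (n * n) by ring.
rewrite ler_pM2r ?mulr_gt0 // => h4; apply: (le_trans h4).
rewrite ler_pM2r // exprMn ler_pM2r ?exprn_gt0 //.
by lra.
Qed.

Lemma ruzsa_triangle_le (R : realFieldType) (F : finFieldType) (X Y Z : {set F})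
    (a b : R) :
  #|diffset Y X|%:R <= a -> #|diffset X Z|%:R <= b ->
  #|diffset Y Z|%:R * #|X|%:R <= a * b.
Proof.
move=> ha hb; apply: le_trans (ler_pM _ _ ha hb) => //.
by rewrite mulrC -!natrM ler_nat ruzsa_triangle.
Qed.

(* Bourgain's device: pass from sets [A x], [B x] depending on [x] to a single
   [A x0], via the intersections with [A x0] and [B x0]. *)
Lemma common_small_distortion (R : realFieldType) (F : finFieldType)
    (A X : {set F}) (K : R) :
  A != set0 -> X != set0 -> 0 \notin X -> 1 <= K ->
  (forall x, x \in X -> exists A' B' : {set F}, [/\ A' \subset A, B' \subset A,
    #|A|%:R <= K * #|A'|%:R, #|A|%:R <= K * #|B'|%:R &
    #|diffset A' (dilate x B')|%:R <= K ^+ 8 * #|A|%:R]) ->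
  exists x0, x0 \in X /\ exists A' X' : {set F},
    [/\ A' \subset A, X' \subset X, #|A|%:R <= K * #|A'|%:R,
        #|X|%:R <= 2 * K ^+ 4 * #|X'|%:R &
        distortion R A' 1 <= 2 * K ^+ 56 /\
        forall x, x \in X' -> distortion R A' (x / x0) <= 2 * K ^+ 56].
Proof.
move=> An0 Xn0 X0 K1 hyp.
have n0 : 0 < #|A|%:R :> R by rewrite ltr0n card_gt0.
set n : R := #|A|%:R in n0 hyp *.
have K0 : 0 < K by lra.
pose ok x (p : {set F} * {set F}) := [&& p.1 \subset A, p.2 \subset A,
  n <= K * #|p.1|%:R, n <= K * #|p.2|%:R &
  #|diffset p.1 (dilate x p.2)|%:R <= K ^+ 8 * n].
(* A choice of sets for each x; the default never occurs for x in [X]. *)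
pose c x := odflt (set0, set0) [pick p | ok x p].
have cP x : x \in X -> ok x (c x).
  move=> xX; rewrite /c; case: pickP => //= no.
  have [A' [B' [h1 h2 h3 h4 h5]]] := hyp x xX.
  by have := no (A', B'); rewrite /ok /= h1 h2 h3 h4 h5.
pose As x := (c x).1; pose Bs x := (c x).2.
have {cP hyp}hyp x : x \in X -> [/\ As x \subset A, Bs x \subset A,
    n <= K * #|As x|%:R, n <= K * #|Bs x|%:R &
    #|diffset (As x) (dilate x (Bs x))|%:R <= K ^+ 8 * n].
  by move=> /cP/and5P[].
(* The rectangles As x * Bs x have density at least K^-2 in A * A. Intersecting rectangles makes
   both coordinates meet at once. *)
have AAn0 : setX A A != set0 by rewrite -card_gt0 cardsX muln_gt0 card_gt0 An0.
have al0 : 0 <= K ^- 2 by rewrite invr_ge0 exprn_ge0 // ltW.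
have hP x : x \in X -> setX (As x) (Bs x) \subset setX A A /\
    K ^- 2 * #|setX A A|%:R <= #|setX (As x) (Bs x)|%:R.
  move=> /hyp[h1 h2 h3 h4 _]; split; first exact: setXS.
  rewrite !cardsX !natrM -/n ler_pdivrMl ?exprn_gt0 //.
  have -> : K ^+ 2 * (#|As x|%:R * #|Bs x|%:R) = (K * #|As x|%:R) * (K * #|Bs x|%:R).
    by ring.
  by apply: ler_pM => //; apply: ltW.
have [x0 x0X hx0] := popular_intersection Xn0 AAn0 al0 hP.
exists x0; split=> //.
set X' := [set x in X | _] in hx0.
exists (As x0), X'; have [A0A B0A nA nB d0] := hyp x0 x0X.
have K4 : 0 < 2 * K ^+ 4 by rewrite mulr_gt0 ?exprn_gt0.
have alE : K ^- 2 ^+ 2 / 2 = (2 * K ^+ 4)^-1.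
  by field; rewrite gt_eqF.
have A0pos : 0 < #|As x0|%:R :> R.
  by have := lt_le_trans n0 nA; rewrite pmulr_rgt0.
have B0pos : 0 < #|Bs x0|%:R :> R.
  by have := lt_le_trans n0 nB; rewrite pmulr_rgt0.
have x0n : x0 != 0 by apply: contraNneq X0 => <-.
have d0' : #|diffset (dilate x0 (Bs x0)) (As x0)|%:R <= K ^+ 8 * n.
  by rewrite card_diffsetC.
have dAA : #|diffset (As x0) (As x0)|%:R <= K ^+ 17 * n.
  have := ruzsa_triangle_le d0 d0'; rewrite card_dilate // => h.
  rewrite -(ler_pM2r B0pos); apply: (le_trans h).
  have -> : K ^+ 8 * n * (K ^+ 8 * n) = K ^+ 16 * n * n by ring.
  have -> : K ^+ 17 * n * #|Bs x0|%:R = K ^+ 16 * n * (K * #|Bs x0|%:R) by ring.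
  by rewrite ler_pM2l // mulr_gt0 ?exprn_gt0.
have dBB : #|diffset (Bs x0) (Bs x0)|%:R <= K ^+ 17 * n.
  have := ruzsa_triangle_le d0' d0.
  rewrite diffset_dilate card_dilate // => h.
  rewrite -(ler_pM2r A0pos); apply: (le_trans h).
  have -> : K ^+ 8 * n * (K ^+ 8 * n) = K ^+ 16 * n * n by ring.
  have -> : K ^+ 17 * n * #|As x0|%:R = K ^+ 16 * n * (K * #|As x0|%:R) by ring.
  by rewrite ler_pM2l // mulr_gt0 ?exprn_gt0.
have LX a b : (a <= b)%N -> K ^+ a <= K ^+ b by apply: ler_weXn2l.
split=> //.
- by apply/subsetP => x; rewrite inE => /andP[].
- by move: hx0; rewrite alE ler_pdivrMl.
split.
  rewrite /distortion ler_pdivrMr // dilate1; apply: (le_trans dAA).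
  apply: (@le_trans _ _ (K ^+ 18 * #|As x0|%:R)).
    by rewrite [in leRHS]exprSr -mulrA ler_wpM2l // exprn_ge0 // ltW.
  rewrite ler_wpM2r //; have := LX 18%N 56%N isT; have := exprn_ge0 56 (ltW K0); lra.
move=> x; rewrite inE => /andP[xX].
have [_ _ _ _ dx] := hyp x xX.
have xn : x != 0 by apply: contraNneq X0 => <-.
have -> : setX (As x0) (Bs x0) :&: setX (As x) (Bs x) =
    setX (As x0 :&: As x) (Bs x0 :&: Bs x).
  by apply/setP => -[a b]; rewrite !inE /= andbACA.
rewrite alE !cardsX !natrM -/n ler_pdivrMl //.
set A1 := _ :&: _; set B1 := _ :&: _ => h11.
(* Ruzsa's triangle inequality is chained through As x0, A1, x B1, x (Bs x0) and (x / x0) (As x0).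
   The three differences up to x (Bs x0) cost 17 + 8 + 17 powers of [K], and dividing by |A1| |B1|
   costs 4 more. The last difference is that for x0, dilated by x / x0, and costs 8; the final
   normalisation costs 2. The total is 56. *)
have d1 : #|diffset (As x0) A1|%:R <= K ^+ 17 * n.
  by apply: le_trans dAA; rewrite ler_nat subset_leq_card // diffsetS // subsetIl.
have d2 : #|diffset A1 (dilate x B1)|%:R <= K ^+ 8 * n.
  apply: le_trans dx; rewrite ler_nat subset_leq_card // diffsetS ?subsetIr //.
  by apply: imsetS; apply: subsetIr.
have d3 : #|diffset (dilate x B1) (dilate x (Bs x0))|%:R <= K ^+ 17 * n.
  rewrite diffset_dilate card_dilate //; apply: le_trans dBB.
  by rewrite ler_nat subset_leq_card // diffsetS // subsetIl.
have r1 := ruzsa_triangle_le d2 d3; rewrite card_dilate // in r1.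
have nn0 : 0 < n * n by rewrite mulr_gt0.
have AB1 : 0 < #|A1|%:R * #|B1|%:R :> R.
  by rewrite -(pmulr_rgt0 _ K4); apply: lt_le_trans h11.
have B1pos : 0 < #|B1|%:R :> R.
  by rewrite lt_neqAle ler0n andbT; apply: contraTneq AB1 => <-; rewrite mulr0 ltxx.
have d4 : #|diffset A1 (dilate x (Bs x0))|%:R <= K ^+ 8 * n * (K ^+ 17 * n) / #|B1|%:R.
  by rewrite ler_pdivlMr.
have r2 := ruzsa_triangle_le d1 d4.
have d5 : #|diffset (As x0) (dilate x (Bs x0))|%:R <= 2 * K ^+ 46 * n.
  rewrite -(ler_pM2r AB1) mulrA.
  apply: (@le_trans _ _ (K ^+ 17 * n * (K ^+ 8 * n * (K ^+ 17 * n) / #|B1|%:R) * #|B1|%:R)).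
    by rewrite ler_wpM2r.
  have -> : K ^+ 17 * n * (K ^+ 8 * n * (K ^+ 17 * n) / #|B1|%:R) * #|B1|%:R =
     K ^+ 42 * n * (n * n) by field; rewrite gt_eqF.
  have -> : 2 * K ^+ 46 * n * (#|A1|%:R * #|B1|%:R) =
     K ^+ 42 * n * (2 * K ^+ 4 * (#|A1|%:R * #|B1|%:R)) by ring.
  by rewrite ler_pM2l // mulr_gt0 ?exprn_gt0.
have d6 : #|diffset (dilate x (Bs x0)) (dilate (x / x0) (As x0))|%:R <= K ^+ 8 * n.
  have -> : dilate x (Bs x0) = dilate (x / x0) (dilate x0 (Bs x0)).
    by rewrite -dilateM divfK.
  by rewrite diffset_dilate card_dilate // mulf_neq0 ?invr_eq0.
have := ruzsa_triangle_le d5 d6; rewrite card_dilate // => r3.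
rewrite /distortion ler_pdivrMr // -(ler_pM2r B0pos); apply: (le_trans r3).
have -> : 2 * K ^+ 46 * n * (K ^+ 8 * n) = 2 * K ^+ 54 * (n * n) by ring.
have -> : 2 * K ^+ 56 * #|As x0|%:R * #|Bs x0|%:R =
  2 * K ^+ 54 * ((K * #|As x0|%:R) * (K * #|Bs x0|%:R)) by ring.
rewrite ler_pM2l ?mulr_gt0 ?exprn_gt0 //.
by apply: ler_pM => //; apply: ltW.
Qed.

(** * Rich planes *)

Lemma quotrep_pairs (R : realFieldType) (F : finFieldType) (A : {set F}) (x : F) :
  quotrep R A x =
  \sum_(p in [set p in setX A A | p.1 != p.2]) diffrep R A (x * (p.1 - p.2)).
Proof.
transitivity (\sum_(a in A) \sum_(b in A | a != b) diffrep R A (x * (a - b))).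
  rewrite /quotrep.
  under eq_bigr => d _ do rewrite mulrC {1}/diffrep mulr_suml.
  rewrite exchange_big /=; apply: eq_bigr => a _.
  under eq_bigr => d _ do rewrite mulr_suml.
  rewrite exchange_big /= big_mkcondr /=; apply: eq_bigr => b _.
  have [<-|ab] /= := eqVneq a b.
    by rewrite big1 // => d d0; rewrite subrr eq_sym (negbTE d0) mul0r.
  rewrite (bigD1 (a - b)) ?subr_eq0 //= eqxx mul1r big1 ?addr0 // => d /andP[_ nd].
  by rewrite eq_sym (negbTE nd) mul0r.
rewrite pair_big_dep /=; apply: eq_big => [[a b]|[a b] _] //=.
by rewrite !inE /= andbA.
Qed.

Definition line_points (F : finFieldType) (G A : {set F}) (v a : F) : {set F} :=
  [set b in A | (b - a) / v \in G].

Lemma line_points_sym (F : finFieldType) (G : {set F}) (v a b : F) :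
  is_subfield G -> ((b - a) / v \in G) = ((a - b) / v \in G).
Proof.
move=> GF; have e : (b - a) / v = - ((a - b) / v) by rewrite -mulNr opprB.
apply/idP/idP => h; last by rewrite e subfieldN.
by rewrite -[_ / _]opprK -e subfieldN.
Qed.

Lemma card_line_points (F : finFieldType) (G A : {set F}) (v a : F) :
  v != 0 -> (#|line_points G A v a| <= #|G|)%N.
Proof.
move=> v0; have inj : injective (fun b => (b - a) / v).
  by move=> b b' /(mulIf (invr_neq0 v0))/addIr.
rewrite -(card_imset _ inj); apply: subset_leq_card.
by apply/subsetP => z /imsetP[b]; rewrite inE => /andP[_ h] ->.
Qed.

Lemma sum_line_points_sym (R : realFieldType) (F : finFieldType)
    (G A B : {set F}) (v : F) :
  is_subfield G ->
  \sum_(a in A) #|line_points G B v a|%:R =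
  \sum_(b in B) #|line_points G A v b|%:R :> R.
Proof.
move=> GF.
transitivity (\sum_(a in A) \sum_(b in B) ((b - a) / v \in G)%:R : R).
  apply: eq_bigr => a _; rewrite -sum1_card_set [LHS]big_mkcond [RHS]big_mkcond.
  by apply: eq_bigr => b _; rewrite inE; case: (b \in B); case: (_ \in G).
rewrite exchange_big /=; apply: eq_bigr => b _.
rewrite -sum1_card_set [LHS]big_mkcond [RHS]big_mkcond.
apply: eq_bigr => a _; rewrite inE line_points_sym //.
by case: (a \in A); case: (_ \in G).
Qed.

(** If a - b = x (c - d) with x / x0 in [G], then a and b lie on a common line over [G] in direction
    x0 (c - d). Large energies therefore make many directions rich. Two non-parallel rich directions
    v, v' share a large set B of points on rich lines; some line in direction v' contains many
    points of B, and the rich v-lines through them sweep out the plane. *)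
Lemma rich_plane (R : realFieldType) (F : finFieldType) (G A X : {set F})
    (x0 : F) (K : R) :
  is_subfield G -> A != set0 -> X != set0 -> x0 != 0 -> 0 < K ->
  2 * K <= #|A|%:R -> 0 \notin X ->
  (forall x, x \in X -> x / x0 \in G) ->
  (forall x, x \in X -> #|A|%:R ^+ 3 <= K * (#|A|%:R ^+ 2 + quotrep R A x)) ->
  let al := #|X|%:R / (8 * K * #|G|%:R) in
  #|G|%:R < al ^+ 3 * #|A|%:R ->
  exists a v v' : F, [/\ v != 0, v' / v \notin G &
    al ^+ 2 * #|X|%:R ^+ 2 <= 128 * K ^+ 2 *
      #|A :&: [set a + p.1 * v + p.2 * v' | p in setX G G]|%:R].
Proof.
move=> GF An0 Xn0 x0n K0 Kn X0 XG energy.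
have n0 : 0 < #|A|%:R :> R by rewrite ltr0n card_gt0.
have p0 : 0 < #|G|%:R :> R by rewrite ltr0n (ltn_trans _ (subfield_card_gt1 GF)).
have m0 : 0 < #|X|%:R :> R by rewrite ltr0n card_gt0.
set n : R := #|A|%:R in n0 Kn energy *.
set p : R := #|G|%:R in p0 *; set m : R := #|X|%:R in m0 *.
move=> al big.
pose nu v : R := \sum_(a in A) #|line_points G A v a|%:R.
pose I0 := [set q in setX A A | q.1 != q.2].
pose dir (q : F * F) := x0 * (q.1 - q.2).
have I0P q : q \in I0 -> [/\ q.1 \in A, q.2 \in A & dir q != 0].
  rewrite !inE => /andP[/andP[h1 h2] h3]; split=> //.
  by rewrite mulf_neq0 // subr_eq0.
have nu_le v : v != 0 -> nu v <= n * p.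
  move=> v0; rewrite /n -sum1_card_set mulr_suml; apply: ler_sum => a _.
  by rewrite mul1r ler_nat card_line_points.
have sum_nu : m * n ^+ 3 <= 2 * K * \sum_(q in I0) nu (dir q).
  have h1 : m * (n ^+ 3 / K - n ^+ 2) <= \sum_(x in X) quotrep R A x.
    rewrite /m -sum1_card_set mulr_suml; apply: ler_sum => x xX.
    rewrite mul1r lerBlDl ler_pdivrMr // mulrC; exact: energy.
  have h2 : \sum_(x in X) quotrep R A x <= \sum_(q in I0) nu (dir q).
    under eq_bigr => x _ do rewrite quotrep_pairs.
    rewrite exchange_big /=; apply: ler_sum => q qI.
    have dq : q.1 - q.2 != 0.
      by move: qI; rewrite inE subr_eq0 => /andP[].
    rewrite /diffrep exchange_big /=; apply: ler_sum => a aA.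
    rewrite exchange_big /= -sum1_card_set [leRHS]big_mkcond [leLHS]big_mkcond /=.
    apply: ler_sum => b _; rewrite inE; case: (b \in A) => //=.
    have [Gab|Gab] := boolP (_ \in G).
      have [xX|xX] := boolP ((a - b) / (q.1 - q.2) \in X).
        rewrite (bigD1 _ xX) /= big1 ?addr0; first by case: eqP.
        move=> x /andP[_ nx]; case: eqP => // e; case/eqP: nx.
        by rewrite e mulfK.
      rewrite big1 // => x xX'; case: eqP => // e; case/negP: xX.
      by rewrite e mulfK.
    rewrite big1 // => x xX; case: eqP => // e; case/negP: Gab.
    rewrite line_points_sym // e /dir (_ : _ / _ = x / x0) ?XG //.
    by field; rewrite x0n dq.
  (* Here [2 * K <= n] is used: the trivial n^2 solutions account for at most half of the energy
     bound. *)
  have h3 : m * n ^+ 3 / (2 * K) <= m * (n ^+ 3 / K - n ^+ 2).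
    rewrite -mulrA ler_pM2l // lerBrDl -lerBrDr.
    have -> : n ^+ 3 / K - n ^+ 3 / (2 * K) = n ^+ 2 * n / (2 * K) by field; rewrite gt_eqF.
    by rewrite ler_pdivlMr ?mulr_gt0 // ler_wpM2l // exprn_ge0 // ltW.
  have := le_trans h3 (le_trans h1 h2).
  by rewrite ler_pdivrMr ?mulr_gt0 // [leRHS]mulrC.
(* The threshold is half the average of [nu]. As [nu] never exceeds n p, this leaves a proportion 2
   [al] of the pairs. *)
pose P := [set q in I0 | m * n / (4 * K) <= nu (dir q)].
have Kn0 : K != 0 by rewrite gt_eqF.
have pn0 : p != 0 by rewrite gt_eqF.
have al0 : 0 < al by rewrite divr_gt0 // !mulr_gt0.
have alE : m = al * (8 * K * p) by rewrite /al; field; rewrite Kn0 pn0.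
have cP : 2 * al * n ^+ 2 <= #|P|%:R.
  have t0 : 0 <= m * n / (4 * K) by rewrite divr_ge0 ?mulr_ge0 // ltW.
  have le1 := @sum_le_popular R _ I0 (fun q => nu (dir q)) _ (n * p) t0
    (fun q qI => let: And3 _ _ h := I0P q qI in nu_le _ h).
  rewrite -/P in le1.
  have cI : #|I0|%:R <= n * n.
    rewrite -natrM -cardsX ler_nat subset_leq_card //.
    by apply/subsetP => q; rewrite inE => /andP[].
  have le2 := le_trans le1 (lerD (ler_wpM2l t0 cI) (lexx _)).
  have K20 : 0 <= 2 * K by rewrite mulr_ge0 // ltW.
  have := le_trans sum_nu (ler_wpM2l K20 le2).
  have -> : 2 * K * (m * n / (4 * K) * (n * n) + n * p * #|P|%:R) =
     m * n ^+ 3 / 2 + 2 * K * p * n * #|P|%:R by field.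
  rewrite alE => h; have Kpn : 0 < 2 * K * p * n by rewrite !mulr_gt0.
  by rewrite -(ler_pM2l Kpn); lra.
pose Ap q := [set a in A | m / (8 * K) <= #|line_points G A (dir q) a|%:R].
have hAp q : q \in P -> Ap q \subset A /\ al * n <= #|Ap q|%:R.
  rewrite inE => /andP[qI hq]; split.
    by apply/subsetP => a; rewrite inE => /andP[].
  have [_ _ dq] := I0P q qI.
  have t0 : 0 <= m / (8 * K) by rewrite divr_ge0 ?mulr_ge0 // ltW.
  have le1 := @sum_le_popular R _ A (fun a => #|line_points G A (dir q) a|%:R) _ p t0
    (fun a _ => ltac:(by rewrite ler_nat card_line_points)).
  have := le_trans hq le1; rewrite -/(Ap q) -/n alE.
  have -> : al * (8 * K * p) * n / (4 * K) = 2 * (p * (al * n)) by field.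
  have -> : al * (8 * K * p) / (8 * K) * n = p * (al * n) by field.
  by move=> h; rewrite -(ler_pM2l p0); lra.
have Pn0 : P != set0.
  rewrite -card_gt0 -(ltr0n R); apply: lt_le_trans cP.
  by rewrite mulr_gt0 ?exprn_gt0 // mulr_gt0.
have [q0 q0P hq0] := popular_intersection Pn0 An0 (ltW al0) hAp.
set P' := [set q in P | _] in hq0.
(* At most n p pairs have a direction parallel to that of q0, whereas [P'] has at least al^3 n^2
   elements; this is what the hypothesis |G| < al^3 n is for. *)
have [q1 q1P' q1dir] : exists2 q1, q1 \in P' & dir q1 / dir q0 \notin G.
  case: (boolP [exists q in P', dir q / dir q0 \notin G]) => [/exists_inP//|].
  rewrite negb_exists_in => /forall_inP no.
  have : P' \subset [set q in setX A A | dir q / dir q0 \in G].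
    apply/subsetP => q qP'; have := no q qP'; rewrite negbK => h.
    rewrite inE h andbT; move: qP'; rewrite !inE.
    by move=> /andP[/andP[/andP[]]].
  move=> /subset_leq_card; rewrite -(ler_nat R) leNgt => /negP[].
  apply: (@le_lt_trans _ _ (n * p)).
    rewrite (card_setX_filter R A A (fun a b => dir (a, b) / dir q0 \in G)).
    rewrite /n -sum1_card_set mulr_suml; apply: ler_sum => a _.
    rewrite mul1r; have [_ _ dq0] : [/\ q0.1 \in A, q0.2 \in A & dir q0 != 0].
      by apply: I0P; move: q0P; rewrite inE => /andP[].
    have inj : injective (fun b => dir (a, b) / dir q0).
      by move=> b b' /(mulIf (invr_neq0 dq0))/(mulfI x0n)/addrI/oppr_inj.
    rewrite /p -(sum1_card_set R G) [leRHS](reindex_inj inj) /=.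
    rewrite [leLHS]big_mkcond [leRHS]big_mkcond; apply: ler_sum => b _.
    by case: (b \in A); case: (_ \in G).
  apply: lt_le_trans hq0.
  apply: (@lt_le_trans _ _ (al ^+ 2 / 2 * (2 * al * n ^+ 2))); last first.
    by rewrite ler_wpM2l // divr_ge0 ?sqr_ge0.
  have -> : al ^+ 2 / 2 * (2 * al * n ^+ 2) = n * (al ^+ 3 * n) by field.
  by rewrite ltr_pM2l.
move: q1P'; rewrite inE => /andP[q1P hB]; rewrite -/n in hB.
have [_ _ v0] : [/\ q0.1 \in A, q0.2 \in A & dir q0 != 0].
  by apply: I0P; move: q0P; rewrite inE => /andP[].
have [_ _ v'0] : [/\ q1.1 \in A, q1.2 \in A & dir q1 != 0].
  by apply: I0P; move: q1P; rewrite inE => /andP[].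
move: v0 v'0 q1dir hB; rewrite /Ap; move: (dir q0) (dir q1) => v v' v0 v'0 vG.
set B := _ :&: _ => hB.
have [a aA ha] : exists2 a, a \in A & #|B|%:R * (m / (8 * K)) <= #|line_points G B v' a|%:R * n.
  apply: exists_ge_avg => //; rewrite (sum_line_points_sym R A B v' GF).
  rewrite -sum1_card_set mulr_suml; apply: ler_sum => b; rewrite !inE mul1r.
  by move=> /andP[_ /andP[]].
exists a, v, v'; split=> //.
set Pl := _ :&: _.
(* As v'/v is not in [G], the v-lines through distinct points of a v'-line are disjoint, so their
   points may be added up. *)
have cPl : #|line_points G B v' a|%:R * (m / (8 * K)) <= #|Pl|%:R.
  have sub : \sum_(b in line_points G B v' a) #|line_points G A v b|%:R <= #|Pl|%:R :> R.
    have -> : \sum_(b in line_points G B v' a) #|line_points G A v b|%:R =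
        \sum_(z in A) \sum_(b in line_points G B v' a) ((z - b) / v \in G)%:R :> R.
      rewrite exchange_big /=; apply: eq_bigr => b _.
      rewrite -sum1_card_set [LHS]big_mkcond [RHS]big_mkcond.
      by apply: eq_bigr => z _; rewrite inE; case: (z \in A); case: (_ \in G).
    rewrite -[leRHS]sum1_card_set [leRHS]big_mkcond [leLHS]big_mkcond /=.
    apply: ler_sum => z _; have [zA|zA] := boolP (z \in A); last by case: ifP.
    have [b /andP[bL zb]|no] :=
      pickP (fun b => (b \in line_points G B v' a) && ((z - b) / v \in G)).
      have -> : z \in Pl.
        rewrite inE zA; apply/imsetP; exists ((z - b) / v, (b - a) / v').
          by rewrite inE /= zb; move: bL; rewrite inE => /andP[].
        by rewrite /= !divfK //; ring.
      rewrite (bigD1 b) //= big1 ?addr0; first by case: (_ \in G).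
      move=> b' /andP[b'L nb]; have [zb'|//] := boolP (_ \in G).
      case/negP: vG; move: bL b'L; rewrite !inE => /andP[_ bG] /andP[_ b'G].
      case: (GF) => _ GB GD.
      have e1 : (b - b') / v' \in G.
        have -> : (b - b') / v' = (b - a) / v' - (b' - a) / v'.
          by rewrite -mulrBl; congr (_ / _); ring.
        exact: GB.
      have e2 : (b' - b) / v \in G.
        have -> : (b' - b) / v = (z - b) / v - (z - b') / v.
          by rewrite -mulrBl; congr (_ / _); ring.
        exact: GB.
      have bb : b' - b != 0 by rewrite subr_eq0.
      have -> : v' / v = - ((b' - b) / v / ((b - b') / v')).
        have bb' : b - b' != 0 by rewrite subr_eq0 eq_sym.
        by rewrite -(opprB b b'); field; rewrite v0 v'0 bb'.
      by rewrite subfieldN // GD.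
    rewrite big1 ?ler0n // => [|b bL]; first by case: ifP.
    by have := no b; rewrite bL /= => ->.
  apply: le_trans sub; rewrite -(sum1_card_set R (line_points _ _ _ _)) mulr_suml.
  apply: ler_sum => b; rewrite !inE mul1r.
  by move=> /andP[/andP[/andP[_]]].
have hh : al ^+ 2 / 2 * n * (m / (8 * K)) <= #|line_points G B v' a|%:R * n.
  apply: le_trans ha; rewrite ler_wpM2r //.
  by rewrite divr_ge0 ?mulr_ge0 // ltW.
have {}hh : al ^+ 2 / 2 * (m / (8 * K)) <= #|line_points G B v' a|%:R.
  by rewrite -(ler_pM2r n0) mulrAC.
have t0 : 0 <= m / (8 * K) by rewrite divr_ge0 ?mulr_ge0 // ltW.
have := le_trans (ler_wpM2r t0 hh) cPl.
have -> : al ^+ 2 / 2 * (m / (8 * K)) * (m / (8 * K)) = al ^+ 2 * m ^+ 2 / (128 * K ^+ 2).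
  by field.
by rewrite ler_pdivrMr ?mulr_gt0 ?exprn_gt0 // [leRHS]mulrC.
Qed.

(** * The theorem *)

Lemma diffrep_notin (R : realFieldType) (F : finFieldType) (A : {set F}) d :
  d \notin diffset A A -> diffrep R A d = 0.
Proof.
move=> dD; rewrite /diffrep big1 // => a aA; rewrite big1 // => b bA.
by case: eqP => // e; case/negP: dD; rewrite -e mem_diffset.
Qed.

Lemma prodrep_notin (R : realFieldType) (F : finFieldType) (A : {set F}) t :
  t \notin prodset (diffset A A) (diffset A A) -> prodrep R A t = 0.
Proof.
move=> tD; rewrite /prodrep big1 // => d d0.
have [dD|/diffrep_notin->] := boolP (d \in diffset A A); last by rewrite mul0r.
rewrite [X in _ * X]diffrep_notin ?mulr0 //; apply: contra tD => tdD.
by apply/imset2P; exists d (t / d); rewrite // mulrC divfK.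
Qed.

(** [prodrep] vanishes at no fewer than (q - 1)/2 nonzero elements, so its variance is large, and
    hence so is the second moment of the excess. Since the excess has a small sum and is at most
    n^3, this moment has to come from many x. *)
Lemma many_rich_dilations (R : realFieldType) (F : finFieldType) (A : {set F}) :
  (1 < #|A|)%N ->
  (2 * #|prodset (diffset A A) (diffset A A)| <= #|F|)%N ->
  exists X : {set F}, [/\ 0 \notin X,
    #|A|%:R ^+ 2 <= 64 * #|F|%:R * #|X|%:R :> R &
    forall x, x \in X ->
      #|A|%:R ^+ 3 <= 64 * #|F|%:R ^+ 2 / #|A|%:R ^+ 3 *
        (#|A|%:R ^+ 2 + quotrep R A x)].
Proof.
move=> A1 few; set DD := prodset _ _ in few.
have n2 : 2 <= #|A|%:R :> R by rewrite (ler_nat R 2).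
have TF := subfieldT F; have AT := subsetT A.
have q0 : 0 < #|F|%:R :> R by rewrite ltr0n; apply/card_gt0P; exists 0.
have q1 : 0 < #|F|%:R - 1 :> R.
  by rewrite subr_gt0 ltr1n card_finNzRing_gt1.
set n : R := #|A|%:R in n2 *; set q : R := #|F|%:R in q0 q1 *.
have n0 : 0 < n by lra.
have DD0 : 0 \in DD.
  have /card_gt0P[a aA] : (0 < #|A|)%N by apply: ltnW.
  have D0 : 0 \in diffset A A by rewrite -(subrr a) mem_diffset.
  by apply/imset2P; exists 0 0; rewrite ?mulr0.
pose Z := [set: F] :\ 0 :\: DD.
have cZ : q - 1 <= 2 * #|Z|%:R.
  have e : (#|Z| + #|DD| = #|F|)%N.
    rewrite -(cardsC DD) addnC; congr (_ + _)%N; apply: eq_card => z.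
    by rewrite !inE andbT; have [->|] := eqVneq z 0; rewrite ?DD0 ?andbT.
  have : (q : R) <= 2 * #|Z|%:R.
    by rewrite /q -natrM ler_nat -e; move: few; rewrite -e; lia.
  by lra.
pose W : R := (n ^+ 2 - n) ^+ 2.
have W_ge : n ^+ 4 / 4 <= W.
  have h : n ^+ 2 / 2 <= n ^+ 2 - n.
    have : 0 <= n * (n - 2) by rewrite mulr_ge0 ?subr_ge0 // ltW.
    by lra.
  have -> : n ^+ 4 / 4 = (n ^+ 2 / 2) ^+ 2 by field.
  rewrite ler_sqr ?nnegrE ?divr_ge0 ?sqr_ge0 //.
  by apply: le_trans h; rewrite divr_ge0 ?sqr_ge0.
have var := variance_prodrep_le R TF AT; rewrite cardsT -/n -/q -/W in var.
have low : n ^+ 8 / (32 * q) <= \sum_(x in [set: F] :\ 0) excess R [set: F] A x ^+ 2.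
  apply: le_trans var.
  apply: (@le_trans _ _ (\sum_(t in Z) (W / (q - 1)) ^+ 2)); last first.
    rewrite [leRHS](big_setID (~: DD)) /=.
    have -> : ([set: F] :\ 0) :&: ~: DD = Z by rewrite -setDE.
    rewrite -[leLHS]addr0; apply: lerD; last by apply: sumr_ge0 => t _; apply: sqr_ge0.
    apply: ler_sum => t; rewrite inE => /andP[tD _].
    by rewrite prodrep_notin // sub0r sqrrN.
  rewrite sumr_const -[leRHS]mulr_natr.
  apply: (@le_trans _ _ ((W / (q - 1)) ^+ 2 * ((q - 1) / 2))); last first.
    by rewrite ler_wpM2l ?sqr_ge0 //; lra.
  have -> : (W / (q - 1)) ^+ 2 * ((q - 1) / 2) = W ^+ 2 / (2 * (q - 1)).
    by field; rewrite gt_eqF.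
  rewrite ler_pdivlMr ?mulr_gt0 //.
  apply: (@le_trans _ _ ((n ^+ 4 / 4) ^+ 2)); last first.
    by rewrite ler_sqr ?nnegrE ?sqr_ge0 // divr_ge0 ?exprn_ge0 // ltW.
  have -> : n ^+ 8 / (32 * q) * (2 * (q - 1)) = (n ^+ 4 / 4) ^+ 2 - n ^+ 8 / (16 * q).
    by field; rewrite gt_eqF.
  by rewrite gerBl divr_ge0 ?mulr_ge0 ?exprn_ge0 // ltW.
(* Chosen so that values below [T], whose sum is at most q n^2, contribute at most half of the lower
   bound n^8 / (32 q). *)
pose T : R := n ^+ 6 / (64 * q ^+ 2).
have T0 : 0 < T by rewrite divr_gt0 ?mulr_gt0 ?exprn_gt0.
pose X := [set x in [set: F] :\ 0 | T <= excess R [set: F] A x].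
have ex0 x : 0 <= excess R [set: F] A x by rewrite excess_ge0 ?inE.
exists X; split.
- by rewrite !inE eqxx.
- have up : \sum_(x in [set: F] :\ 0) excess R [set: F] A x ^+ 2 <=
      T * (q * n ^+ 2) + n ^+ 6 * #|X|%:R.
    apply: (@le_trans _ _ (\sum_(x in [set: F] :\ 0)
       (T * excess R [set: F] A x + n ^+ 6 * (T <= excess R [set: F] A x)%R%:R))).
      apply: ler_sum => x _; have [le|/ltW lt] := lerP T (excess R [set: F] A x).
        apply: (@le_trans _ _ (n ^+ 6)); last by rewrite mulr1 lerDr mulr_ge0 // ltW.
        rewrite (_ : n ^+ 6 = (n ^+ 3) ^+ 2); last by rewrite -exprM.
        by rewrite ler_sqr ?nnegrE ?excess_le // exprn_ge0 // ltW.
      by rewrite mulr0 addr0 expr2 ler_wpM2r.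
    rewrite big_split /= -!mulr_sumr; apply: lerD.
      rewrite ler_wpM2l ?(ltW T0) //.
      by have := sum_excess_nz_le R TF AT; rewrite cardsT.
    rewrite ler_wpM2l ?exprn_ge0 ?(ltW n0) //.
    rewrite -[leRHS]sum1_card_set [leLHS]big_mkcond [leRHS]big_mkcond.
    apply: ler_sum => x _.
    have -> : (x \in X) = (x \in [set: F] :\ 0) && (T <= excess R [set: F] A x).
      by rewrite [LHS]inE.
    by case: (x \in _) => //=; case: (T <= _).
  have := le_trans low up.
  have -> : T * (q * n ^+ 2) = n ^+ 8 / (64 * q) by rewrite /T; field; rewrite gt_eqF.
  have -> : n ^+ 8 / (32 * q) = 2 * (n ^+ 8 / (64 * q)) by field; rewrite gt_eqF.
  move=> h; have : n ^+ 8 / (64 * q) <= n ^+ 6 * #|X|%:R by lra.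
  rewrite ler_pdivrMr ?mulr_gt0 // => {}h.
  have n6 : 0 < n ^+ 6 by rewrite exprn_gt0.
  by rewrite -(ler_pM2l n6); lra.
move=> x; rewrite inE => /andP[_ hx].
have hE : T <= n ^+ 2 + quotrep R A x.
  apply: (le_trans hx); rewrite lerBlDr lerDl divr_ge0 ?exprn_ge0 //.
rewrite -[leLHS](_ : 64 * q ^+ 2 / n ^+ 3 * T = _).
  by rewrite ler_wpM2l // divr_ge0 ?mulr_ge0 ?exprn_ge0 // ltW.
by rewrite /T; field; rewrite !gt_eqF.
Qed.

(* All losses are powers of [u], and [p ^ 3 = #|F|]; in the end [p] is the
   cardinal of a subfield and [u] a small power of [p]. *)
Lemma prod_diff_large (R : realFieldType) (F : finFieldType) (A : {set F})
    (u p : R) :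
  2 ^+ 60 <= u -> u ^+ 4100 <= p -> #|F|%:R = p ^+ 3 ->
  p ^+ 2 <= u * #|A|%:R -> #|A|%:R <= p ^+ 2 ->
  (#|F| < 2 * #|prodset (diffset A A) (diffset A A)|)%N.
Proof.
move=> u_ge pu qE n_lo n_hi; rewrite ltnNge; apply/negP => few.
have u_c1 : 1000 <= u by apply: le_trans u_ge; clear; lra.
have u_c2 : 2 * (3 ^+ 6 * 2 ^+ 6) <= u by apply: le_trans u_ge; clear; lra.
have u_c3 : 2 * (7 ^+ 7 * 3 ^+ 3 * 2 ^+ 18) <= u.
  by apply: le_trans u_ge; clear; lra.
have u_c c : c <= 1000 -> c <= u by move=> /le_trans; apply.
have u1 : 1 < u by apply: lt_le_trans u_c1; clear; lra.
have u0 : 0 < u := lt_trans ltr01 u1.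
have u1' := u1; have {}u1 : 1 <= u := ltW u1'.
have uk_gt0 k : 0 < u ^+ k by rewrite exprn_gt0.
have uk_ge0 k : 0 <= u ^+ k := ltW (uk_gt0 k).
have um_ge0 k x : 0 <= x -> 0 <= u ^+ k * x.
  by move=> x_ge0; apply: mulr_ge0.
have pk k : (k <= 4100)%N -> u ^+ k <= p.
  by move=> k4; apply: le_trans pu; apply: ler_weXn2l.
have pk_lt k : (k < 4100)%N -> u ^+ k < p.
  by move=> k4; apply: lt_le_trans pu; rewrite ltr_eXn2l.
have p0 : 0 < p by apply: lt_le_trans pu; apply: uk_gt0.
have p3 : 1 <= p by rewrite (le_trans _ (pk 0%N isT)).
have n_gt1 : (1 < #|A|)%N.
  rewrite -(ltr_nat R) -(ltr_pM2l u0); apply: lt_le_trans n_lo.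
  have h : u ^+ 2 <= p by apply: pk.
  have h2 : 1 * p <= p * p by rewrite ler_wpM2r // ltW.
  have h3 : 1 * u < u * u by rewrite ltr_pM2r.
  by clear -h h2 h3; lra.
have An0 : A != set0 by rewrite -card_gt0 ltnW.
set n : R := #|A|%:R in n_lo n_hi.
have n0 : 0 < n by rewrite ltr0n ltnW.
have [X [X0 cX enX]] := @many_rich_dilations R F A n_gt1 few.
rewrite qE -/n in cX enX.
set m : R := #|X|%:R in cX.
have m_lo : p <= u ^+ 3 * m.
  have h1 : (p ^+ 2) ^+ 2 <= (u * n) ^+ 2.
    by rewrite ler_sqr ?nnegrE ?sqr_ge0 // mulr_ge0 // ltW.
  have h2 : u ^+ 2 * n ^+ 2 <= u ^+ 2 * (64 * p ^+ 3 * m) by rewrite ler_pM2l.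
  have p30 : 0 < p ^+ 3 by rewrite exprn_gt0.
  have m0 : 0 <= u ^+ 2 * m by rewrite um_ge0.
  have h3 : 64 * (u ^+ 2 * m) <= u * (u ^+ 2 * m).
    by rewrite ler_wpM2r //; apply: u_c; clear; lra.
  rewrite -(ler_pM2l p30).
  have h4 : p ^+ 3 * (64 * (u ^+ 2 * m)) <= p ^+ 3 * (u * (u ^+ 2 * m)).
    by rewrite ler_pM2l.
  by clear -h1 h2 h4; lra.
(* The divisor 12 makes the parameter 12 K of [balog_szemeredi_gowers] a pure power of u. *)
pose K := u ^+ 4 / 12.
have K0 : 0 < K by rewrite divr_gt0.
have energy x : x \in X -> n ^+ 3 <= K * (n ^+ 2 + quotrep R A x).
  move=> xX; apply: (le_trans (enX x xX)); rewrite ler_wpM2r //.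
    by rewrite addr_ge0 ?sqr_ge0 ?quotrep_ge0.
  rewrite ler_pdivrMr ?exprn_gt0 // /K.
  have h1 : (p ^+ 2) ^+ 3 <= (u * n) ^+ 3.
    by rewrite lerXn2r ?nnegrE ?sqr_ge0 // mulr_ge0 // ltW.
  have h2 : 768 * (u ^+ 3 * n ^+ 3) <= u * (u ^+ 3 * n ^+ 3).
    rewrite ler_wpM2r //; last by apply: u_c; clear; lra.
    by rewrite mulr_ge0 ?exprn_ge0 // ltW.
  by clear -h1 h2; lra.
have K12 : 12 * K = u ^+ 4 by rewrite /K; field.
have Xn0 : X != set0.
  apply/eqP => e; move: m_lo; rewrite /m e cards0 mulr0.
  by rewrite leNgt p0.
have bsg x : x \in X -> exists A' B' : {set F}, [/\ A' \subset A, B' \subset A,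
    #|A|%:R <= u ^+ 4 * #|A'|%:R, #|A|%:R <= u ^+ 4 * #|B'|%:R &
    #|diffset A' (dilate x B')|%:R <= (u ^+ 4) ^+ 8 * #|A|%:R].
  move=> xX; have xn : x != 0 by apply: contraNneq X0 => <-.
  by have := balog_szemeredi_gowers An0 xn K0 (energy x xX); rewrite K12.
have u41 : 1 <= u ^+ 4 by rewrite exprn_ege1.
have [x0 [x0X [A' [X' [A'A X'X nA' cX' [L1 LX']]]]]] :=
  common_small_distortion An0 Xn0 X0 u41 bsg.
have x0n : x0 != 0 by apply: contraNneq X0 => <-.
rewrite -/n in nA'; rewrite -/m in cX'.
have nA'n : #|A'|%:R <= n by rewrite ler_nat subset_leq_card.
set n' : R := #|A'|%:R in nA' nA'n.
set m' : R := #|X'|%:R in cX'.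
have m'_lo : p <= u ^+ 20 * m'.
  apply: (le_trans m_lo); apply: (le_trans (ler_wpM2l (ltW (uk_gt0 3%N)) cX')).
  have : 2 * (u ^+ 19 * m') <= u * (u ^+ 19 * m').
    rewrite ler_wpM2r //; last by apply: u_c; clear; lra.
    by rewrite um_ge0.
  by clear; lra.
have n'_lo : p ^+ 2 <= u ^+ 5 * n'.
  apply: (le_trans n_lo); apply: (le_trans (ler_wpM2l (ltW u0) nA')).
  by rewrite mulrA -exprS.
have A'n0 : A' != set0.
  apply/eqP => e; move: n'_lo; rewrite /n' e cards0 mulr0.
  by rewrite leNgt exprn_gt0.
pose Y := dilate x0^-1 X'.
have cY : #|Y| = #|X'| by rewrite card_dilate // invr_eq0.
have Y1 : (1 < #|Y|)%N.
  rewrite cY -(ltr_nat R) -(ltr_pM2l (uk_gt0 20%N)); apply: lt_le_trans m'_lo.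
  by rewrite mulr1; apply: pk_lt.
have LY y : y \in Y -> distortion R A' y <= 2 * (u ^+ 4) ^+ 56.
  by move=> /imsetP[x xX' ->]; rewrite mulrC; apply: LX'.
set L : R := 2 * (u ^+ 4) ^+ 56 in L1 LX' LY.
have LE : L = 2 * u ^+ 224 by rewrite /L -exprM.
clearbody L.
have L18 : 2 * (7 ^+ 7 * 3 ^+ 3 * L ^+ 18) <= u ^+ 4033.
  have -> : L ^+ 18 = 2 ^+ 18 * u ^+ 4032 by rewrite LE exprMn -exprM.
  rewrite (exprS u 4032); have := ler_wpM2r (ltW (uk_gt0 4032%N)) u_c3.
  by move: (u ^+ 4032) => U; clear; lra.
have L6 : 2 * (3 * L) ^+ 6 <= u ^+ 1345.
  have -> : (3 * L) ^+ 6 = 3 ^+ 6 * (2 ^+ 6 * u ^+ 1344).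
    by rewrite exprMn LE exprMn -exprM.
  rewrite (exprS u 1344); have := ler_wpM2r (ltW (uk_gt0 1344%N)) u_c2.
  by move: (u ^+ 1344) => U; clear; lra.
have L0 : 0 <= L by rewrite LE mulr_ge0.
pose La := 7 ^+ 7 * 3 ^+ 3 * L ^+ 18.
have La0 : 0 <= La by apply: mulr_ge0; [apply: mulr_ge0 | ]; apply: exprn_ge0.
rewrite -/La in L18.
have cond1 : 2 * La * n' <= #|F|%:R.
  rewrite qE exprS; apply: ler_pM => //.
  - by rewrite mulr_ge0.
  - by apply: (le_trans L18); apply: pk.
  - exact: le_trans nA'n n_hi.
have uu a b : u ^+ a * u ^+ b = u ^+ (a + b) by rewrite exprD.
(* The tightest requirement of the proof. The sizes of Y and A' cost u^45 and the pivot u^4033, so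
   u^4078 < p is needed. *)
have cond2 : 2 * La * #|F|%:R < #|Y|%:R ^+ 2 * n'.
  rewrite cY -/m' qE.
  have h1 : p ^+ 2 * p ^+ 2 <= (u ^+ 20 * m') ^+ 2 * (u ^+ 5 * n').
    apply: ler_pM; rewrite ?sqr_ge0 //.
    by rewrite ler_sqr ?nnegrE ?um_ge0 // ltW.
  have u45 : 0 < u ^+ 45 by [].
  rewrite -(ltr_pM2l u45); apply: (lt_le_trans (y := p ^+ 2 * p ^+ 2)); last first.
    by apply: (le_trans h1); rewrite le_eqVlt; apply/orP; left; apply/eqP; ring.
  have p30 : 0 < p ^+ 3 by rewrite exprn_gt0.
  have -> : p ^+ 2 * p ^+ 2 = p * p ^+ 3 by ring.
  rewrite mulrA ltr_pM2r //.
  apply: (le_lt_trans (ler_wpM2l (ltW u45) L18)); rewrite uu.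
  exact: pk_lt.
have [[GF YG] cG] := quotset_subfield_of_distortion A'n0 Y1 L1 LY cond1 cond2.
set G := quotset Y in GF YG cG.
rewrite qE -/n' in cG.
have m'G : m' <= #|G|%:R by rewrite /m' -cY ler_nat subset_leq_card.
set g : R := #|G|%:R in cG m'G.
have g0 : 0 < g by rewrite ltr0n (ltn_trans _ (subfield_card_gt1 GF)).
have g_up : g <= u ^+ 1350 * p.
  have p20 : 0 < p ^+ 2 by rewrite exprn_gt0.
  rewrite -(ler_pM2r p20).
  apply: (le_trans (ler_wpM2l (ltW g0) n'_lo)).
  have p30 : 0 <= p ^+ 3 by rewrite exprn_ge0 // ltW.
  have h := le_trans cG (ler_wpM2r p30 L6).
  have := ler_wpM2l (ltW (uk_gt0 5%N)) h.
  rewrite [in X in _ <= X -> _]mulrA uu => h2.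
  have -> : u ^+ 1350 * p * p ^+ 2 = u ^+ (5 + 1345) * p ^+ 3.
    by rewrite -mulrA -exprS.
  by clear -h2; lra.
have lt2 : (#|G| ^ 2 < #|F|)%N.
  rewrite -(ltr_nat R) natrX qE -/g.
  apply: (@le_lt_trans _ _ ((u ^+ 1350 * p) ^+ 2)).
    by rewrite ler_sqr ?nnegrE ?um_ge0 // ltW.
  have p20 : 0 < p ^+ 2 by rewrite exprn_gt0.
  rewrite exprMn -exprM [ltRHS]exprS.
  rewrite (ltr_pM2r p20).
  exact: pk_lt.
have lt4 : (#|F| < #|G| ^ 4)%N.
  rewrite -(ltr_nat R) natrX qE -/g.
  have pg : p <= u ^+ 20 * g by apply: (le_trans m'_lo); rewrite ler_pM2l.
  have h : p ^+ 4 <= (u ^+ 20 * g) ^+ 4.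
    by rewrite lerXn2r ?nnegrE ?um_ge0 ?(ltW p0) ?(ltW g0).
  have u80 : 0 < u ^+ 80 by [].
  rewrite -(ltr_pM2l u80); apply: (@lt_le_trans _ _ (p ^+ 4)); last first.
    by apply: (le_trans h); rewrite exprMn -exprM.
  rewrite [ltRHS]exprS ltr_pM2r ?exprn_gt0 //.
  exact: pk_lt.
(* The bounds on g are lossy, but they separate |F| from g^2 and g^4. Integrality of the dimension
   then removes every loss. *)
have gp : g = p.
  have e := card_cube_subfield GF lt2 lt4.
  have : g ^+ 3 = p ^+ 3 by rewrite -qE e natrX.
  by apply: pexpIrn; rewrite // nnegrE ltW.
have X'n0 : X' != set0 by rewrite -card_gt0 -cY ltnW.
have X'0 : 0 \notin X' by apply: contra X0; apply: (subsetP X'X).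
have X'G x : x \in X' -> x / x0 \in G.
  by move=> xX'; apply: (subsetP YG); rewrite mulrC; apply: imset_f.
have energy' x : x \in X' -> n ^+ 3 <= u ^+ 4 * (n ^+ 2 + quotrep R A x).
  move=> xX'; apply: (le_trans (energy x (subsetP X'X x xX'))).
  rewrite ler_wpM2r ?addr_ge0 ?sqr_ge0 ?quotrep_ge0 // /K.
  by rewrite ler_pdivrMr // ler_peMr ?(ltW (uk_gt0 _)) //; clear; lra.
have n_u5 : u ^+ 5 <= n.
  rewrite -(ler_pM2l u0) -exprS; apply: le_trans n_lo.
  apply: (le_trans (pk 6%N isT)); rewrite expr2 -[leLHS]mul1r.
  by rewrite ler_wpM2r // ltW.
have K2n : 2 * u ^+ 4 <= n.
  apply: le_trans n_u5; rewrite [leRHS]exprS ler_pM2r //.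
  by apply: u_c; clear; lra.
have := rich_plane GF An0 X'n0 x0n (uk_gt0 4%N) K2n X'0 X'G energy'.
rewrite -/g gp -/m' -/n; set al := m' / _ => plane.
have al_lo : 1 <= u ^+ 25 * al.
  rewrite /al mulrA ler_pdivlMr ?mulr_gt0 // mul1r.
  have h : 8 * u ^+ 4 * p <= 8 * u ^+ 4 * (u ^+ 20 * m').
    by rewrite ler_wpM2l // mulr_ge0 // ltW.
  apply: (le_trans h).
  have : 8 * (u ^+ 24 * m') <= u * (u ^+ 24 * m').
    rewrite ler_wpM2r //; last by apply: u_c; clear; lra.
    by rewrite um_ge0.
  by clear; lra.
clearbody al.
have al0 : 0 < al by have := lt_le_trans ltr01 al_lo; rewrite pmulr_rgt0.
have [|a [v [v' [v0 vG big]]]] := plane.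
  have u75 : 0 < u ^+ 75 by [].
  rewrite -(ltr_pM2l u75); apply: (@lt_le_trans _ _ n).
    rewrite -(ltr_pM2l u0); apply: lt_le_trans n_lo.
    rewrite mulrA -exprS expr2 ltr_pM2r //; exact: pk_lt.
  rewrite mulrA -[leLHS]mul1r ler_wpM2r ?(ltW n0) //.
  have -> : u ^+ 75 * al ^+ 3 = (u ^+ 25 * al) ^+ 3 by rewrite exprMn -exprM.
  by rewrite exprn_ege1.
(* The density of [A] in the plane is at least u^-99; its 14th power costs u^1386, well within the
   range allowed for p. *)
set N : R := #|_|%:R in big.
have N_lo : p ^+ 2 <= u ^+ 99 * N.
  have u50 : 0 < u ^+ 50 by [].
  have h1 : p ^+ 2 <= (u ^+ 20 * m') ^+ 2.
    by rewrite ler_sqr ?nnegrE ?um_ge0 // ltW.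
  have h2 : 1 * m' ^+ 2 <= (u ^+ 25 * al) ^+ 2 * m' ^+ 2.
    by rewrite ler_wpM2r ?sqr_ge0 // exprn_ege1.
  have h3 : u ^+ 90 * (al ^+ 2 * m' ^+ 2) <= u ^+ 90 * (128 * (u ^+ 4) ^+ 2 * N).
    by rewrite ler_pM2l.
  have h4 : 128 * (u ^+ 98 * N) <= u * (u ^+ 98 * N).
    rewrite ler_wpM2r //; last by apply: u_c; clear; lra.
    by rewrite um_ge0.
  have h5 : u ^+ 40 * (1 * m' ^+ 2) <= u ^+ 40 * ((u ^+ 25 * al) ^+ 2 * m' ^+ 2).
    by rewrite ler_pM2l.
  by clear -h1 h3 h4 h5; lra.
have := @prod_diff_plane R F G A a v v' GF lt2 lt4 v0 vG.
rewrite -/g gp -/N ltnNge few => /(_ _)/negP; apply=> //.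
have u1386 : 0 < u ^+ 1386 by [].
rewrite -(ltr_pM2l u1386); apply: (@lt_le_trans _ _ ((p ^+ 2) ^+ 14)); last first.
  have -> : u ^+ 1386 * N ^+ 14 = (u ^+ 99 * N) ^+ 14 by rewrite exprMn -exprM.
  by rewrite lerXn2r ?nnegrE ?sqr_ge0 ?um_ge0.
rewrite -exprM mulrA [ltRHS](exprS p 27) ltr_pM2r ?exprn_gt0 //.
apply: le_lt_trans (pk_lt 1387%N isT).
rewrite mulrC (exprS u 1386) ler_pM2r //.
by apply: u_c; clear; lra.
Qed.

Lemma subset_of_card (T : finType) (A : {set T}) (m : nat) :
  (m <= #|A|)%N -> exists2 B : {set T}, B \subset A & #|B| = m.
Proof.
move=> mA; exists [set x in take m (enum A)].
  by apply/subsetP => x; rewrite inE => /mem_take; rewrite mem_enum.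
by rewrite cardsE (card_uniqP _) ?take_uniq ?enum_uniq // size_takel // -cardE.
Qed.

Lemma prod_diffS (F : finFieldType) (A B : {set F}) : B \subset A ->
  prodset (diffset B B) (diffset B B) \subset prodset (diffset A A) (diffset A A).
Proof. by move=> BA; apply: imset2S; apply: diffsetS. Qed.

From mathcomp Require Import all_classical all_reals all_analysis.

Lemma ln2_ge_half (R : realType) : 1 / 2 <= ln 2 :> R.
Proof.
have h : ln (1 + (- (1 / 2))) <= - (1 / 2) :> R by apply: le_ln1Dx; lra.
have e : (1 + - (1 / 2) : R) = 2^-1 by field.
by move: h; rewrite e lnV ?posrE //; lra.
Qed.

(* No power of the logarithm is needed: [k = 1] and [C] absorbs [ln 2]. *)
Lemma prod_diff_threshold (R : realType) (N : R) :
  0 < N -> 3 * 4100%:R <= N ->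
  exists C k : R, 0 < C /\ 0 < k /\
    forall (q : nat) (Fq : finFieldType) (A : {set Fq}),
      #|Fq| = q ->
      C * (q%:R `^ (2 / 3 - 1 / N)) * (ln q%:R `^ k) < #|A|%:R ->
      q%:R / 2 < #|prodset (diffset A A) (diffset A A)|%:R :> R.
Proof.
move=> N0; have M0 : 1 <= 4100%:R :> R by rewrite ler1n.
move: M0 (erefl (4100%:R : R)); move: {1 2 4}(4100%:R : R) => M M0 ME N_ge.
(* Since |A| <= q, the factor (2^60)^N excludes every q below it and so forces q^(1/N) >= 2^60. The
   factor 2 offsets ln q >= 1/2. *)
exists (2 * (2 ^+ 60) `^ N), 1; split.
  by rewrite mulr_gt0 // powR_gt0 // exprn_gt0.
split=> // q F A qE; have q2 : (1 < q)%N by rewrite -qE card_finNzRing_gt1.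
have q2R : 2 <= q%:R :> R by rewrite (ler_nat R 2).
have q1 : 1 <= q%:R :> R by apply: le_trans q2R; lra.
have q0 : 0 <= q%:R :> R by [].
have qn0 : q%:R != 0 :> R by rewrite pnatr_eq0 -lt0n ltnW.
have lnq : 1 / 2 <= ln q%:R :> R.
  apply: le_trans (ln2_ge_half R) _.
  by rewrite ler_ln ?posrE // (lt_le_trans _ q1).
rewrite powRr1; last by apply: le_trans lnq; lra.
set e := 2 / 3 - 1 / N; set c := (2 ^+ 60) `^ N; set n : R := #|A|%:R => big.
have e_ge0 : 0 <= e.
  by rewrite subr_ge0 ler_pdivrMr //; move: M0 N_ge; clear; lra.
have c_ge0 : 0 <= c by apply: powR_ge0.
have qe1 : 1 <= q%:R `^ e :> R by rewrite -[leLHS](powRr0 (q%:R : R)) ler_powR.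
have cqe : c * q%:R `^ e < n.
  apply: le_lt_trans big.
  have -> : 2 * c * q%:R `^ e * ln q%:R = c * q%:R `^ e * (2 * ln q%:R) by ring.
  rewrite ler_peMr ?mulr_ge0 ?powR_ge0 //.
  by move: lnq; clear; lra.
have c_le : c <= q%:R.
  apply: (@le_trans _ _ (c * q%:R `^ e)); first by rewrite ler_peMr.
  by apply: (le_trans (ltW cqe)); rewrite -qE ler_nat max_card.
pose u : R := q%:R `^ (1 / N); pose p : R := q%:R `^ (1 / 3).
have u_ge : 2 ^+ 60 <= u.
  have -> : (2 : R) ^+ 60 = c `^ (1 / N).
    by rewrite /c -powRrM mul1r divff ?gt_eqF // powRr1 // exprn_ge0.
  by rewrite /u ge0_ler_powR ?nnegrE // divr_ge0 // ltW.
have u0 : 0 < u by apply: lt_le_trans u_ge; rewrite exprn_gt0.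
have pu : u ^+ 4100 <= p.
  rewrite -powR_mulrn ?(ltW u0) // -ME /u -powRrM ler_powR //.
  rewrite mulrAC mul1r ler_pdivrMr //.
  by move: N_ge; clear; lra.
have p3 : q%:R = p ^+ 3.
  by rewrite -powR_mulrn ?powR_ge0 // -powRrM divfK ?pnatr_eq0 // powRr1.
have p0 : 0 < p by apply: lt_le_trans pu; apply: exprn_gt0.
have pn : p ^+ 2 <= u * n.
  have c1 : 1 <= c.
    rewrite -[leLHS](powRr0 ((2 : R) ^+ 60)) ler_powR ?(ltW N0) //.
    by rewrite exprn_ege1 // ler1n.
  have h : q%:R `^ e <= n.
    by apply: le_trans (ltW cqe); rewrite ler_peMl ?powR_ge0.
  rewrite -[leLHS](_ : u * q%:R `^ e = _); first by rewrite ler_pM2l.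
  rewrite /u -powRD; last by rewrite qn0 implybT.
  by rewrite addrC subrK -powR_mulrn ?powR_ge0 // -powRrM; congr (_ `^ _); field.
suff [B BA hB] : exists2 B : {set F}, B \subset A &
    (#|F| < 2 * #|prodset (diffset B B) (diffset B B)|)%N.
  have le := subset_leq_card (prod_diffS BA).
  have : (q < 2 * #|prodset (diffset A A) (diffset A A)|)%N.
    by rewrite -qE; apply: leq_trans hB _; rewrite leq_mul2l le.
  by rewrite -(ltr_nat R) natrM ltr_pdivrMr // mulrC.
have u2 : 2 <= u by apply: le_trans u_ge; clear; lra.
have p_ge : 2 <= p.
  apply: (le_trans u2); apply: le_trans pu; rewrite -[leLHS]expr1.
  by apply: ler_weXn2l => //; move: u2; clear; lra.
have [nle|nlt] := lerP n (p ^+ 2).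
  by exists A => //; apply: (@prod_diff_large R F A u p); rewrite // qE.
(* [prod_diff_large] also bounds |A| above by p^2, so a larger set is replaced by a subset of
   floor(p^2) elements; rounding costs at most a factor 2 <= u. *)
have /andP[tle tlt] := truncn_itv (sqr_ge0 p).
have [|B BA cB] := @subset_of_card F A (Num.truncn (p ^+ 2)).
  by rewrite -(ler_nat R) (le_trans tle) // ltW.
exists B => //; apply: (@prod_diff_large R F B u p); rewrite // ?qE // cB //.
set t := Num.truncn _ in tle tlt *.
have h1 : 2 * t%:R <= u * t%:R by rewrite ler_wpM2r.
have h2 : 2 * 2 <= p * p by apply: ler_pM.
by move: tlt; rewrite -natr1; clear -h1 h2; lra.
Qed.

Theorem theoremA (R : realType) :
  exists C k : R, 0 < C /\ 0 < k /\
    forall (q : nat) (Fq : finFieldType) (A : {set Fq}),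
      #|Fq| = q ->
      C * (q%:R `^ (2 / 3 - 1 / 13542)) * (ln q%:R `^ k) < #|A|%:R ->
      q%:R / 2 < #|prodset (diffset A A) (diffset A A)|%:R :> R.
Proof.
apply: prod_diff_threshold; first by rewrite ltr0n.
(* 3 * 4100 = 12300 <= 13542. *)
by rewrite -natrM ler_nat.
Qed.
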